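(* Let $\Omega\subset[0,1]^d$ be open, let $s>3$, let $f\in\mathcal{B}^s(\Omega)$ be real-valued, and assume that the infimum defining $\|f\|_{\mathcal{B}^s(\Omega)}$ is attained at an extension $f_e\in L^1(\mathbb{R}^d)$ of $f$. Let $M\ge 2$ be a constant, let $P_1$ be the uniform distribution on $\{\omega\in\mathbb{R}^d:\|\omega\|_1\le M\}$ and let $P_2$ be the uniform distribution on $\{b\in\mathbb{R}:|b|\le 2M\}$. Let $m\in\mathbb{N}$, let $W_1,\dots,W_m\sim P_1$ be i.i.d. and $B_1,\dots,B_m\sim P_2$ be i.i.d., with $W=(W_1,\dots,W_m)$ and $B=(B_1,\dots,B_m)$ independent. Then there exists an $\mathbb{R}^m$-valued random vector $A=(A_1,\dots,A_m)$, measurable with respect to the $\sigma$-algebra generated by $(W,B)$, such that the random function $$f_m(x)=\frac1m\sum_{i=1}^m A_i\,\sigma(W_i\cdot x+B_i)$$ satisfies the following. If $3<s<6$, then $$\mathbb{E}\left[\|f-f_m\|_{H^2(\Omega)}^2\right]\lesssim \frac{M^{d+7-s}}{m}\,\|f\|_{\mathcal{B}^s(\Omega)}\,\|\hat f_e\|_{L^\infty(\mathbb{R}^d)}+\left(\frac{1}{M^{s-3}}\|f\|_{\mathcal{B}^s(\Omega)}\right)^2 .$$ If $s\ge 6$, then $$\mathbb{E}\left[\|f-f_m\|_{H^2(\Omega)}^2\right]\lesssim \frac{M^{d+1}}{m}\,\|f\|_{\mathcal{B}^s(\Omega)}\,\|\hat f_e\|_{L^\infty(\mathbb{R}^d)}+\left(\frac{1}{M^{s-3}}\|f\|_{\mathcal{B}^s(\Omega)}\right)^2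 .$$ Moreover, in both cases $|A_i|\le C\,\|\hat f_e\|_{L^\infty(\mathbb{R}^d)}\,M^{d+1}$ for all $1\le i\le m$, where $C$ is a universal constant. Here $\lesssim$ means that a universal multiplicative constant is omitted.
   Context: Activation function: $\sigma:\mathbb{R}\to\mathbb{R}$, $\sigma(t)=\sum_{i=0}^{4}(-1)^i\binom{4}{i}\sigma_3(t+2-i)$, where $\sigma_3(t)=[\max(0,t)]^3$; it is supported in $[-2,2]$. Fourier transform convention: the normalization is such that $f(x)=\int_{\mathbb{R}^d}e^{i\omega\cdot x}\hat f(\omega)\,d\omega$, i.e. $\hat f(\omega)=(2\pi)^{-d}\int_{\mathbb{R}^d} f(x)e^{-i\omega\cdot x}\,dx$. Barron space: for $s>0$, $\mathcal{B}^s(\Omega)$ is the set of $f:\Omega\to\mathbb{C}$ with $$\|f\|_{\mathcal{B}^s(\Omega)}:=\inf_{f_e|_\Omega=f}\int_{\mathbb{R}^d}(1+\|\omega\|_1)^s|\hat f_e(\omega)|\,d\omega<\infty,$$ the infimum being over extensions $f_e\in L^1(\mathbb{R}^d)$ of $f$, where $\hat f_e$ is the Fourier transform of $f_e$. Sobolev norm: $\|u\|_{H^2(\Omega)}^2=\int_\Omega u^2\,dx+\sum_{k=1}^d\int_\Omega(\partial_k u)^2\,dx+\sum_{k,l=1}^d\int_\Omega(\partial_{k,l}u)^2\,dx$. *)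

(* Defs.v *)
From HB Require Import structures.
From mathcomp Require Import all_boot all_order all_algebra.
From mathcomp Require Import all_classical all_reals all_analysis.
From mathcomp Require Import complex.
Import Order.TTheory GRing.Theory Num.Theory numFieldNormedType.Exports.

Set Implicit Arguments.
Unset Strict Implicit.
Unset Printing Implicit Defensive.

Local Open Scope classical_set_scope.
Local Open Scope ring_scope.

(* 'rV[R]_n carries the product sigma-algebra, generated by the coordinates
   (as n.-tuple R in the library); it coincides with the Borel sigma-algebra of
   the topology of 'rV[R]_n. *)
Section measurable_rV.
Context (R : realType) (n : nat).

Definition rV_coord (i : 'I_n) (v : 'rV[R]_n) : R := v ord0 i.

Let rV_set0 : g_sigma_preimage rV_coord set0.
Proof. exact: sigma_algebra0. Qed.

Let rV_setC A : g_sigma_preimage rV_coord A -> g_sigma_preimage rV_coord (~` A).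
Proof. exact: sigma_algebraC. Qed.

Let rV_bigcup (F : (set 'rV[R]_n)^nat) :
  (forall i, g_sigma_preimage rV_coord (F i)) ->
  g_sigma_preimage rV_coord (\bigcup_i F i).
Proof. exact: sigma_algebra_bigcup. Qed.

HB.instance Definition _ := @isMeasurable.Build default_measure_display
  'rV[R]_n (g_sigma_preimage rV_coord) rV_set0 rV_setC rV_bigcup.

Lemma measurable_rV_coord i : measurable_fun [set: 'rV[R]_n] (rV_coord i).
Proof.
move=> _ Y mY; rewrite setTI; apply: sub_sigma_algebra => /=.
rewrite -bigcup_seq/=; exists i => /=; first by rewrite mem_index_enum.
by exists Y => //; rewrite setTI.
Qed.

Lemma measurable_fun_rVP d (T : measurableType d) (f : T -> 'rV[R]_n) :
  (forall i, measurable_fun [set: T] (rV_coord i \o f)) ->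
  measurable_fun [set: T] f.
Proof.
move=> mf.
have sub : preimage_set_system [set: T] f (g_sigma_preimage rV_coord)
    `<=` measurable.
  rewrite -g_sigma_preimage_comp.
  apply: smallest_sub; first exact: sigma_algebra_measurable.
  rewrite -bigcup_seq/=; apply: bigcup_sub => i _.
  by move=> A [B mB <-]; exact: mf.
by move=> _ A mA; apply: sub; exists A.
Qed.

End measurable_rV.

Section lebesgue_rV_succ.
Context (R : realType) (n : nat).

Definition rV_cons (p : R * 'rV[R]_n) : 'rV[R]_n.+1 :=
  \row_i oapp (p.2 ord0) p.1 (unlift ord0 i).

Definition rV_uncons (v : 'rV[R]_n.+1) : R * 'rV[R]_n :=
  (v ord0 ord0, \row_j v ord0 (lift ord0 j)).

Lemma rV_consK : cancel rV_cons rV_uncons.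
Proof.
case=> x v; rewrite /rV_uncons; congr pair.
  by rewrite mxE unlift_none.
by apply/rowP => j; rewrite !mxE liftK.
Qed.

Lemma measurable_rV_cons : measurable_fun [set: _] rV_cons.
Proof.
apply: measurable_fun_rVP => i; case: (unliftP ord0 i) => [j|] ->.
  rewrite (_ : _ \o _ = @rV_coord R n j \o snd).
    by apply: measurableT_comp => //; exact: measurable_rV_coord.
  by apply/funext => p; rewrite /= /rV_coord mxE liftK.
rewrite (_ : _ \o _ = fst)//.
by apply/funext => p; rewrite /= /rV_coord mxE unlift_none.
Qed.

Lemma measurable_rV_uncons : measurable_fun [set: _] rV_uncons.
Proof.
apply: measurable_fun_pair.
  exact: (measurable_rV_coord ord0).
apply: measurable_fun_rVP => j.
rewrite (_ : _ \o _ = @rV_coord R n.+1 (lift ord0 j)).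
  exact: measurable_rV_coord.
by apply/funext => v; rewrite /= /rV_coord mxE.
Qed.

Variable mu : {sigma_finite_measure set 'rV[R]_n -> \bar R}.

Definition lebesgue_rV_succ : set 'rV[R]_n.+1 -> \bar R :=
  pushforward (@lebesgue_measure R \x mu)%E rV_cons.

Let lebS0 : lebesgue_rV_succ set0 = 0%E.
Proof. by rewrite /lebesgue_rV_succ /pushforward preimage_set0 measure0. Qed.

Let lebS_ge0 A : (0 <= lebesgue_rV_succ A)%E.
Proof. by rewrite /lebesgue_rV_succ /pushforward; exact: measure_ge0. Qed.

Let lebS_sigma_additive : semi_sigma_additive lebesgue_rV_succ.
Proof.
move=> F mF tF mUF; rewrite /lebesgue_rV_succ /pushforward preimage_bigcup.
apply: measure_semi_sigma_additive.
- by move=> k; rewrite -[X in measurable X]setTI; exact: measurable_rV_cons.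
- apply/trivIsetP => /= i j _ _ ij; rewrite -preimage_setI.
  by move/trivIsetP : tF => /(_ _ _ _ _ ij) ->//; rewrite preimage_set0.
- rewrite -preimage_bigcup -[X in measurable X]setTI.
  exact: measurable_rV_cons.
Qed.

HB.instance Definition _ := isMeasure.Build _ _ _ lebesgue_rV_succ
  lebS0 lebS_ge0 lebS_sigma_additive.

Let lebS_sigma_finite : sigma_finite setT lebesgue_rV_succ.
Proof.
have /sigma_finiteP[F [TF ndF mF]] := sigma_finiteT (@lebesgue_measure R).
have /sigma_finiteP[G [TG ndG mG]] := sigma_finiteT mu.
exists (fun k => rV_uncons @^-1` (F k `*` G k)).
  rewrite -preimage_bigcup (_ : \bigcup_k _ = setT) ?preimage_setT//.
  rewrite -subTset => -[x v] _.
  have [i _ Fx] : (\bigcup_k F k) x by rewrite -TF.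
  have [j _ Gv] : (\bigcup_k G k) v by rewrite -TG.
  exists (maxn i j) => //; split.
    by move: x Fx; exact/subsetPset/ndF/leq_maxl.
  by move: v Gv; exact/subsetPset/ndG/leq_maxr.
move=> k; have [mFk Fk] := mF k; have [mGk Gk] := mG k; split.
  by rewrite -[X in measurable X]setTI; apply: measurable_rV_uncons => //;
    exact: measurableX.
rewrite /lebesgue_rV_succ /pushforward -comp_preimage.
rewrite (_ : rV_uncons \o rV_cons = id) ?preimage_id.
  by rewrite product_measure1E// lte_mul_pinfty// ge0_fin_numE.
by apply/funext => p; exact: rV_consK.
Qed.

HB.instance Definition _ := @Measure_isSigmaFinite.Build _ _ _
  lebesgue_rV_succ lebS_sigma_finite.

End lebesgue_rV_succ.

Fixpoint lebesgue_rV (R : realType) (n : nat) :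
    {sigma_finite_measure set 'rV[R]_n -> \bar R} :=
  match n with
  | 0%N => [the {sigma_finite_measure set 'rV[R]_0 -> \bar R} of \d_(0 : 'rV[R]_0)]
  | k.+1 => [the {sigma_finite_measure set 'rV[R]_k.+1 -> \bar R} of
             lebesgue_rV_succ (lebesgue_rV R k)]
  end.

Lemma lebesgue_rV_box (R : realType) (n : nat) (A : 'I_n -> set R) :
  (forall i, measurable (A i)) ->
  lebesgue_rV R n [set v : 'rV[R]_n | forall i, A i (v ord0 i)] =
  (\prod_(i < n) lebesgue_measure (A i))%E.
Proof.
elim: n A => [|n IH] A mA /=.
  by rewrite big_ord0 diracE mem_set// => -[].
have mB : measurable [set v : 'rV[R]_n | forall i, A (lift ord0 i) (v ord0 i)].
  rewrite [X in measurable X](_ : _ = \bigcap_(i in [set: 'I_n])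
      (@rV_coord R n i @^-1` A (lift ord0 i))); last first.
    apply/seteqP; split => [v h i _|v h i]; first exact: h.
    by have := h i I.
  apply: fin_bigcap_measurable => // i _; rewrite -[X in measurable X]setTI.
  exact: measurable_rV_coord.
rewrite /lebesgue_rV_succ /pushforward big_ord_recl -IH//.
transitivity ((@lebesgue_measure R \x lebesgue_rV R n)%E
    (A ord0 `*` [set v : 'rV[R]_n | forall i, A (lift ord0 i) (v ord0 i)])); last first.
  by have := product_measure1E (@lebesgue_measure R) (lebesgue_rV R n) (mA ord0) mB; apply.
congr ((_ \x _)%E _); apply/seteqP; split => -[x v] /=.
  move=> h; split => [|i].
    by have := h ord0; rewrite mxE unlift_none.
  by have := h (lift ord0 i); rewrite mxE liftK.
by move=> [hx hv] i; rewrite mxE; case: (unliftP ord0 i) => [j|] -> /=.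
Qed.

Section vectors.
Context (R : realType) (d : nat).

Definition dot (u v : 'rV[R]_d) : R := \sum_(k < d) u ord0 k * v ord0 k.

Definition l1norm (u : 'rV[R]_d) : R := \sum_(k < d) `|u ord0 k|.

End vectors.

Definition sigma3 (R : realType) (t : R) : R := Num.max 0 t ^+ 3.

Definition sigma (R : realType) (t : R) : R :=
  \sum_(i < 5) (-1) ^+ i * 'C(4, i)%:R * sigma3 (t + 2 - i%:R).

Section fourier_barron.
Context (R : realType) (d : nat).
Implicit Types (f g : 'rV[R]_d -> R[i]) (Omega : set 'rV[R]_d).

Definition Cintegrable f :=
  (lebesgue_rV R d).-integrable setT (fun x => (complex.Re (f x))%:E) /\
  (lebesgue_rV R d).-integrable setT (fun x => (complex.Im (f x))%:E).

Definition Cintegral f : R[i] :=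
  Complex (\int[lebesgue_rV R d]_x complex.Re (f x))
          (\int[lebesgue_rV R d]_x complex.Im (f x)).

Definition expi (t : R) : R[i] := Complex (cos t) (sin t).

Definition fourier f (w : 'rV[R]_d) : R[i] :=
  ((2 * pi) ^- d)%:C%C * Cintegral (fun x => f x * expi (- dot w x)).

Definition L1_extension Omega f g :=
  Cintegrable g /\ (forall x, Omega x -> g x = f x).

Definition barron_integral (s : R) g : \bar R :=
  (\int[lebesgue_rV R d]_w ((1 + l1norm w) `^ s * Normc.normc (fourier g w))%:E)%E.

Definition barron_norm (s : R) Omega f : \bar R :=
  ereal_inf [set barron_integral s g | g in L1_extension Omega f].

Definition in_barron (s : R) Omega f := (barron_norm s Omega f < +oo)%E.

Definition fourier_Linfty g : \bar R :=
  ('N[lebesgue_rV R d]_+oo [(fun w => (Normc.normc (fourier g w))%:E)])%E.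

End fourier_barron.

Section sobolev.
Context (R : realType) (d : nat).
Implicit Types (u v phi : 'rV[R]_d -> R) (Omega : set 'rV[R]_d).

Definition partial (k : 'I_d) phi : 'rV[R]_d -> R :=
  'D_(delta_mx ord0 k : 'rV[R]_d) phi.

Fixpoint Cn (n : nat) phi : Prop :=
  continuous phi /\
  match n with
  | 0%N => True
  | n'.+1 => forall k : 'I_d,
      (forall x, derivable phi x (delta_mx ord0 k)) /\ Cn n' (partial k phi)
  end.

Definition test_function Omega phi :=
  (forall n, Cn n phi) /\
  exists2 K : set 'rV[R]_d, compact K /\ K `<=` Omega &
    forall x, ~ K x -> phi x = 0.

Definition loc_integrable Omega u :=
  measurable_fun Omega u /\
  forall K : set 'rV[R]_d, compact K -> K `<=` Omega ->
    (lebesgue_rV R d).-integrable K (EFin \o u).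

(* v is the weak derivative of u on Omega along the list of directions ks;
   partial derivatives of test functions commute, so the order of ks does not
   matter. *)
Definition weak_derivative Omega (ks : seq 'I_d) u v :=
  [/\ loc_integrable Omega u, loc_integrable Omega v &
  forall phi, test_function Omega phi ->
    \int[lebesgue_rV R d]_(x in Omega) (u x * foldr partial phi ks x) =
    (-1) ^+ size ks * \int[lebesgue_rV R d]_(x in Omega) (v x * phi x)].

(* Weak derivatives are unique up to a null set, so the infimum is over at most
   one value; it is +oo when one of the weak derivatives does not exist. *)
Definition H2_normsq Omega u : \bar R :=
  ereal_inf [set z | exists D1 : 'I_d -> 'rV[R]_d -> R,
                     exists D2 : 'I_d -> 'I_d -> 'rV[R]_d -> R,
    [/\ forall k, weak_derivative Omega [:: k] u (D1 k),
        forall k l, weak_derivative Omega [:: k; l] u (D2 k l) &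
        z = (\int[lebesgue_rV R d]_(x in Omega) (u x ^+ 2)%:E +
             \sum_(k < d) \int[lebesgue_rV R d]_(x in Omega) (D1 k x ^+ 2)%:E +
             \sum_(k < d) \sum_(l < d)
               \int[lebesgue_rV R d]_(x in Omega) (D2 k l x ^+ 2)%:E)%E]].

End sobolev.

Section randomness.
Context (R : realType) (d d' : measure_display).
Context (T : measurableType d) (U : measurableType d') (P : probability T R).

Definition uniformly_distributed (X : {RV P >-> U}) (mu : set U -> \bar R)
    (K : set U) :=
  forall S, measurable S -> distribution P X S = (mu (S `&` K) / mu K)%E.

Definition mutually_independent (m : nat) (X : 'I_m -> {RV P >-> U}) :=
  forall S : 'I_m -> set U, (forall i, measurable (S i)) ->
    P (\bigcap_(i in [set: 'I_m]) (X i @^-1` S i)) =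
    (\prod_(i < m) P (X i @^-1` S i))%E.

End randomness.

Definition independent_sigma_algebras (R : realType) (d : measure_display)
    (T : measurableType d) (P : probability T R) (F G : set (set T)) :=
  forall A B, F A -> G B -> P (A `&` B) = (P A * P B)%E.

Definition sigma_joint (d d1 d2 : measure_display)
    (T : measurableType d) (U1 : measurableType d1) (U2 : measurableType d2)
    (m n : nat) (X : 'I_m -> T -> U1) (Y : 'I_n -> T -> U2) : set (set T) :=
  <<s g_sigma_preimage X `|` g_sigma_preimage Y >>.

Definition random_net (R : realType) (d m : nat) (a : 'rV[R]_m)
    (w : 'I_m -> 'rV[R]_d) (b : 'I_m -> R) (x : 'rV[R]_d) : R :=
  m%:R^-1 * \sum_(i < m) a ord0 i * sigma (dot (w i) x + b i).

(* Main.v *)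
Require Import Defs.
From HB Require Import structures.
From mathcomp Require Import all_boot all_order all_algebra.
From mathcomp Require Import all_classical all_reals all_analysis.
From mathcomp Require Import measurable_realfun ess_sup_inf.
From mathcomp Require Import complex.
From mathcomp Require Import ring lra.
Import Order.TTheory GRing.Theory Num.Theory numFieldNormedType.Exports.

Set Implicit Arguments.
Unset Strict Implicit.
Unset Printing Implicit Defensive.

Local Open Scope classical_set_scope.
Local Open Scope ring_scope.

(** The network and why it works.

    Let f^ be the Fourier transform of the extension fe, cut off to the l1-ball of
    radius M, and let V be the volume of that ball. The i-th coefficient is
      A_i = (4 M V / spline_hat) Re (f^(W_i) exp (- i B_i)).
    For |theta| <= M the function b |-> sigma (theta + b) is supported in [-2 M, 2 M]
    because M >= 2. Integrating it against a wave of frequency 1 in b returns the wave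
    in theta times the positive number spline_hat, and a derivative of sigma becomes
    a phase shift of a quarter period (integral_cos_spline). Hence every neuron,
    together with its derivatives of order at most two, is an unbiased estimate of
    the part of f, and of its derivatives, that has frequencies of l1-norm at most M
    (atom_mean).

    The mean square error of the average of m independent unbiased estimates is at
    most 1 / m times a second moment (mean_square_average). As sigma vanishes outside
    of [-2, 2], integrating over b costs 4 and not 4 M, and the second moment is at
    most a constant times V M times the integral of (1 + |w|) ^ 4 |f^(w)| ^ 2
    (atom_second_moment). One factor |f^| is bounded by its essential supremum, the
    other one by the Barron norm, at the price of M ^ (6 - s) when s < 6
    (low_frequencies_le); and V <= 2 M ^ d with a constant that does not depend on d
    (l1ball_volume_le). The frequencies beyond M are a bias, at most the integral of
    (1 + |w|) ^ 2 |f^(w)| over |w| > M, that is M ^ (3 - s) times the Barron norm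
    (high_frequencies_le).

    Three points need care. First, f has to be a superposition of waves almost
    everywhere on the cube (fourier_inversion). Damping the inverse Fourier integral
    by exp (- eps |w_j|) in each coordinate turns it into a Poisson integral of f;
    averaging over a box turns the Poisson kernel into a difference of arctangents,
    which tends to the indicator of the box as eps tends to 0. So f and the inverse
    integral have the same integral over all boxes, and they agree almost everywhere
    by a pi-lambda argument. Secondly, the H2 norm is an infimum over weak
    derivatives. Those of f and of the network are explicit: waves and neurons are
    ridge functions, for which the derivatives can be taken from the test function
    one at a time (integral_by_parts_ridge), and Fubini extends this to
    superpositions. The squared norm of the error is thus at most a sum of integrals
    over Omega of squared pointwise errors (H2_normsq_error), to which Tonelli
    applies. Thirdly, the coefficients must be bounded at every sample and not only
    almost surely; the transform is therefore set to 0 where it exceeds its essential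
    supremum, a change that no integral sees. *)

Local Notation "mu .-L1 f" := (mu.-integrable setT (EFin \o f))
  (at level 2, f at level 1, format "mu .-L1  f").

(** * Integration of real-valued functions *)

Section real_integrals.
Context d (T : measurableType d) (R : realType).
Variable mu : {measure set T -> \bar R}.

Lemma integrable_le (f g : T -> R) : measurable_fun setT f ->
  mu.-L1 g -> (forall x, `|f x| <= g x) ->
  mu.-L1 f.
Proof.
move=> mf ig fg; apply: le_integrable ig => //; first exact/measurable_EFinP.
by move=> x _ /=; rewrite lee_fin (le_trans (fg x))// ler_norm.
Qed.

Lemma ae_eq_Rintegral (D : set T) (f g : T -> R) : measurable D ->
  measurable_fun D f -> measurable_fun D g ->
  {ae mu, forall x, D x -> f x = g x} ->
  \int[mu]_(x in D) f x = \int[mu]_(x in D) g x.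
Proof.
move=> mD mf mg fg; congr fine.
apply: ae_eq_integral => //; [exact/measurable_EFinP..|].
by apply: filterS fg => x /= + Dx => ->.
Qed.

Lemma integrable_sumR (D : set T) (I : Type) (s : seq I) (F : I -> T -> R) :
  measurable D -> (forall i, mu.-integrable D (EFin \o F i)) ->
  mu.-integrable D (EFin \o (fun x => \sum_(i <- s) F i x)).
Proof.
move=> mD iF; rewrite (_ : _ \o _ = fun x => (\sum_(i <- s) (F i x)%:E)%E); last first.
  by apply/funext => x /=; rewrite sumEFin.
by apply: integrable_sum => //= i _; exact: iF.
Qed.

Lemma Rintegral_sum (D : set T) (I : Type) (s : seq I) (F : I -> T -> R) :
  measurable D -> (forall i, mu.-integrable D (EFin \o F i)) ->
  \int[mu]_(x in D) (\sum_(i <- s) F i x) =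
  \sum_(i <- s) \int[mu]_(x in D) F i x.
Proof.
move=> mD iF; elim: s => [|i s IH].
  under eq_Rintegral do rewrite big_nil.
  by rewrite big_nil Rintegral_cst// mul0r.
under eq_Rintegral do rewrite big_cons.
by rewrite big_cons RintegralD// ?IH//; exact: integrable_sumR.
Qed.

Lemma EFin_Rintegral (D : set T) (f : T -> R) : measurable D ->
  mu.-integrable D (EFin \o f) ->
  (\int[mu]_(x in D) f x)%:E = (\int[mu]_(x in D) (f x)%:E)%E.
Proof. by move=> mD fi; rewrite fineK//; exact: integrable_fin_num. Qed.

Lemma integrableM_bounded (f g : T -> R) (M : R) :
  mu.-L1 f -> measurable_fun setT g ->
  (forall x, `|g x| <= M) -> mu.-L1 (fun x => f x * g x).
Proof.
move=> fi mg gM.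
have mf : measurable_fun setT f by apply/measurable_EFinP; exact: measurable_int fi.
have : mu.-L1 (fun x => `|f x| * M).
  rewrite (_ : _ \o _ = (fun x => (`|f x|)%:E * M%:E)%E); last exact/funext.
  by apply: integrableZr => //; exact: integrable_norm.
move=> H; apply: (integrable_le _ H); first exact: measurable_funM.
by move=> x; rewrite normrM ler_wpM2l.
Qed.

Lemma integrableZR (D : set T) (f : T -> R) (k : R) : measurable D ->
  mu.-integrable D (EFin \o f) ->
  mu.-integrable D (EFin \o (fun x => k * f x)).
Proof.
move=> mD fi; rewrite (_ : _ \o _ = fun x => (k%:E * (f x)%:E)%E); last exact/funext.
exact: integrableZl.
Qed.

Lemma integrableDR (f g : T -> R) : mu.-L1 f ->
  mu.-L1 g ->
  mu.-L1 (fun x => f x + g x).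
Proof.
move=> fi gi; rewrite (_ : _ \o _ = ((EFin \o f) \+ (EFin \o g))%E); last exact/funext.
exact: integrableD.
Qed.

Lemma integrableBR (f g : T -> R) : mu.-L1 f ->
  mu.-L1 g ->
  mu.-L1 (fun x => f x - g x).
Proof.
move=> fi gi; rewrite (_ : _ \o _ = ((EFin \o f) \- (EFin \o g))%E); last exact/funext.
exact: integrableB.
Qed.

(** The integral of a nonnegative function is a supremum over the simple
    functions below it, hence monotone on all functions. This serves for the
    squared Sobolev norm of the error: as an infimum, it need not be
    measurable in the sample. *)
Lemma ge0_le_integral_lower (f g : T -> \bar R) :
  (forall x, 0 <= f x)%E -> (forall x, f x <= g x)%E ->
  (\int[mu]_x f x <= \int[mu]_x g x)%E.
Proof.
move=> f0 fg; rewrite !ge0_integralTE//; last first.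
  by move=> x; exact: le_trans (f0 x) (fg x).
apply: le_ereal_sup => _ [h hf <-]; exists h => // x.
exact: le_trans (hf x) (fg x).
Qed.

End real_integrals.

Section real_fubini.
Context d1 d2 (T1 : measurableType d1) (T2 : measurableType d2) (R : realType).
Variable m1 : {sigma_finite_measure set T1 -> \bar R}.
Variable m2 : {sigma_finite_measure set T2 -> \bar R}.
Implicit Types f : T1 * T2 -> R.

Lemma integrable_fineT d (T : measurableType d) (mu : {measure set T -> \bar R})
    (F : T -> \bar R) :
  mu.-integrable setT F -> mu.-L1 (fine \o F) /\
  (\int[mu]_x (fine (F x))%:E = \int[mu]_x F x)%E.
Proof.
move=> iF; have mF := measurable_int _ iF.
have mfF : measurable_fun setT (fun x => (fine (F x))%:E).
  by apply/measurable_EFinP; exact: measurableT_comp.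
split.
  apply: le_integrable iF => // x _ /=.
  by case: (F x) => [r| |]//=; rewrite ?normr0 ?leey.
apply: ae_eq_integral => //.
have := integrable_ae measurableT iF.
by apply: filterS => x /= + _ => /(_ I) /fineK ->.
Qed.

Lemma integrable_Rfubini1 f : (m1 \x m2)%E.-L1 f ->
  m1.-L1 (fun x => \int[m2]_y f (x, y)).
Proof. by move=> /integrable_fubini_F /integrable_fineT[]. Qed.

Lemma Rintegral12_prod f : (m1 \x m2)%E.-L1 f ->
  \int[m1]_x \int[m2]_y f (x, y) = \int[(m1 \x m2)%E]_z f z.
Proof.
move=> fi; rewrite /Rintegral; congr fine.
rewrite -(integral12_prod_meas1 fi).
by have [_ ->] := integrable_fineT (integrable_fubini_F fi).
Qed.

Lemma integrable_fubini_G (f : T1 * T2 -> \bar R) :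
  (m1 \x m2)%E.-integrable setT f -> m2.-integrable setT (fubini_G m1 f).
Proof.
move=> fi; have mf := measurable_int _ fi; apply/integrableP; split.
  exact: measurable_fubini_G fi.
apply: le_lt_trans ((integrable21ltyP m1 m2 mf).1 fi).
apply: ge0_le_integral_lower => y; first exact: abse_ge0.
apply: le_abse_integral => //.
exact: measurableT_comp mf (measurable_pair2 y).
Qed.

Lemma integrable_Rfubini2 f : (m1 \x m2)%E.-L1 f ->
  m2.-L1 (fun y => \int[m1]_x f (x, y)).
Proof. by move=> /integrable_fubini_G /integrable_fineT[]. Qed.

Lemma Rintegral21_prod f : (m1 \x m2)%E.-L1 f ->
  \int[m2]_y \int[m1]_x f (x, y) = \int[(m1 \x m2)%E]_z f z.
Proof.
move=> fi; rewrite /Rintegral; congr fine.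
rewrite -(integral21_prod_meas1 fi).
by have [_ ->] := integrable_fineT (integrable_fubini_G fi).
Qed.

Lemma Rfubini f : (m1 \x m2)%E.-L1 f ->
  \int[m1]_x \int[m2]_y f (x, y) = \int[m2]_y \int[m1]_x f (x, y).
Proof. by move=> fi; rewrite Rintegral12_prod// Rintegral21_prod. Qed.

Lemma integrable_prod_le f (g : T1 -> R) (h : T2 -> R) :
  measurable_fun setT f -> m1.-L1 g ->
  m2.-L1 h ->
  (forall x y, `|f (x, y)| <= `|g x| * `|h y|) ->
  (m1 \x m2)%E.-L1 f.
Proof.
move=> mf gi hi fgh.
have mg := measurable_int _ gi; have mh := measurable_int _ hi.
apply/integrable12ltyP; first exact/measurable_EFinP.
have hoo : (\int[m2]_y `|(h y)%:E| < +oo)%E by case/integrableP : hi.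
have goo : (\int[m1]_x `|(g x)%:E| < +oo)%E by case/integrableP : gi.
apply: (@le_lt_trans _ _ (\int[m1]_x (`|(g x)%:E| * \int[m2]_y `|(h y)%:E|))%E).
  apply: ge0_le_integral_lower => x; first exact: integral_ge0.
  rewrite -ge0_integralZl//; last exact: measurableT_comp.
  apply: ge0_le_integral_lower => y; first exact: abse_ge0.
  by rewrite /= -EFinM lee_fin.
rewrite ge0_integralZr//; last 2 first.
- exact: measurableT_comp.
- exact: integral_ge0.
by rewrite lte_mul_pinfty// ?integral_ge0// ge0_fin_numE// integral_ge0.
Qed.

End real_fubini.

(** * Measurability and Fubini on row vectors *)

Section measurability_rV.
Context (R : realType) (n : nat).

Lemma measurable_rV_entry d (T : measurableType d) (f : T -> 'rV[R]_n) i :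
  measurable_fun setT f -> measurable_fun setT (fun t => f t ord0 i).
Proof.
by move=> mf; exact: (measurableT_comp (measurable_rV_coord (R:=R) i) mf).
Qed.

Lemma measurable_dot d (T : measurableType d) (f g : T -> 'rV[R]_n) :
  measurable_fun setT f -> measurable_fun setT g ->
  measurable_fun setT (fun t => dot (f t) (g t)).
Proof.
move=> mf mg; apply: measurable_sum => k.
by apply: measurable_funM; exact: measurable_rV_entry.
Qed.

Lemma measurable_l1norm d (T : measurableType d) (f : T -> 'rV[R]_n) :
  measurable_fun setT f -> measurable_fun setT (fun t => l1norm (f t)).
Proof.
move=> mf; apply: measurable_sum => k.
by apply: measurableT_comp => //; exact: measurable_rV_entry.
Qed.

Lemma measurable_rV_box (A : 'I_n -> set R) : (forall i, measurable (A i)) ->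
  measurable [set v : 'rV[R]_n | forall i, A i (v ord0 i)].
Proof.
move=> mA; rewrite [X in measurable X](_ : _ = \bigcap_(i in [set: 'I_n])
    (@rV_coord R n i @^-1` A i)); last first.
  apply/seteqP; split => [v h i _|v h i]; first exact: h.
  by have := h i I.
apply: fin_bigcap_measurable => // i _; rewrite -[X in measurable X]setTI.
exact: measurable_rV_coord.
Qed.

(** An open set is the union of the balls of rational centre and radius that it
    contains, which are countably many boxes. *)
Lemma open_measurable_rV (U : set 'rV[R]_n) : open U -> measurable U.
Proof.
move=> oU.
pose c (q : 'rV[rat]_n) : 'rV[R]_n := map_mx ratr q.
pose D := [set p : 'rV[rat]_n * nat | ball (c p.1) (p.2.+1%:R^-1 : R) `<=` U].
have -> : U = \bigcup_(p in D) ball (c p.1) (p.2.+1%:R^-1 : R).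
  apply/seteqP; split => [x Ux|x [p Dp]]; last exact: Dp.
  have /nbhs_ballP[e /= e0 eU] : nbhs x U by exact: open_nbhs_nbhs.
  have [k ke] : exists k : nat, (k.+1%:R^-1 : R) < e / 2.
    have /ltr_add_invr[k] : 0 < e / 2 by rewrite divr_gt0.
    by rewrite add0r => ?; exists k.
  have k0 : 0 < (k.+1%:R^-1 : R) by rewrite invr_gt0.
  have [q qx] : exists q : 'rV[rat]_n, forall i, ball (x ord0 i) (k.+1%:R^-1 : R) (ratr (q ord0 i)).
    have : forall i : 'I_n, exists r : rat, ball (x ord0 i) (k.+1%:R^-1 : R) (ratr r).
      move=> i; have /rat_in_itvoo[r] : x ord0 i - k.+1%:R^-1 < x ord0 i + k.+1%:R^-1.
        by rewrite ltrBlDr -addrA ltrDl addr_gt0.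
      rewrite in_itv/= => ri; exists r; rewrite /ball/= distrC ltr_distl.
      by [].
    by move=> /choice[g gP]; exists (\row_i g i) => i; rewrite mxE.
  exists (q, k); last first.
    by split => // i j; rewrite ord1 mxE; apply: ball_sym; exact: qx.
  move=> y /= [_ yq]; apply: eU; split => // i j.
  apply: (@le_ball _ _ _ (k.+1%:R^-1 + k.+1%:R^-1)).
    by rewrite [leRHS]splitr lerD// ltW.
  apply: (@ball_triangle _ R^o (ratr (q ord0 j))).
    by rewrite ord1; exact: qx.
  by have := yq i j; rewrite ord1 mxE.
rewrite bigcup_mkcond; apply: countable_bigcupT_measurable => // -[q k] /=.
case: ifPn => // _.
rewrite (_ : ball _ _ = [set v : 'rV[R]_n | forall i, ball (c q ord0 i) (k.+1%:R^-1 : R) (v ord0 i)]).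
  by apply: (measurable_rV_box (A := fun i => ball (c q ord0 i) k.+1%:R^-1)) => i;
    exact: measurable_ball.
apply/seteqP; split => [v [_ h] i|v h]; first exact: h.
by split; [rewrite invr_gt0|move=> i j; rewrite ord1; exact: h].
Qed.

Lemma continuous_measurable_rV (f : 'rV[R]_n -> R) :
  continuous f -> measurable_fun setT f.
Proof.
move=> /continuousP cf; apply: (measurability _ (RGenOpens.measurableE R)).
move=> _ [_ [a [b ->] <-]]; rewrite setTI; apply: open_measurable_rV.
exact/cf/interval_open.
Qed.

Lemma closed_measurable_rV (K : set 'rV[R]_n) : closed K -> measurable K.
Proof.
by move=> cK; rewrite -(setCK K); apply: measurableC;
  apply: open_measurable_rV; exact: closed_openC.
Qed.

End measurability_rV.

Section fubini_rV.
Context (R : realType) (n : nat).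
Local Notation mu := (@lebesgue_measure R).

Lemma ge0_integral_rV_succ (f : 'rV[R]_n.+1 -> \bar R) :
  measurable_fun setT f -> (forall v, 0 <= f v)%E ->
  (\int[lebesgue_rV R n.+1]_v f v =
   \int[mu]_t \int[lebesgue_rV R n]_v f (rV_cons (t, v)))%E.
Proof.
move=> mf f0.
have H0 := fun phi m => @ge0_integral_pushforward _ _ _ _ R phi m
  (mu \x lebesgue_rV R n)%E setT f measurableT mf (fun v _ => f0 v).
have := H0 (@rV_cons R n) (@measurable_rV_cons R n); rewrite preimage_setT => H {H0}.
have mfc : measurable_fun setT (f \o @rV_cons R n).
  by apply: (measurableT_comp mf); exact: measurable_rV_cons.
rewrite -(@fubini_tonelli1 _ _ _ _ R mu (lebesgue_rV R n) (f \o @rV_cons R n) mfc)//.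
by move=> x; exact: f0.
Qed.

Lemma integrable_rV_succ (f : 'rV[R]_n.+1 -> R) :
  (lebesgue_rV R n.+1).-L1 f ->
  (mu \x lebesgue_rV R n)%E.-L1 (f \o @rV_cons R n).
Proof.
move=> /integrableP[mf foo].
have mfc : measurable_fun setT (EFin \o (f \o @rV_cons R n)).
  by apply: (measurableT_comp mf); exact: measurable_rV_cons.
apply/integrable12ltyP => //.
by rewrite ge0_integral_rV_succ// in foo; exact: measurableT_comp.
Qed.

Lemma Rintegral_rV_succ (f : 'rV[R]_n.+1 -> R) :
  (lebesgue_rV R n.+1).-L1 f ->
  \int[lebesgue_rV R n.+1]_v f v =
  \int[mu]_t \int[lebesgue_rV R n]_v f (rV_cons (t, v)).
Proof.
move=> fi; have fci := integrable_rV_succ fi.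
rewrite (Rintegral12_prod fci); congr fine.
have /measurable_EFinP mf := measurable_int _ fi.
have H0 := fun phi m => @integral_pushforward _ _ _ _ R phi m
  (mu \x lebesgue_rV R n)%E setT (EFin \o f) (measurable_int _ fi).
have := H0 (@rV_cons R n) (@measurable_rV_cons R n).
by rewrite preimage_setT => /(_ fci measurableT) <-.
Qed.

Lemma Rintegral_rV_succ' (f : 'rV[R]_n.+1 -> R) :
  (lebesgue_rV R n.+1).-L1 f ->
  \int[lebesgue_rV R n.+1]_v f v =
  \int[lebesgue_rV R n]_v \int[mu]_t f (rV_cons (t, v)).
Proof.
move=> fi; rewrite Rintegral_rV_succ//.
exact: (Rfubini (integrable_rV_succ fi)).
Qed.

End fubini_rV.

Lemma rV_cons0 (R : realType) n (t : R) (v : 'rV[R]_n) :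
  rV_cons (t, v) ord0 ord0 = t.
Proof. by rewrite mxE unlift_none. Qed.

Lemma rV_consS (R : realType) n (t : R) (v : 'rV[R]_n) j :
  rV_cons (t, v) ord0 (lift ord0 j) = v ord0 j.
Proof. by rewrite mxE liftK. Qed.

Lemma ge0_integral_prod_rV (R : realType) n (k : 'I_n -> R -> R) :
  (forall j, measurable_fun setT (k j)) -> (forall j t, 0 <= k j t) ->
  (\int[lebesgue_rV R n]_v (\prod_j k j (v ord0 j))%:E =
   \prod_(j < n) \int[@lebesgue_measure R]_t (k j t)%:E)%E.
Proof.
elim: n k => [|n IH] k mk k0.
  rewrite big_ord0 /=; under eq_integral do rewrite big_ord0.
  by rewrite integral_cst//= diracT mul1e.
rewrite ge0_integral_rV_succ; last 2 first.
- apply/measurable_EFinP; apply: measurable_prod => j _.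
  by apply: measurableT_comp => //; exact: (measurable_rV_coord (R:=R)).
- by move=> v; rewrite lee_fin prodr_ge0.
under eq_integral => t _.
  under eq_integral => v _.
    rewrite big_ord_recl rV_cons0.
    under eq_bigr do rewrite rV_consS.
    rewrite EFinM.
    over.
  rewrite ge0_integralZl//; last 3 first.
  - apply/measurable_EFinP; apply: measurable_prod => j _.
    by apply: measurableT_comp => //; exact: (measurable_rV_coord (R:=R)).
  - by move=> v _; rewrite lee_fin prodr_ge0.
  - by rewrite lee_fin.
  rewrite (IH (fun j => k (lift ord0 j)))//.
  over.
rewrite ge0_integralZr//; last 3 first.
- by apply/measurable_EFinP; exact: mk.
- by move=> t _; rewrite lee_fin.
- by apply: prode_ge0 => j _; apply: integral_ge0 => t _; rewrite lee_fin.
by rewrite big_ord_recl.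
Qed.

Lemma lebesgue_rV_cube_le1 (R : realType) n (A : set 'rV[R]_n) : measurable A ->
  A `<=` [set x : 'rV[R]_n | forall k, 0 <= x ord0 k <= 1] ->
  (lebesgue_rV R n A <= 1)%E.
Proof.
move=> mA A1.
have := lebesgue_rV_box (n := n) (fun _ => measurable_itv `[(0:R), 1]).
rewrite big1 => [<-|i _]; last by rewrite lebesgue_measure_itv/= lte_fin ltr01 oppr0 adde0.
apply: le_measure => //; rewrite ?inE//.
  by apply: (measurable_rV_box (A := fun=> `[0, 1]%classic)) => _; exact: measurable_itv.
Qed.

Lemma lebesgue_rV_hyperplane (R : realType) n (i : 'I_n) (a : R) :
  lebesgue_rV R n [set v | v ord0 i = a] = 0%E.
Proof.
pose A (j : 'I_n) : set R := if j == i then [set a] else setT.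
rewrite (_ : mkset _ = [set v | forall j, A j (v ord0 j)]); last first.
  apply/seteqP; split => v /=.
    by move=> h j; rewrite /A; case: eqP => [->|].
  by move/(_ i); rewrite /A eqxx.
rewrite lebesgue_rV_box; last by move=> j; rewrite /A; case: ifP.
by rewrite (bigD1 i)//= /A eqxx lebesgue_measure_set1 mul0e.
Qed.

Lemma integral_FTC (R : realType) (f F : R -> R) (a b : R) : a <= b ->
  continuous f -> (forall x : R, is_derive x (1 : R) F (f x)) ->
  (\int[@lebesgue_measure R]_(t in `[a, b]) (f t)%:E = (F b - F a)%:E)%E.
Proof.
rewrite le_eqVlt => /predU1P[->|ab] cf dF.
  by rewrite set_itv1 integral_set1 subrr.
have cF : continuous F.
  by move=> x; apply/differentiable_continuous/derivable1_diffP; have [] := dF x.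
rewrite (continuous_FTC2 (F := F) ab)//.
- exact: continuous_subspaceT.
- split; first by move=> x _; have [] := dF x.
  + by apply: cvg_at_right_filter; exact: cF.
  + by apply: cvg_at_left_filter; exact: cF.
- by move=> x _; rewrite derive1E; have [] := dF x.
Qed.

Section l1ball.
Context (R : realType).
Local Notation mu := (@lebesgue_measure R).

Lemma l1norm_cons n (t : R) (v : 'rV[R]_n) : l1norm (rV_cons (t, v)) = `|t| + l1norm v.
Proof.
rewrite /l1norm big_ord_recl rV_cons0; congr (_ + _).
by apply: eq_bigr => j _; rewrite rV_consS.
Qed.

Definition l1ball n (r : R) : set 'rV[R]_n := [set w | l1norm w <= r].
Arguments l1ball : clear implicits.

Lemma measurable_l1ball n (r : R) : measurable (l1ball n r).
Proof.
rewrite /l1ball (_ : [set _ | _] = (@l1norm R n) @^-1` `]-oo, r]); last first.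
  by apply/seteqP; split => w /=; rewrite in_itv.
rewrite -[X in measurable X]setTI.
by apply: (measurable_l1norm (f := id)) => //; exact: measurable_itv.
Qed.

Lemma integral_tent (r : R) : 0 <= r ->
  (\int[mu]_t (Num.max 0 (r - `|t|))%:E = (r ^+ 2)%:E)%E.
Proof.
move=> r0.
pose f : R -> R := fun t => Num.max 0 (r - `|t|).
have cf : continuous f.
  move=> x; apply: (@continuous_max _ _ (cst 0) (fun t => r - `|t|)); first exact: cst_continuous.
  apply: continuousB; first exact: cst_continuous.
  exact: norm_continuous.
rewrite (ge0_symfun_integralT (f := f))//; last 2 first.
- by move=> x; rewrite /f le_max lexx.
- by move=> x; rewrite /f /= normrN.
rewrite (_ : [set x | _] = `[0, +oo[%classic); last by rewrite set_itvcy.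
rewrite (@itv_bndbnd_setU _ _ _ (BRight r))//.
have mfE (D : set R) : measurable_fun D (EFin \o f).
  by apply/measurable_EFinP; apply: measurable_funTS; exact: continuous_measurable_fun.
rewrite ge0_integral_setU//=; last 3 first.
- exact: mfE.
- by move=> x _; rewrite lee_fin /f le_max lexx.
- apply/disj_setPS => y [/=]; rewrite !in_itv/= => /andP[_ yr].
  by rewrite andbT ltNge yr.
rewrite [X in (_ + X)%E](_ : _ = 0%E) ?adde0; last first.
  apply: integral0_eq => x /=; rewrite in_itv/= andbT => rx.
  by rewrite /f max_l// subr_le0 (le_trans (ltW rx))// ler_norm.
transitivity (2 * \int[mu]_(x in `[0%R, r]) (r - x)%:E)%E.
  congr (_ * _)%E; apply: eq_integral => x; rewrite inE/= in_itv/= => /andP[x0 xr].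
  by rewrite /f ger0_norm// max_r// subr_ge0.
have dF (x : R) : is_derive x (1 : R) (fun t : R => r * t - 2^-1 * t ^+ 2) (r - x).
  by apply: is_derive_eq; rewrite /GRing.scale/=; field.
rewrite (integral_FTC r0 _ dF); first by rewrite -EFinM; congr EFin; field.
  by move=> x; apply: continuousB; [exact: cst_continuous|exact: cvg_id].
Qed.

(** By induction on the dimension: the slice of the ball at t is a ball of
    radius r - |t|, and one of the factors r - |t| of its volume bound is
    integrated exactly, the others being bounded by r. That the constant 2
    does not depend on the dimension is what makes the final constant
    universal. *)
Lemma l1ball_volume_le n (r : R) : 0 <= r ->
  (lebesgue_rV R n.+1 (l1ball n.+1 r) <= (2 * r ^+ n.+1)%:E)%E.
Proof.
elim: n r => [|n IH] r r0.
  have -> : l1ball 1 r = [set v | forall j, `[- r, r]%classic (v ord0 j)].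
    apply/seteqP; split => v /=; rewrite /l1ball/= /l1norm big_ord1.
      by rewrite ler_norml => h j; rewrite (ord1 j) in_itv/=.
    by move/(_ ord0); rewrite in_itv/= ler_norml.
  rewrite (lebesgue_rV_box (fun=> measurable_itv `[- r, r])) big_ord1 lebesgue_measure_itv/= lte_fin.
  by case: ifP => _; rewrite -?EFinD lee_fin ?opprK; lra.
have mB := @measurable_l1ball n.+2 r.
have := integral_indic (lebesgue_rV R n.+2) measurableT mB.
rewrite setIT => <-.
rewrite ge0_integral_rV_succ; last 2 first.
- by apply/measurable_EFinP; exact: measurable_indic.
- by move=> v; rewrite lee_fin.
apply: (@le_trans _ _ (\int[mu]_t ((2 * r ^+ n)%:E * (Num.max 0 (r - `|t|))%:E))%E); last first.
  rewrite ge0_integralZl_EFin//.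
  - by rewrite integral_tent// -EFinM lee_fin -mulrA -exprD addn2.
  - by move=> x _; rewrite lee_fin le_max lexx.
  - by apply/measurable_EFinP; apply: measurable_maxr => //; apply: measurable_funB => //; exact: measurableT_comp.
  - by rewrite mulr_ge0// exprn_ge0.
apply: ge0_le_integral_lower => t; first by apply: integral_ge0 => v _; rewrite lee_fin.
have [tr|tr] := ltP r `|t|.
  rewrite max_l ?mule0; last by rewrite subr_le0 ltW.
  rewrite integral0_eq// => v _.
  rewrite indicE memNset// /l1ball/= l1norm_cons => tvr.
  have : 0 <= l1norm v by apply: sumr_ge0.
  lra.
rewrite max_r ?subr_ge0//.
rewrite (eq_integral (EFin \o \1_(l1ball n.+1 (r - `|t|)))); last first.
  move=> v _ /=; rewrite !indicE; rewrite (_ : (_ \in _) = (v \in l1ball n.+1 (r - `|t|)))//.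
  by apply/idP/idP; rewrite !inE /l1ball/= l1norm_cons; lra.
rewrite integral_indic// ?setIT; last exact: measurable_l1ball.
apply: (le_trans (IH _ _)); first by rewrite subr_ge0.
rewrite -EFinM lee_fin exprSr -mulrA ler_wpM2l// ler_wpM2r ?subr_ge0//.
by rewrite lerXn2r ?nnegrE ?subr_ge0// gerBl.
Qed.

End l1ball.
Arguments l1ball {R} n r.

(** * The cubic spline activation *)

Section spline.
Context (R : realType).
Local Notation mu := (@lebesgue_measure R).
Implicit Types t x c th : R.

(** The j-th derivative of the activation for j at most 2; the falling
    factorial comes from differentiating a cube j times. *)
Definition spline (j : nat) t : R :=
  (3 ^_ j)%:R * \sum_(i < 5) (-1) ^+ i * 'C(4, i)%:R *
    Num.max 0 (t + 2 - i%:R) ^+ (3 - j).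

Lemma spline0 : spline 0 = @sigma R.
Proof. by apply/funext => t; rewrite /spline ffactn0 mul1r. Qed.

Lemma is_derive_translate (f : R -> R) (a x df : R) :
  is_derive (a + x) (1 : R) f df -> is_derive x (1 : R) (fun t => f (a + t)) df.
Proof.
move=> d; have d1 : is_derive x (1 : R) (fun t : R => a + t) (1 : R).
  by have := is_deriveD (is_derive_cst a x (1 : R)) (is_derive_id x (1 : R)); rewrite add0r.
by have := @is_derive1_comp _ _ (fun t => a + t) _ _ _ d d1; rewrite mulr1.
Qed.

Lemma is_derive_reflect (f : R -> R) (a x df : R) :
  is_derive (a - x) (1 : R) f df -> is_derive x (1 : R) (fun t => f (a - t)) (- df).
Proof.
move=> d; have d1 : is_derive x (1 : R) (fun t : R => a - t) (-1 : R).
  by have := is_deriveB (is_derive_cst a x (1 : R)) (is_derive_id x (1 : R)); rewrite sub0r.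
by have := @is_derive1_comp _ _ (fun t => a - t) _ _ _ d d1; rewrite mulrN1.
Qed.

Lemma is_derive_relu_exp n x :
  is_derive x (1 : R) (fun t : R => Num.max 0 t ^+ n.+2)
    (n.+2%:R * Num.max 0 x ^+ n.+1).
Proof.
have [x0|x0|x0] := ltgtP x 0.
- rewrite expr0n/= mulr0.
  apply: (@near_eq_is_derive _ _ _ (cst 0)).
    near=> t; rewrite /cst max_l ?expr0n//.
    by apply: ltW; near: t; exact: lt_nbhsl.
- apply: (@near_eq_is_derive _ _ _ (fun t : R => t ^+ n.+2)).
    near=> t; rewrite max_r//.
    by apply: ltW; near: t; exact: lt_nbhsr.
  have := @is_deriveX _ _ id n.+2 x (1 : R) (1 : R) (is_derive_id x (1 : R)).
  rewrite [_%:A]mulr1 (_ : id ^+ n.+2 = (fun t : R => t ^+ n.+2))//.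
  by apply/funext => t; rewrite fctE.
rewrite x0 expr0n/= mulr0.
have H : h^-1 *: (((fun t : R => Num.max 0 t ^+ n.+2) \o shift 0) (h *: (1 : R)) -
    Num.max 0 0 ^+ n.+2) @[h --> 0^'] --> (0 : R).
  apply/cvgrPdist_le => /= e e0; near=> h.
  have h0 : h != 0 by near: h; exact: nbhs_dnbhs_neq.
  rewrite maxxx expr0n/= subr0 sub0r normrN /GRing.scale/= mulr1 addr0.
  have h1 : `|h| <= Num.min 1 e.
    near: h; apply: dnbhs0_le; rewrite lt_min ltr01 e0 //.
  have mh : `|Num.max 0 h| <= `|h|.
    by rewrite maxEle; case: ifPn; rewrite ?normr0.
  rewrite normrM normfV ler_pdivrMl ?normr_gt0// normrX mulrC.
  rewrite (le_trans (lerXn2r _ _ _ mh)) ?nnegrE// exprSr.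
  rewrite ler_wpM2r// exprSr (le_trans (y := 1 * `|h|))//.
    by rewrite ler_wpM2r// exprn_ile1// (le_trans h1)// ge_min lexx.
  by rewrite mul1r (le_trans h1)// ge_min lexx orbT.
split; first by apply/cvg_ex; exists 0.
exact/cvg_lim.
Unshelve. all: by end_near. Qed.

Lemma is_derive_spline j t : (j < 2)%N ->
  is_derive t (1 : R) (spline j) (spline j.+1 t).
Proof.
move=> j2; rewrite /spline.
have dd (i : 'I_5) : is_derive t (1 : R)
   (fun t => (-1) ^+ i * 'C(4, i)%:R * Num.max 0 (t + 2 - i%:R) ^+ (3 - j))
   ((-1) ^+ i * 'C(4, i)%:R * ((3 - j)%:R * Num.max 0 (t + 2 - i%:R) ^+ (3 - j.+1))).
  have d2 : is_derive ((2 - i%:R) + t) (1 : R) (fun t : R => Num.max 0 t ^+ (3 - j))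
      ((3 - j)%:R * Num.max 0 ((2 - i%:R) + t) ^+ (3 - j.+1)).
    by case: j j2 => [|[|//]] _; exact: is_derive_relu_exp.
  have d3 := is_derive_translate d2.
  have E u : (2 - i%:R) + u = u + 2 - i%:R by rewrite addrC addrA.
  rewrite E in d3; under [X in is_derive _ _ X _]eq_fun do rewrite -E.
  have := @is_deriveZ _ _ _ _ ((-1) ^+ i * 'C(4, i)%:R) _ _ _ d3.
  by [].
have := is_derive_sum dd.
move=> /(@is_deriveZ _ _ _ _ (3 ^_ j)%:R _ _ _) /is_derive_eq H.
have -> : (fun t => (3 ^_ j)%:R * \sum_(i < 5) (-1) ^+ i * 'C(4, i)%:R * Num.max 0 (t + 2 - i%:R) ^+ (3 - j)) =
  (3 ^_ j)%:R *: \sum_(i < 5) (fun t => (-1) ^+ i * 'C(4, i)%:R * Num.max 0 (t + 2 - i%:R) ^+ (3 - j)).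
  by apply/funext => u; rewrite /GRing.scale/= fct_sumE.
apply: H; rewrite /GRing.scale/= ffactnSr natrM -mulrA; congr (_ * _).
by rewrite mulr_sumr; apply: eq_bigr => i _; ring.
Qed.

Lemma continuous_sum_ord (X : topologicalType) n (F : 'I_n -> X -> R) :
  (forall i, continuous (F i)) -> continuous (fun t : X => \sum_(i < n) F i t).
Proof.
elim: n F => [|n IH] F cF t.
  rewrite (_ : (fun _ => _) = cst 0); first exact: cvg_cst.
  by apply/funext => u; rewrite big_ord0.
rewrite (_ : (fun _ => _) = (fun u : X => \sum_(i < n) F (widen_ord (leqnSn n) i) u + F ord_max u)).
  by apply: cvgD; [apply: IH => i; exact: cF|exact: cF].
by apply/funext => u; rewrite big_ord_recr.
Qed.

Lemma continuous_spline j : (j <= 2)%N -> continuous (spline j).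
Proof.
move=> j2 t.
case: (ltnP j 2) => [jlt|jge].
  apply/differentiable_continuous/derivable1_diffP.
  by have [] := is_derive_spline t jlt.
have -> : j = 2%N by apply/eqP; rewrite eqn_leq j2.
rewrite /spline; apply: cvgM; first exact: cvg_cst.
apply: (continuous_sum_ord (F := fun (i : 'I_5) t => (-1) ^+ i * 'C(4, i)%:R *
    Num.max 0 (t + 2 - i%:R) ^+ (3 - 2))) => i {}t; apply: cvgM; first exact: cvg_cst.
rewrite /=; under [in X in cvg_to X]eq_fun do rewrite expr1.
rewrite expr1.
apply: (@continuous_max _ _ (cst 0) (fun t => t + 2 - i%:R)); first exact: cst_continuous.
by apply: cvgB; [apply: cvgD; [exact: cvg_id|exact: cvg_cst]|exact: cvg_cst].
Qed.

(** Right of its support the spline is a fourth difference of a polynomial of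
    degree at most three. *)
Lemma spline_outside j t : (j <= 2)%N -> 2 <= `|t| -> spline j t = 0.
Proof.
move=> j2; rewrite /spline ler_normr => /orP[t2|t2].
  suff -> : \sum_(i < 5) (-1) ^+ i * 'C(4, i)%:R * Num.max 0 (t + 2 - i%:R) ^+ (3 - j) = 0 :> R.
    by rewrite mulr0.
  rewrite (eq_bigr (fun i : 'I_5 => (-1) ^+ i * 'C(4, i)%:R * (t + 2 - i%:R) ^+ (3 - j))); last first.
    move=> i _; rewrite max_r//.
    have : (i%:R : R) <= 4 by rewrite ler_nat -ltnS.
    lra.
  case: j j2 => [|[|[|//]]] _; rewrite !big_ord_recr big_ord0/= /bump/=;
    rewrite -?[binomial _ _]/(_) /binomial/=; ring.
rewrite big1 ?mulr0// => i _; rewrite max_l ?expr0n ?subn_eq0; last first.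
  have : 0 <= (i%:R : R) by [].
  lra.
by rewrite leqNgt ltnS j2/= mulr0.
Qed.

(** The falling factorial is at most 6, the binomial coefficients sum to 16,
    and on the support each truncated power is at most 4 ^ 3. *)
Definition spline_sup : R := 6 * (16 * 64).

Lemma spline_bound j t : (j <= 2)%N -> `|spline j t| <= spline_sup.
Proof.
move=> j2; have [t2|t2] := leP 2 `|t|; first by rewrite spline_outside// normr0 /spline_sup !mulr_ge0.
rewrite /spline normrM ger0_norm//.
have f6 : ((3 ^_ j)%:R : R) <= 6 by rewrite ler_nat; case: j j2 => [|[|[|]]].
have S : `|\sum_(i < 5) (-1) ^+ i * 'C(4, i)%:R * Num.max 0 (t + 2 - i%:R) ^+ (3 - j)|
    <= \sum_(i < 5) 'C(4, i)%:R * 64.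
  apply: (le_trans (ler_norm_sum _ _ _)); apply: ler_sum => i _.
  rewrite !normrM normrX normrN1 expr1n mul1r ger0_norm// ler_wpM2l//.
  have m4 : 0 <= Num.max 0 (t + 2 - i%:R) <= 4.
    rewrite le_max lexx/= ge_max; apply/andP; split => //.
    have := ltW t2; rewrite ler_norml => /andP[_ ?].
    have : 0 <= (i%:R : R) by [].
    lra.
  case/andP: m4 => m0 m4; rewrite ger0_norm ?exprn_ge0//.
  apply: (@le_trans _ _ (4 ^+ (3 - j))); first by rewrite lerXn2r ?nnegrE.
  by rewrite (le_trans (y := 4 ^+ 3))// ?ler_weXn2l ?leq_subr//; lra.
have -> : spline_sup = 6 * \sum_(i < 5) ('C(4, i)%:R * 64) :> R.
  by rewrite /spline_sup -mulr_suml; congr (_ * (_ * _));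
    rewrite !big_ord_recr big_ord0/= /binomial/=; ring.
by apply: ler_pM.
Qed.

Lemma measurable_spline j : (j <= 2)%N -> measurable_fun setT (spline j).
Proof. by move=> j2; apply: continuous_measurable_fun; exact: continuous_spline. Qed.

(** The Fourier transform of the activation at frequency 1, without the
    normalizing factor: 6 from the truncated cube and the square of 2 - 2 cos
    1 from the fourth difference. *)
Definition spline_hat : R := 6 * (2 - 2 * cos 1) ^+ 2.

Lemma spline_hat_gt0 : 0 < spline_hat.
Proof.
rewrite /spline_hat mulr_gt0// exprn_even_gt0//=.
have s0 : 0 < sin (1 : R) by apply: sin_gt0_pi; rewrite ltr01/= (lt_le_trans _ (pi_ge2 R)) ?ltr1n.
apply/eqP => c1.
have {}c1 : cos 1 = 1 :> R by lra.
have := cos2Dsin2 (1 : R); rewrite c1 expr1n.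
have : 0 < sin (1 : R) ^+ 2 by rewrite exprn_gt0.
lra.
Qed.

Let cont_cos (c : R) : continuous (fun b : R => cos (c - b)).
Proof.
move=> b; apply: (continuous_comp (f := fun b => c - b)).
  by apply: cvgB; [exact: cvg_cst|exact: cvg_id].
exact: continuous_cos.
Qed.

Lemma is_derive_cosB c x : is_derive x (1 : R) (fun b => cos (c - b)) (sin (c - x)).
Proof.
by apply: is_derive_eq (is_derive_reflect (is_derive_cos (c - x))) _; rewrite opprK.
Qed.

Lemma is_derive_sinB c x : is_derive x (1 : R) (fun b => sin (c - b)) (- cos (c - x)).
Proof.
exact: is_derive_reflect (is_derive_sin (c - x)).
Qed.

(** The boundary terms at N are affine in tau, so that a fourth difference in
    tau kills them and only the cosine of c + tau survives. *)
Lemma integral_cos_relu c tau N : - N <= tau <= N ->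
  \int[mu]_(b in `[- N, N]) (cos (c - b) * Num.max 0 (b + tau)) =
  - sin (c - N) * (N + tau) + cos (c - N) - cos (c + tau).
Proof.
move=> /andP[Nt tN].
have cf : continuous (fun b => cos (c - b) * Num.max 0 (b + tau)).
  move=> b; apply: cvgM; first exact: cont_cos.
  apply: (@continuous_max _ _ (cst 0) (fun b => b + tau)); first exact: cst_continuous.
  by apply: cvgD; [exact: cvg_id|exact: cvg_cst].
have fi : mu.-integrable `[- N, N] (EFin \o (fun b => cos (c - b) * Num.max 0 (b + tau))).
  apply: continuous_compact_integrable; first exact: segment_compact.
  exact: continuous_subspaceT.
have := @Rintegral_itvB R _ (BLeft (- N)) (BRight N) (- tau) fi.
have b1 : (BLeft (- N) <= BRight (- tau))%O by rewrite bnd_simp lerN2.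
have b2 : (BRight (- tau) <= BRight N)%O by rewrite bnd_simp lerNl.
move=> /(_ b1 b2) E.
rewrite -[LHS](subrK (\int[mu]_(b in `[- N, - tau]) (cos (c - b) * Num.max 0 (b + tau)))) E.
rewrite [X in _ + X](_ : _ = 0) ?addr0; last first.
  rewrite /Rintegral integral0_eq// => x /=; rewrite in_itv/= => /andP[_ xt].
  by rewrite max_l ?mulr0// -lerBrDr sub0r.
rewrite (@Rintegral_itv_obnd_cbnd R (- tau) (BRight N)); last first.
  apply: integrableS fi => //; apply: subset_itvr; rewrite bnd_simp; lra.
transitivity (\int[mu]_(b in `[- tau, N]) (cos (c - b) * (b + tau))).
  apply: eq_Rintegral => x; rewrite inE/= in_itv/= => /andP[tx _].
  by rewrite max_r//; lra.
have dF (x : R) : is_derive x (1 : R) (fun b => - sin (c - b) * (b + tau) + cos (c - b))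
    (cos (c - x) * (x + tau)).
  have d1 := is_derive_sinB c x; have d2 := is_derive_cosB c x.
  by apply: is_derive_eq; rewrite /GRing.scale/= !addr0; ring.
have cg : continuous (fun b : R => cos (c - b) * (b + tau)).
  move=> b; apply: cvgM; first exact: cont_cos.
  by apply: cvgD; [exact: cvg_id|exact: cvg_cst].
have tN' : - tau <= N by rewrite lerNl.
rewrite /Rintegral (integral_FTC tN' cg dF) /= addNr mulr0 add0r opprK.
by [].
Qed.

Let i4 (i : 'I_5) : 0 <= (i%:R : R) <= 4.
Proof. by rewrite ler0n ler_nat -ltnS ltn_ord. Qed.

Lemma integral_cos_spline2 c th M : 2 <= M -> `|th| <= M ->
  \int[mu]_(b in `[- (2 * M), 2 * M]) (cos (c - b) * spline 2 (th + b)) =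
  - spline_hat * cos (c + th).
Proof.
move=> M2; rewrite ler_norml => /andP[thM Mth].
have fi tau : mu.-integrable `[- (2 * M), 2 * M] (EFin \o (fun b => cos (c - b) * Num.max 0 (b + tau))).
  apply: continuous_compact_integrable; first exact: segment_compact.
  apply: continuous_subspaceT => b; apply: cvgM; first exact: cont_cos.
  apply: (@continuous_max _ _ (cst 0) (fun b => b + tau)); first exact: cst_continuous.
  by apply: cvgD; [exact: cvg_id|exact: cvg_cst].
have E (b : R) : cos (c - b) * spline 2 (th + b) =
   \sum_(i < 5) (6 * (-1) ^+ i * 'C(4, i)%:R) * (cos (c - b) * Num.max 0 (b + (th + 2 - i%:R))).
  rewrite /spline mulrCA mulr_sumr mulr_sumr; apply: eq_bigr => i _.
  rewrite (_ : b + (th + 2 - i%:R) = th + b + 2 - i%:R); last by ring.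
  rewrite expr1 (_ : (3 ^_ 2) = 6)//; ring.
under eq_Rintegral do rewrite E.
rewrite Rintegral_sum//; last first.
  by move=> i; apply: integrableZR => //; exact: fi.
under eq_bigr do rewrite RintegralZl//.
rewrite (eq_bigr (fun i : 'I_5 => 6 * (-1) ^+ i * 'C(4, i)%:R *
   (- sin (c - 2 * M) * (2 * M + (th + 2 - i%:R)) + cos (c - 2 * M) - cos (c + (th + 2 - i%:R))))); last first.
  move=> i _; rewrite integral_cos_relu//; have /andP[] := i4 i; lra.
rewrite !big_ord_recr big_ord0/= /binomial/=.
rewrite (_ : c + (th + 2 - 0) = (c + th) + (1 + 1)); last by ring.
rewrite (_ : c + (th + 2 - 1) = (c + th) + 1); last by ring.
rewrite (_ : c + (th + 2 - 2) = (c + th)); last by ring.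
rewrite (_ : c + (th + 2 - 3) = (c + th) - 1); last by ring.
rewrite (_ : c + (th + 2 - 4) = (c + th) - (1 + 1)); last by ring.
rewrite !cosB !cosD sinD /spline_hat.
have := cos2Dsin2 (1 : R); set C := cos 1; set S := sin 1 => CS.
have -> : S * S = 1 - C ^+ 2 by rewrite -CS expr2 addrC addKr.
ring.
Qed.

(** Integration by parts; both ends of the interval lie outside the support of
    the spline, as |th| is at most M and M is at least 2. *)
Lemma integral_cos_spline_step j c th M : (j < 2)%N -> 2 <= M -> `|th| <= M ->
  \int[mu]_(b in `[- (2 * M), 2 * M]) (cos (c - b) * spline j (th + b)) =
  \int[mu]_(b in `[- (2 * M), 2 * M]) (cos (c - pi / 2 - b) * spline j.+1 (th + b)).
Proof.
move=> j2 M2 thM.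
have ds (x : R) : is_derive x (1 : R) (fun b => spline j (th + b)) (spline j.+1 (th + x)).
  exact: is_derive_translate (is_derive_spline (th + x) j2).
have dF (x : R) : is_derive x (1 : R) (fun b => - sin (c - b) * spline j (th + b))
  (cos (c - x) * spline j (th + x) - cos (c - pi / 2 - x) * spline j.+1 (th + x)).
  have d1 := is_derive_sinB c x; have d2 := ds x.
  apply: is_derive_eq; rewrite /GRing.scale/= (_ : c - pi / 2 - x = c - x - pi / 2) ?cosBpihalf; ring.
have cs k : (k <= 2)%N -> continuous (fun b => spline k (th + b)).
  move=> k2 b; apply: (continuous_comp (f := fun b => th + b)); last exact: continuous_spline.
  by apply: cvgD; [exact: cvg_cst|exact: cvg_id].
have c1 e k : (k <= 2)%N -> continuous (fun b => cos (e - b) * spline k (th + b)).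
  by move=> k2 b; apply: cvgM; [exact: cont_cos|exact: cs].
have ii e k : (k <= 2)%N -> mu.-integrable `[- (2 * M), 2 * M] (EFin \o (fun b => cos (e - b) * spline k (th + b))).
  move=> k2; apply: continuous_compact_integrable; first exact: segment_compact.
  by apply: continuous_subspaceT; exact: c1.
apply/eqP; rewrite -subr_eq0 -RintegralB//; [|exact: ii (ltnW j2)|exact: ii].
have cF : continuous (fun x => cos (c - x) * spline j (th + x) - cos (c - pi / 2 - x) * spline j.+1 (th + x)).
  by move=> b; apply: cvgB; [exact: c1 (ltnW j2) _|exact: c1].
have MM : - (2 * M) <= 2 * M by lra.
rewrite /Rintegral (integral_FTC MM cF dF) /=.
have sp0 x : `|x| = 2 * M -> spline j (th + x) = 0.
  move=> xM; apply: spline_outside; first exact: ltnW.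
  have := ler_normB (th + x) th; rewrite addrC addKr xM; lra.
rewrite !sp0 ?mulr0 ?subr0 ?normrN ?ger0_norm//; lra.
Qed.

(** The reproducing formula behind the network: a wave is a superposition of
    shifted activations whose shifts stay in the sampled range. A derivative
    of the activation moves to the cosine and becomes a phase shift of a
    quarter period, which is the effect of differentiating the wave. *)
Lemma integral_cos_spline j c th M : (j <= 2)%N -> 2 <= M -> `|th| <= M ->
  \int[mu]_(b in `[- (2 * M), 2 * M]) (cos (c - b) * spline j (th + b)) =
  spline_hat * cos (c + th + j%:R * (pi / 2)).
Proof.
move=> j2 M2 thM; case: j j2 => [|[|[|//]]] _.
- rewrite integral_cos_spline_step// integral_cos_spline_step// integral_cos_spline2// mul0r addr0.
  rewrite (_ : c - pi / 2 - pi / 2 + th = c + th - pi); last by field.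
  by rewrite cosB cospi sinpi; ring.
- rewrite integral_cos_spline_step// integral_cos_spline2// mul1r.
  rewrite cosDpihalf (_ : c - pi / 2 + th = c + th - pi / 2); last by field.
  by rewrite cosBpihalf mulrN mulNr.
- rewrite integral_cos_spline2// (_ : 2 * (pi / 2) = pi); last by field.
  by rewrite cosDpi mulrN mulNr.
Qed.

End spline.

(** * Integration by parts against test functions *)

(** The difference quotient of f \o c in the direction v is that of f in the
    direction v'. *)
Lemma is_derive_line (R : realType) (V W : normedModType R) (c : V -> W)
    (f : W -> R) (x v : V) (v' : W) (df : R) :
  (forall h : R, c (h *: v + x) = h *: v' + c x) ->
  is_derive (c x) v' f df -> is_derive x v (f \o c) df.
Proof.
move=> cE [df1 df2].
have E : (fun h : R => h^-1 *: (((f \o c) \o shift x) (h *: v) - (f \o c) x)) =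
    (fun h : R => h^-1 *: ((f \o shift (c x)) (h *: v') - f (c x))).
  by apply/funext => h; rewrite /= cE.
by split; [rewrite /derivable E|rewrite /derive E].
Qed.

Section parts.
Context (R : realType).
Local Notation mu := (@lebesgue_measure R).

Lemma continuous_rV_cons1 n (f : 'rV[R]_n.+1 -> R) (v : 'rV[R]_n) :
  continuous f -> continuous (fun t : R => f (rV_cons (t, v))).
Proof.
move=> cf t; apply: (continuous_comp (f := fun t : R => rV_cons (t, v))); last exact: cf.
move=> A /nbhs_ballP[e e0 eA]; apply/nbhs_ballP; exists e => // u /= tu.
apply: eA; split => // i j; rewrite ord1.
case: (unliftP ord0 j) => [k|] ->.
  by rewrite !rV_consS; exact: ballxx.
by rewrite !rV_cons0.
Qed.

Lemma continuous_rV_cons2 n (f : 'rV[R]_n.+1 -> R) (t : R) :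
  continuous f -> continuous (fun v : 'rV[R]_n => f (rV_cons (t, v))).
Proof.
move=> cf v; apply: (continuous_comp (f := fun v : 'rV[R]_n => rV_cons (t, v))); last exact: cf.
move=> A /nbhs_ballP[e e0 eA]; apply/nbhs_ballP; exists e => // u [_ uv].
apply: eA; split => // i j; rewrite ord1.
case: (unliftP ord0 j) => [k|] ->.
  by rewrite !rV_consS; exact: uv.
by rewrite !rV_cons0; exact: ballxx.
Qed.

Definition cube n (N : R) : set 'rV[R]_n := [set v | forall i, `[- N, N]%classic (v ord0 i)].
Arguments cube : clear implicits.

Lemma measurable_cube n N : measurable (cube n N).
Proof. exact: (measurable_rV_box (A := fun=> `[- N, N]%classic)) => _. Qed.

Lemma cube_volume_lty n N : (lebesgue_rV R n (cube n N) < +oo)%E.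
Proof.
rewrite (lebesgue_rV_box (fun=> measurable_itv `[- N, N])).
rewrite (eq_bigr (fun=> (fine (mu `[- N, N]%classic))%:E)) ?prodEFin ?ltry//.
by move=> i _; rewrite fineK// lebesgue_measure_itv/=; case: ifP.
Qed.

Lemma compact_support_integrable n N (f : 'rV[R]_n -> R) : continuous f ->
  (forall x, ~ cube n N x -> f x = 0) ->
  (lebesgue_rV R n).-L1 f.
Proof.
move=> cf f0.
have kc : compact (cube n N) by apply: (@rV_compact R n (fun=> `[- N, N]%classic)) => i; exact: segment_compact.
have -> : EFin \o f = (EFin \o f) \_ (cube n N).
  apply/funext => x; rewrite patchE; case: ifPn => // /negP; rewrite inE => xN.
  by rewrite /= f0.
apply/(integrable_mkcond _ _).1; first exact: measurable_cube.
apply: measurable_bounded_integrable; first exact: measurable_cube.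
- exact: cube_volume_lty.
- by apply: measurable_funTS; exact: continuous_measurable_rV.
- have /compact_bounded[M [Mr MP]] : compact (f @` cube n N).
    by apply: continuous_compact => //; exact: continuous_subspaceT.
  exists M; split => // y My x xc; apply: (MP _ My).
  by exists x.
Qed.

(** Fubini and the fundamental theorem of calculus along coordinate k, which
    the induction on n brings to the front. *)
Lemma integral_partial_eq0 n (k : 'I_n) N (F F' : 'rV[R]_n -> R) :
  (forall x, is_derive x (delta_mx ord0 k : 'rV[R]_n) F (F' x)) ->
  continuous F' ->
  (forall x, ~ cube n N x -> F x = 0 /\ F' x = 0) ->
  \int[lebesgue_rV R n]_x F' x = 0.
Proof.
elim: n k F F' => [[]//|n IH] k F F' dF cF' FN.
have iF' : (lebesgue_rV R n.+1).-L1 F'.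
  by apply: (@compact_support_integrable _ N) => // x /FN[].
have cubeE t v : cube n.+1 N (rV_cons (t, v)) <-> `[- N, N]%classic t /\ cube n N v.
  split=> [h|[ht hv] j].
    split=> [|j]; first by have := h ord0; rewrite rV_cons0.
    by have := h (lift ord0 j); rewrite rV_consS.
  by case: (unliftP ord0 j) => [i|] ->; rewrite ?rV_consS ?rV_cons0//; exact: hv.
case: (unliftP ord0 k) => [j|] kE; subst k.
- rewrite Rintegral_rV_succ//.
  under eq_Rintegral => t _.
    have dG (v : 'rV[R]_n) : is_derive v (delta_mx ord0 j : 'rV[R]_n)
        (fun v => F (rV_cons (t, v))) (F' (rV_cons (t, v))).
      apply: (@is_derive_line _ _ _ (fun v => rV_cons (t, v)) F v _ (delta_mx ord0 (lift ord0 j))) => // h.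
      apply/rowP => i; rewrite !mxE /=.
      case: (unliftP ord0 i) => [i'|] ->; rewrite ?liftK ?unlift_none/=.
        by rewrite !mxE/= (inj_eq lift_inj).
      by rewrite mulr0 add0r.
    rewrite (IH _ _ _ dG); first over.
    + exact: continuous_rV_cons2.
    + by move=> v vN; apply: FN => /cubeE[].
  by rewrite Rintegral_cst// mul0r.
- rewrite Rintegral_rV_succ'//.
  under eq_Rintegral => v _.
    have dG (t : R) : is_derive t (1 : R) (fun t : R => F (rV_cons (t, v))) (F' (rV_cons (t, v))).
      apply: (@is_derive_line _ _ _ (fun t : R => rV_cons (t, v)) F t _ (delta_mx ord0 ord0)) => // h.
      apply/rowP => i; rewrite !mxE /=.
      case: (unliftP ord0 i) => [i'|] ->; rewrite ?liftK ?unlift_none/=.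
        by rewrite mulr0 add0r.
      by [].
    have cG := @continuous_rV_cons1 _ _ v cF'.
    have G0 (t : R) : `|N| < `|t| -> F (rV_cons (t, v)) = 0 /\ F' (rV_cons (t, v)) = 0.
      move=> Nt; apply: FN => /cubeE[/=]; rewrite in_itv/= -ler_norml => tN _.
      by have := le_lt_trans (le_trans tN (ler_norm N)) Nt; rewrite ltxx.
    pose N' := `|N| + 1.
    have N'0 : 0 <= N' by rewrite addr_ge0.
    have NN' : - N' <= N' by rewrite /N'; have := normr_ge0 N; lra.
    rewrite (_ : \int[mu]_t F' (rV_cons (t, v)) = 0); first over.
    transitivity (\int[mu]_(t in `[- N', N']) F' (rV_cons (t, v))).
      rewrite [RHS]Rintegral_mkcond; apply: eq_Rintegral => t _.
      rewrite patchE; case: ifPn => // /negP; rewrite inE/= in_itv/= -ler_norml => /negP.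
      rewrite -ltNge => tN; apply: (G0 t _).2; rewrite (lt_trans _ tN)// /N'; lra.
    rewrite /Rintegral (integral_FTC NN' cG dG) /=.
    have [-> _] : F (rV_cons (N', v)) = 0 /\ F' (rV_cons (N', v)) = 0.
      by apply: G0; rewrite (ger0_norm N'0) ltrDl.
    have [-> _] : F (rV_cons (- N', v)) = 0 /\ F' (rV_cons (- N', v)) = 0.
      by apply: G0; rewrite normrN (ger0_norm N'0) ltrDl.
    by rewrite subrr.
  by rewrite Rintegral_cst// mul0r.
Qed.

End parts.
Arguments cube {R} n N.

Section test_functions.
Context (R : realType) (d : nat) (Omega : set 'rV[R]_d).
Implicit Types phi : 'rV[R]_d -> R.
Local Notation lam := (lebesgue_rV R d).

Lemma test_function_partial phi k :
  test_function Omega phi -> test_function Omega (partial k phi).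
Proof.
move=> [Cphi [K [cK KO] phiK]]; split=> [n|].
  by have [_ /(_ k)[]] := Cphi n.+1.
exists K => // x Kx; rewrite /partial (@near_eq_derive _ _ _ _ (cst 0)) ?derive_cst//.
have oK : open (~` K).
  by apply: closed_openC; apply: compact_closed => //; exact: norm_hausdorff.
have : nbhs x (~` K) by exact: open_nbhs_nbhs.
by apply: filterS => y; exact: phiK.
Qed.

Lemma test_function_foldr phi ks :
  test_function Omega phi -> test_function Omega (foldr (@partial R d) phi ks).
Proof. by move=> tphi; elim: ks => //= k ks; exact: test_function_partial. Qed.

Lemma test_function_continuous phi : test_function Omega phi -> continuous phi.
Proof. by move=> [/(_ 0%N)[]]. Qed.

Lemma test_function_derive phi k x : test_function Omega phi ->
  is_derive x (delta_mx ord0 k : 'rV[R]_d) phi (partial k phi x).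
Proof. by move=> [/(_ 1%N)[_ /(_ k)[/(_ x) ? _]] _]; split. Qed.

Lemma test_function_bounded phi : test_function Omega phi ->
  exists2 C : R, 0 <= C & forall x, `|phi x| <= C.
Proof.
move=> tphi; have cphi := test_function_continuous tphi.
case: tphi => _ [K [cK KO] phiK].
have /compact_bounded[M [Mr MP]] : compact (phi @` K).
  by apply: continuous_compact => //; exact: continuous_subspaceT.
exists (`|M| + 1) => [|x]; first by rewrite addr_ge0.
have [Kx|Kx] := pselect (K x); last by rewrite phiK// normr0 addr_ge0.
by apply: (MP (`|M| + 1)); [rewrite (le_lt_trans (ler_norm _))// ltrDl|exists x].
Qed.

Lemma test_function_outside phi x : test_function Omega phi -> ~ Omega x -> phi x = 0.
Proof. by move=> [_ [K [cK KO] phiK]] Ox; apply: phiK => /KO. Qed.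

Hypothesis Ocube : Omega `<=` [set x : 'rV[R]_d | forall k, 0 <= x ord0 k <= 1].

Lemma Omega_cube1 x : Omega x -> cube d 1 x.
Proof.
move=> /Ocube h i; have /andP[? ?] := h i.
by rewrite /= in_itv/=; apply/andP; split; lra.
Qed.

Lemma Rintegral_test (h phi : 'rV[R]_d -> R) : test_function Omega phi ->
  \int[lam]_(x in Omega) (h x * phi x) = \int[lam]_x (h x * phi x).
Proof.
move=> tphi; rewrite Rintegral_mkcond; apply: eq_Rintegral => x _.
rewrite patchE; case: ifPn => // /negP; rewrite inE => xO.
by rewrite (test_function_outside tphi xO) mulr0.
Qed.

Lemma integrable_test (h phi : 'rV[R]_d -> R) : continuous h ->
  test_function Omega phi -> lam.-L1 (fun x => h x * phi x).
Proof.
move=> ch tphi; have cphi := test_function_continuous tphi.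
apply: (@compact_support_integrable _ _ 1).
  by move=> x; apply: continuousM; [exact: ch|exact: cphi].
move=> x xc; rewrite (@test_function_outside phi x) ?mulr0//.
by move/Omega_cube1.
Qed.

(** A test function vanishes off Omega, so that its product with h is a
    compactly supported function on the whole space: the boundary of Omega
    never enters. *)
Lemma integral_by_parts_test (h h' : 'rV[R]_d -> R) phi k :
  test_function Omega phi -> continuous h -> continuous h' ->
  (forall x, is_derive x (delta_mx ord0 k : 'rV[R]_d) h (h' x)) ->
  \int[lam]_(x in Omega) (h x * partial k phi x) =
  - \int[lam]_(x in Omega) (h' x * phi x).
Proof.
move=> tphi ch ch' dh.
have tpphi := test_function_partial k tphi.
have cphi := test_function_continuous tphi.
have cpphi := test_function_continuous tpphi.
have out x : ~ cube d 1 x -> phi x = 0 /\ partial k phi x = 0.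
  by move=> xc; split; apply: (@test_function_outside _ x) => // /Omega_cube1.
rewrite !Rintegral_test//; apply/eqP; rewrite -addr_eq0 -RintegralD//; last 2 first.
- exact: integrable_test.
- exact: integrable_test.
apply/eqP; apply: (@integral_partial_eq0 _ _ k 1 (fun x => h x * phi x)).
- move=> x; have d1 := dh x; have d2 := test_function_derive k x tphi.
  have := is_deriveM d1 d2; rewrite /GRing.scale/=.
  by rewrite [phi x * _]mulrC.
- move=> x; apply: (@continuousD _ _ _ (fun x => h x * partial k phi x) (fun x => h' x * phi x));
    apply: continuousM; [exact: ch|exact: cpphi|exact: ch'|exact: cphi].
- by move=> x /out[-> ->]; rewrite !mulr0 addr0.
Qed.

Definition ridge (w : 'rV[R]_d) (b : R) (psi : R -> R) (x : 'rV[R]_d) := psi (dot w x + b).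

Lemma continuous_dot (w : 'rV[R]_d) : continuous (dot w).
Proof.
apply: (continuous_sum_ord (F := fun k (v : 'rV[R]_d) => w ord0 k * v ord0 k)) => k x.
by apply: continuousM; [exact: cst_continuous|exact: coord_continuous].
Qed.

Lemma continuous_ridge w b psi : continuous psi -> continuous (ridge w b psi).
Proof.
move=> cpsi x; apply: (continuous_comp (f := fun x => dot w x + b)); last exact: cpsi.
by apply: continuousD; [exact: continuous_dot|exact: cst_continuous].
Qed.

Lemma is_derive_ridge w b psi psi' k x :
  is_derive (dot w x + b) (1 : R) psi psi' ->
  is_derive x (delta_mx ord0 k : 'rV[R]_d) (ridge w b psi) (w ord0 k * psi').
Proof.
move=> dpsi.
apply: (@is_derive_line _ _ _ (fun x => dot w x + b) psi x _ (w ord0 k)).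
  move=> h; rewrite addrA; congr (_ + _); rewrite /dot.
  under eq_bigr do rewrite !mxE mulrDr.
  rewrite big_split/= (bigD1 k)//= big1 ?addr0; last first.
    by move=> i /negbTE ik; rewrite ik mulr0n !mulr0.
  by rewrite !eqxx/= mulr1n mulr1 mulrC.
have dif : differentiable psi (dot w x + b) by apply/derivable1_diffP; case: dpsi.
split; first exact: diff_derivable.
have <- := @derive_val _ _ _ _ _ _ _ dpsi.
rewrite !deriveE// -[X in 'd _ _ X](mulr1 (w ord0 k)).
by rewrite -[w ord0 k * 1]/(w ord0 k *: (1 : R)) linearZ.
Qed.

Definition monomial (ks : seq 'I_d) (w : 'rV[R]_d) : R := \prod_(k <- ks) w ord0 k.

(** With psi i.+1 the derivative of psi i, each direction k of ks takes one
    derivative from the test function to the profile of the ridge function, at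
    the price of a factor w_k and of a sign. The offset i is there for the
    induction on ks. *)
Lemma integral_by_parts_ridge w b (psi : nat -> R -> R) ks phi i :
  (forall j x, (j < i + size ks)%N -> is_derive x (1 : R) (psi j) (psi j.+1 x)) ->
  (forall j, (j <= i + size ks)%N -> continuous (psi j)) ->
  test_function Omega phi ->
  \int[lam]_(x in Omega) (ridge w b (psi i) x * foldr (@partial R d) phi ks x) =
  (-1) ^+ size ks * \int[lam]_(x in Omega)
    (monomial ks w * ridge w b (psi (i + size ks)%N) x * phi x).
Proof.
elim: ks i => [|k ks IH] i dpsi cpsi tphi.
  rewrite expr0 mul1r /= addn0; apply: eq_Rintegral => x _.
  by rewrite /monomial big_nil mul1r.
have iks : (i < i + (size ks).+1)%N by rewrite addnS ltnS leq_addr.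
have tphi' := test_function_foldr ks tphi.
have cpsi' : continuous (ridge w b (psi i.+1)).
  by apply: continuous_ridge; apply: cpsi.
have dr x : is_derive x (delta_mx ord0 k : 'rV[R]_d) (ridge w b (psi i))
    (w ord0 k * ridge w b (psi i.+1) x).
  by apply: is_derive_ridge; exact: dpsi.
rewrite /= (@integral_by_parts_test _ (fun x => w ord0 k * ridge w b (psi i.+1) x) _ _ tphi' _ _ dr).
- have IHi := IH i.+1; rewrite addSnnS in IHi.
  rewrite Rintegral_test//; under eq_Rintegral do rewrite -mulrA.
  rewrite RintegralZl//; last exact: integrable_test.
  rewrite -(Rintegral_test _ tphi') IHi// exprS mulN1r mulNr.
  congr (- _); rewrite mulrCA; congr (_ * _); rewrite !Rintegral_test//.
  rewrite -RintegralZl//; last first.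
    apply: integrable_test => // x; apply: (@continuousM _ _ (cst (monomial ks w))); first exact: cst_continuous.
    by apply: continuous_ridge; apply: cpsi.
  by apply: eq_Rintegral => x _; rewrite /monomial big_cons !mulrA.
- by apply: continuous_ridge; apply: cpsi; exact: ltnW.
- by move=> x; apply: continuousM; [exact: cst_continuous|exact: cpsi'].
Qed.

End test_functions.

(** * Averages of independent samples *)

Section bounded_integrals.
Context d1 d2 (T1 : measurableType d1) (T2 : measurableType d2) (R : realType).

Lemma integrable_bounded (mu : {measure set T1 -> \bar R}) (f : T1 -> R) (C : R) :
  (mu setT < +oo)%E -> measurable_fun setT f -> (forall x, `|f x| <= C) ->
  mu.-L1 f.
Proof.
move=> muoo mf fC; apply: measurable_bounded_integrable => //.
exists C; split; first exact: num_real.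
by move=> y Cy x /= _; exact: le_trans (fC x) (ltW Cy).
Qed.

Lemma Rintegral_pushforward (P : {measure set T1 -> \bar R})
    (mu : {measure set T2 -> \bar R}) (Z : T1 -> T2) (f : T2 -> R) :
  measurable_fun setT Z -> measurable_fun setT f ->
  (forall A, measurable A -> P (Z @^-1` A) = mu A) ->
  P.-L1 (f \o Z) ->
  \int[P]_t f (Z t) = \int[mu]_z f z.
Proof.
move=> mZ mf Zmu fi; congr fine.
have := @integral_pushforward _ _ _ _ R Z mZ P setT (EFin \o f).
rewrite preimage_setT => H; rewrite -[LHS]H//; last exact/measurable_EFinP.
by apply: eq_measure_integral => A mA _; rewrite -Zmu.
Qed.

Variables (m1 : {sigma_finite_measure set T1 -> \bar R})
  (m2 : {sigma_finite_measure set T2 -> \bar R}).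

Lemma Rintegral_prod_mul (a : T1 -> R) (b : T2 -> R) :
  m1.-L1 a -> m2.-L1 b ->
  \int[(m1 \x m2)%E]_z (a z.1 * b z.2) = (\int[m1]_x a x) * \int[m2]_y b y.
Proof.
move=> ia ib.
have /measurable_EFinP ma := measurable_int _ ia.
have /measurable_EFinP mb := measurable_int _ ib.
have iab : (m1 \x m2)%E.-L1 (fun z => a z.1 * b z.2).
  apply: (integrable_prod_le _ ia ib) => [|x y]; last by rewrite normrM.
  by apply: measurable_funM; [exact: measurableT_comp|exact: measurableT_comp].
rewrite -(Rintegral12_prod iab) /=.
under eq_Rintegral do rewrite RintegralZl//.
by rewrite RintegralZr.
Qed.

End bounded_integrals.

Section generated_sigma_algebra.
Context d1 d2 (U1 : measurableType d1) (U2 : measurableType d2).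
Context d (T : measurableType d) (G : set (set T)).

Lemma sigma_generated_pair (f : T -> U1) (g : T -> U2) :
  (forall S, measurable S -> <<s G >> (f @^-1` S)) ->
  (forall S, measurable S -> <<s G >> (g @^-1` S)) ->
  forall S, measurable S -> <<s G >> ((fun t => (f t, g t)) @^-1` S).
Proof.
move=> mf mg S mS.
pose T' := g_sigma_algebraType G.
have mf' : measurable_fun setT (f : T' -> U1) by move=> _ A mA; rewrite setTI; exact: mf.
have mg' : measurable_fun setT (g : T' -> U2) by move=> _ A mA; rewrite setTI; exact: mg.
by have := measurable_fun_pair mf' mg' measurableT mS; rewrite setTI.
Qed.

Lemma g_sigma_preimage_sub m (X : 'I_m -> T -> U1) i S : measurable S ->
  g_sigma_preimage X (X i @^-1` S).
Proof.
move=> mS; apply: sub_sigma_algebra; rewrite -bigcup_seq/=.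
by exists i => /=; [rewrite mem_index_enum|exists S => //; rewrite setTI].
Qed.

End generated_sigma_algebra.

Section iid.
Context (R : realType) d d1 d2 (T : measurableType d) (U : measurableType d1)
  (V : measurableType d2) (P : probability T R).
Variables (m : nat) (X : 'I_m -> {RV P >-> U}) (Y : 'I_m -> {RV P >-> V}).
Variables (pX : probability U R) (pY : probability V R).
Hypothesis lawX : forall i S, measurable S -> P (X i @^-1` S) = pX S.
Hypothesis lawY : forall i S, measurable S -> P (Y i @^-1` S) = pY S.
Hypothesis indX : mutually_independent X.
Hypothesis indY : mutually_independent Y.
Hypothesis indXY : independent_sigma_algebras P (g_sigma_preimage X) (g_sigma_preimage Y).

Let mX i : measurable_fun setT (X i). Proof. exact: measurable_funP. Qed.
Let mY i : measurable_fun setT (Y i). Proof. exact: measurable_funP. Qed.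

(** The sets at the other indices are taken to be the whole space. *)
Let law_two d' (U' : measurableType d') (Z : 'I_m -> {RV P >-> U'})
    (pZ : probability U' R) (i k : 'I_m) A :
  (forall i S, measurable S -> P (Z i @^-1` S) = pZ S) ->
  mutually_independent Z -> i != k -> measurable A ->
  P ((fun t => (Z i t, Z k t)) @^-1` A) = (pZ \x pZ)%E A.
Proof.
move=> lawZ indZ ik mA.
have mZZ : measurable_fun setT (fun t => (Z i t, Z k t)).
  by apply: measurable_fun_pair; exact: measurable_funP.
pose ZZ : {mfun T >-> (U' * U')%type} :=
  HB.pack (fun t => (Z i t, Z k t)) (isMeasurableFun.Build _ _ _ _ _ mZZ).
rewrite (@product_measure_unique _ _ _ _ _ pZ pZ (distribution P ZZ))// => S1 S2 mS1 mS2.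
pose S j := if j == i then S1 else if j == k then S2 else setT.
have mS j : measurable (S j) by rewrite /S; case: ifP => // _; case: ifP.
have := indZ S mS.
rewrite (bigD1 i)//= (bigD1 k) 1?eq_sym//= big1 ?mule1; last first.
  by move=> j /andP[/negbTE ji /negbTE jk]; rewrite lawZ// /S ji jk probability_setT.
rewrite !lawZ// /S eqxx eq_sym (negbTE ik) eqxx => <-.
rewrite /distribution /pushforward; congr (P _).
apply/seteqP; split => t /=.
  by move=> [h1 h2] j _; case: ifP => [/eqP ->//|_]; case: ifP => [/eqP ->//|].
move=> h; split; first by have := h i I; rewrite eqxx.
by have := h k I; rewrite eq_sym (negbTE ik) eqxx.
Qed.

Let law_pair_pair d1' d2' (U1 : measurableType d1') (V1 : measurableType d2')
    (f : T -> U1) (g : T -> V1) (pf : probability U1 R) (pg : probability V1 R) A :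
  (forall S, measurable S -> g_sigma_preimage X (f @^-1` S)) ->
  (forall S, measurable S -> g_sigma_preimage Y (g @^-1` S)) ->
  measurable_fun setT f -> measurable_fun setT g ->
  (forall S, measurable S -> P (f @^-1` S) = pf S) ->
  (forall S, measurable S -> P (g @^-1` S) = pg S) -> measurable A ->
  P ((fun t => (f t, g t)) @^-1` A) = (pf \x pg)%E A.
Proof.
move=> sf sg mf mg lf lg mA.
have mfg := measurable_fun_pair mf mg.
pose fg : {mfun T >-> (U1 * V1)%type} :=
  HB.pack (fun t => (f t, g t)) (isMeasurableFun.Build _ _ _ _ _ mfg).
rewrite (@product_measure_unique _ _ _ _ _ pf pg (distribution P fg))// => S1 S2 mS1 mS2.
transitivity (P (f @^-1` S1) * P (g @^-1` S2))%E; last by rewrite lf// lg.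
by rewrite -indXY//; [exact: sf|exact: sg].
Qed.

Let sigma_two d' (U' : measurableType d') (Z : 'I_m -> {RV P >-> U'}) i k S :
  measurable S -> g_sigma_preimage Z ((fun t => (Z i t, Z k t)) @^-1` S).
Proof.
by apply: sigma_generated_pair => A mA; exact: g_sigma_preimage_sub.
Qed.

Let integrable_bd d' (U' : measurableType d') (p : probability U' R) (h : U' -> R) C :
  measurable_fun setT h -> (forall z, `|h z| <= C) -> p.-L1 h.
Proof.
move=> mh hC; apply: (integrable_bounded _ mh hC); rewrite [X in (X < _)%E](_ : _ = 1%E) ?ltry//;
  exact: probability_setT.
Qed.

Let mean_one (h : U * V -> R) (C : R) i :
  measurable_fun setT h -> (forall z, `|h z| <= C) ->
  \int[P]_t h (X i t, Y i t) = \int[(pX \x pY)%E]_z h z.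
Proof.
move=> mh hC.
have mXY : measurable_fun setT (fun t => (X i t, Y i t)) by exact: measurable_fun_pair.
apply: (Rintegral_pushforward (Z := fun t => (X i t, Y i t))) => //.
- move=> A mA; apply: law_pair_pair => // S mS; first exact: g_sigma_preimage_sub.
  + exact: g_sigma_preimage_sub.
  + exact: lawX.
  + exact: lawY.
- have mhXY : measurable_fun setT (h \o (fun t => (X i t, Y i t))).
    by apply: (measurableT_comp mh).
  by apply: (integrable_bd _ mhXY (C := C)) => t; exact: hC.
Qed.

(** The pair of first components is independent of the pair of second ones,
    and each pair has a product law; so the expectation factors. *)
Let mean_two (h : U * V -> R) (C : R) i k : i != k ->
  measurable_fun setT h -> (forall z, `|h z| <= C) ->
  \int[P]_t (h (X i t, Y i t) * h (X k t, Y k t)) = (\int[(pX \x pY)%E]_z h z) ^+ 2.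
Proof.
move=> ik mh hC.
have C0 : 0 <= C by apply: le_trans (hC (X i point, Y i point)).
pose h2 (z : (U * U) * (V * V)) := h (z.1.1, z.2.1) * h (z.1.2, z.2.2).
have mh2 : measurable_fun setT h2.
  apply: measurable_funM; apply: (measurableT_comp mh); apply: measurable_fun_pair.
  - by apply: measurableT_comp => //; exact: measurable_fst.
  - by apply: measurableT_comp => //; exact: measurable_snd.
  - by apply: measurableT_comp => //; exact: measurable_fst.
  - by apply: measurableT_comp => //; exact: measurable_snd.
have h2C z : `|h2 z| <= C * C by rewrite normrM ler_pM.
have mXX : measurable_fun setT (fun t => (X i t, X k t)) by exact: measurable_fun_pair.
have mYY : measurable_fun setT (fun t => (Y i t, Y k t)) by exact: measurable_fun_pair.
have mXY := measurable_fun_pair mXX mYY.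
pose QX : probability (U * U)%type R := (pX \x pX)%E.
pose QY : probability (V * V)%type R := (pY \x pY)%E.
transitivity (\int[(QX \x QY)%E]_z h2 z).
  apply: (Rintegral_pushforward (Z := fun t => ((X i t, X k t), (Y i t, Y k t)))
    (f := h2) mXY mh2).
- move=> A mA; apply: law_pair_pair => // S mS; [exact: sigma_two|exact: sigma_two|exact: law_two|exact: law_two].
- apply: (@integrable_bd _ _ _ _ (C * C)) => //; first exact: (measurableT_comp mh2).
  by move=> t; exact: h2C.
have ih2 : (QX \x QY)%E.-L1 h2.
  by apply: (@integrable_bd _ _ _ _ (C * C)).
rewrite -(Rintegral12_prod ih2).
have ih x : pY.-L1 (fun y => h (x, y)).
  apply: (@integrable_bd _ _ _ _ C) => //.
  exact: measurable_fun_pair2 x mh.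
pose H x := \int[pY]_y h (x, y).
have ihh : (pX \x pY)%E.-L1 h by exact: (@integrable_bd _ _ _ _ C).
have iH : pX.-L1 H by exact: integrable_Rfubini1 ihh.
transitivity (\int[(pX \x pX)%E]_x (H x.1 * H x.2)).
  apply: eq_Rintegral => -[x1 x2] _; rewrite /h2/=.
  exact: (Rintegral_prod_mul (ih x1) (ih x2)).
by rewrite Rintegral_prod_mul// -(Rintegral12_prod ihh) expr2.
Qed.

(** The centred samples are pairwise orthogonal, so that only the m diagonal
    terms of the squared sum remain; and a variance is at most the second
    moment. *)
Lemma mean_square_average (h : U * V -> R) (C : R) : (0 < m)%N ->
  measurable_fun setT h -> (forall z, `|h z| <= C) ->
  (\int[P]_t ((m%:R^-1 * \sum_(i < m) h (X i t, Y i t) -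
      \int[(pX \x pY)%E]_z h z) ^+ 2)%:E <=
   (m%:R^-1 * \int[(pX \x pY)%E]_z (h z ^+ 2))%:E)%E.
Proof.
move=> m0 mh hC.
set mean := \int[_]_z h z.
have ihh : (pX \x pY)%E.-L1 h by exact: (@integrable_bd _ _ _ _ C).
pose g z := h z - mean.
have mg : measurable_fun setT g by apply: measurable_funB.
have gC z : `|g z| <= C + `|mean| by rewrite (le_trans (ler_normB _ _))// lerD2r.
have g0 : \int[(pX \x pY)%E]_z g z = 0.
  rewrite /g RintegralB//; last by apply: (@integrable_bd _ _ _ _ `|mean|).
  rewrite Rintegral_cst// [fine _](_ : _ = 1) ?mulr1 ?subrr//.
  by rewrite [X in fine X](_ : _ = 1%E)//; exact: probability_setT.
have ig2 : (pX \x pY)%E.-L1 (fun z => g z * g z).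
  apply: (@integrable_bd _ _ _ _ ((C + `|mean|) * (C + `|mean|))) => //.
    exact: measurable_funM.
  by move=> z; rewrite normrM ler_pM.
have mR : (m%:R : R) != 0 by rewrite pnatr_eq0 -lt0n.
have E t : (m%:R^-1 * \sum_(i < m) h (X i t, Y i t) - mean) ^+ 2 =
    m%:R^-2 * \sum_(i < m) \sum_(k < m) (g (X i t, Y i t) * g (X k t, Y k t)).
  rewrite -big_distrlr /= -expr2 -exprVn -exprMn; congr (_ ^+ 2).
  rewrite /g sumrB mulrBr sumr_const card_ord; congr (_ - _).
  by rewrite -[mean *+ m]mulr_natl mulrA mulVf// mul1r.
have igg i k : P.-L1 (fun t => g (X i t, Y i t) * g (X k t, Y k t)).
  apply: (@integrable_bd _ _ _ _ ((C + `|mean|) * (C + `|mean|))) => //.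
    by apply: measurable_funM; apply: (measurableT_comp mg); exact: measurable_fun_pair.
  by move=> z; rewrite normrM ler_pM.
under eq_integral do rewrite E.
have iS : P.-L1 (fun t => \sum_(i < m) \sum_(k < m) (g (X i t, Y i t) * g (X k t, Y k t))).
  by apply: integrable_sumR => // i; exact: integrable_sumR.
rewrite -EFin_Rintegral//; last exact: integrableZR.
rewrite RintegralZl// Rintegral_sum//; last by move=> i; exact: integrable_sumR.
under eq_bigr do rewrite Rintegral_sum//.
have D i : \sum_(k < m) \int[P]_t (g (X i t, Y i t) * g (X k t, Y k t)) =
    \int[(pX \x pY)%E]_z (g z * g z).
  rewrite (bigD1 i)//= big1 ?addr0; last first.
    by move=> k ki; rewrite (mean_two _ mg gC) 1?eq_sym// g0 expr0n.
  apply: (@mean_one (fun z => g z * g z) ((C + `|mean|) * (C + `|mean|))).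
    exact: measurable_funM.
  by move=> z; rewrite normrM ler_pM.
under eq_bigr do rewrite D.
rewrite sumr_const card_ord -(mulr_natl (\int[_]_z (g z * g z))) mulrA.
rewrite (_ : m%:R^-2 * m%:R = m%:R^-1); last by rewrite -exprVn expr2 -mulrA mulVf// mulr1.
rewrite lee_fin ler_wpM2l ?invr_ge0//.
have ih2 : (pX \x pY)%E.-L1 (fun z => h z ^+ 2).
  apply: (@integrable_bd _ _ _ _ (C ^+ 2)) => //; first exact: measurable_funX.
  by move=> z; rewrite normrX lerXn2r ?nnegrE// (le_trans _ (hC z)).
have -> : \int[(pX \x pY)%E]_z (g z * g z) = \int[(pX \x pY)%E]_z (h z ^+ 2) - mean ^+ 2.
  rewrite (_ : (fun z => g z * g z) = (fun z => h z ^+ 2 - (2 * mean) * g z - mean ^+ 2)); last first.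
    by apply/funext => z; rewrite /g; ring.
  have ig : (pX \x pY)%E.-L1 g by exact: (@integrable_bd _ _ _ _ (C + `|mean|)).
  rewrite RintegralB//; last 2 first.
  - by apply: integrableBR => //; exact: integrableZR.
  - by apply: (@integrable_bd _ _ _ _ `|mean ^+ 2|).
  rewrite RintegralB//; last exact: integrableZR.
  rewrite RintegralZl// g0 mulr0 subr0 Rintegral_cst// [X in _ * fine X](_ : _ = 1%E) ?mulr1//.
  exact: probability_setT.
by rewrite gerBl sqr_ge0.
Qed.

End iid.

(** * Fourier inversion *)

Section abel_kernel.
Context (R : realType).
Local Notation mu := (@lebesgue_measure R).

Lemma ge0_integral_fold (f : R -> R) : (forall x, 0 <= f x) -> continuous f ->
  (\int[mu]_x (f x)%:E = \int[mu]_(x in `[0%R, +oo[) (f x)%:E +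
                         \int[mu]_(x in `[0%R, +oo[) (f (- x))%:E)%E.
Proof.
move=> f0 cf.
have mf : measurable_fun [set: R] f by exact: continuous_measurable_fun.
have mf' (D : set R) : measurable_fun D (EFin \o f) by exact/measurable_EFinP/measurable_funTS.
rewrite -(setUv `[(0:R), +oo[) ge0_integral_setU//=.
- congr (_ + _)%E.
  rewrite setCitvr integral_itv_bndo_bndc; last exact: mf'.
  rewrite -{1}(@oppr0 R) ge0_integration_by_substitutionNy//.
  exact: continuous_subspaceT.
- exact: measurableC.
- exact: mf'.
- by move=> x _; rewrite lee_fin.
- exact/disj_setPCl.
Qed.

(** The 1 added to the cosine makes the integrand nonnegative, which gives
    access to the fundamental theorem of calculus on a half-line before
    integrability is known; Rintegral_abel1 takes it away again. *)
Lemma integral_abel_half (eps z c : R) : 0 < eps ->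
  (\int[mu]_(x in `[0%R, +oo[) (expR (- (eps * x)) * (1 + cos (x * z + c)))%:E =
   (eps^-1 + (eps * cos c - z * sin c) / (eps ^+ 2 + z ^+ 2))%:E)%E.
Proof.
move=> e0; set D := eps ^+ 2 + z ^+ 2.
have D0 : 0 < D by rewrite ltr_pwDl ?exprn_gt0// sqr_ge0.
pose f x := expR (- (eps * x)) * (1 + cos (x * z + c)).
pose F x := expR (- (eps * x)) * (- eps^-1 + (z * sin (x * z + c) - eps * cos (x * z + c)) / D).
have dlin (x : R) : is_derive x (1 : R) (fun x : R => x * z + c) z.
  by apply: is_derive_eq; rewrite /GRing.scale/=; ring.
have dexp (x : R) : is_derive x (1 : R) (fun x : R => expR (- (eps * x))) (- eps * expR (- (eps * x))).
  have d1 : is_derive x (1 : R) (fun x : R => - (eps * x)) (- eps).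
    by apply: is_derive_eq; rewrite /GRing.scale/=; ring.
  by apply: is_derive_eq (is_derive1_comp (is_derive_expR _) d1) _; ring.
have dcos (x : R) : is_derive x (1 : R) (fun x : R => cos (x * z + c)) (- sin (x * z + c) * z).
  exact: is_derive1_comp (is_derive_cos _) (dlin x).
have dsin (x : R) : is_derive x (1 : R) (fun x : R => sin (x * z + c)) (cos (x * z + c) * z).
  exact: is_derive1_comp (is_derive_sin _) (dlin x).
have dF (x : R) : is_derive x (1 : R) F (f x).
  rewrite /F; have d1 := dexp x; have d2 := dcos x; have d3 := dsin x.
  apply: is_derive_eq; rewrite /GRing.scale/= /f.
  set E := expR _; set C := cos _; set S := sin _; rewrite /D; field.
  by rewrite (gt_eqF e0) (gt_eqF D0).
have cont (g : R -> R) (g' : R -> R) : (forall x : R, is_derive x (1 : R) g (g' x)) -> continuous g.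
  by move=> dg x; apply/differentiable_continuous/derivable1_diffP; have [] := dg x.
have cF : continuous F by exact: cont dF.
have cf : continuous f.
  move=> x; apply: cvgM; first exact: cont dexp _.
  by apply: cvgD; [exact: cvg_cst|exact: cont dcos _].
have lim0 : F x @[x --> +oo] --> 0.
  pose B := eps^-1 + (`|z| + eps) / D.
  have FB x : `|F x| <= expR (- (eps * x)) * B.
    rewrite normrM ger0_norm ?expR_ge0// ler_wpM2l ?expR_ge0//.
    rewrite (le_trans (ler_normD _ _))// normrN gtr0_norm ?invr_gt0// lerD2l.
    rewrite normrM (gtr0_norm (x := D^-1)) ?invr_gt0// ler_wpM2r ?invr_ge0 ?(ltW D0)//.
    rewrite (le_trans (ler_normB _ _))// !normrM (gtr0_norm e0) lerD//.
      by rewrite ler_piMr// ler_norml sin_geN1 sin_le1.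
    by rewrite ler_piMr ?(ltW e0)// ler_norml cos_geN1 cos_le1.
  have e_lim : expR (- (eps * x)) * B @[x --> +oo] --> 0.
    rewrite -[X in _ --> X](mul0r B); apply: cvgM; last exact: cvg_cst.
    under eq_fun do rewrite mulrC.
    apply: (@cvg_comp _ _ _ (fun x : R => x * eps) (fun x => expR (- x)) _ (pinfty_nbhs R)); last exact: cvgr_expR.
    by apply: gt0_cvgMly e0 _; exact: cvg_id.
  apply: norm_cvg0; apply: (squeeze_cvgr _ (cvg_cst 0) e_lim).
  by apply: nearW => x; rewrite normr_ge0 FB.
have := @ge0_continuous_FTC2y R f F 0 0.
move=> -> //.
- by rewrite -EFinB; congr EFin; rewrite /F !mul0r mulr0 oppr0 expR0 !add0r; ring.
- by move=> x _; rewrite /f mulr_ge0 ?expR_ge0// -lerBlDl sub0r cos_geN1.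
- exact: continuous_subspaceT.
- by apply: cvg_at_right_filter; exact: cF.
- by move=> x _; rewrite derive1E; have [] := dF x.
Qed.

Let cont_abel (eps z c : R) : continuous (fun x : R => expR (- (eps * `|x|)) * (1 + cos (x * z + c))).
Proof.
move=> x; apply: cvgM.
  apply: (continuous_comp (f := fun x : R => - (eps * `|x|))); last exact: continuous_expR.
  apply: cvgN; apply: cvgM; first exact: cvg_cst.
  exact: norm_continuous.
apply: cvgD; first exact: cvg_cst.
apply: (continuous_comp (f := fun x : R => x * z + c)); last exact: continuous_cos.
by apply: cvgD; [apply: cvgM; [exact: cvg_id|exact: cvg_cst]|exact: cvg_cst].
Qed.

Let integral_abel1 (eps z c : R) : 0 < eps ->
  (\int[mu]_x (expR (- (eps * `|x|)) * (1 + cos (x * z + c)))%:E =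
   (2 / eps + cos c * (2 * eps / (eps ^+ 2 + z ^+ 2)))%:E)%E.
Proof.
move=> e0; rewrite ge0_integral_fold; last 2 first.
- by move=> x; rewrite mulr_ge0 ?expR_ge0// -lerBlDl sub0r cos_geN1.
- exact: cont_abel.
transitivity (\int[mu]_(x in `[0%R, +oo[) (expR (- (eps * x)) * (1 + cos (x * z + c)))%:E +
  \int[mu]_(x in `[0%R, +oo[) (expR (- (eps * x)) * (1 + cos (x * (- z) + c)))%:E)%E.
  congr (_ + _)%E; apply: eq_integral => x; rewrite inE/= in_itv/= andbT => x0.
    by rewrite ger0_norm.
  by rewrite normrN ger0_norm// mulNr mulrN.
rewrite !integral_abel_half// -EFinD sqrrN; congr EFin.
have D0 : 0 < eps ^+ 2 + z ^+ 2 by rewrite ltr_pwDl ?exprn_gt0// sqr_ge0.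
by field; rewrite (gt_eqF e0) (gt_eqF D0).
Qed.

Let abel1_eps (eps : R) : 0 < eps ->
  (\int[mu]_x (expR (- (eps * `|x|)))%:E = (2 / eps)%:E)%E.
Proof.
move=> e0; have := @integral_abel1 eps 0 0 e0.
have cE : continuous (fun x : R => expR (- (eps * `|x|))).
  move=> x; apply: (continuous_comp (f := fun x : R => - (eps * `|x|))); last exact: continuous_expR.
  apply: cvgN; apply: cvgM; first exact: cvg_cst.
  exact: norm_continuous.
under eq_integral do rewrite mulr0 addr0 cos0 mulrC EFinM.
rewrite ge0_integralZl_EFin//.
- rewrite cos0 mul1r expr0n/= addr0 => H.
  have : (\int[mu]_x (expR (- (eps * `|x|)))%:E = 2^-1%:E * ((1 + 1)%:E * \int[mu]_x (expR (- (eps * `|x|)))%:E))%E.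
    by rewrite muleA -EFinM (_ : 2^-1 * (1 + 1) = 1) ?mul1e//; field.
  rewrite H => ->; rewrite -EFinM; congr EFin; field.
  by rewrite (gt_eqF e0).
by apply/measurable_EFinP; exact: continuous_measurable_fun.
Qed.

Lemma integrable_abel1 (eps : R) : 0 < eps ->
  mu.-L1 (fun x => expR (- (eps * `|x|))).
Proof.
move=> e0; apply/integrableP; split.
  apply/measurable_EFinP; apply: continuous_measurable_fun => x.
  apply: (continuous_comp (f := fun x : R => - (eps * `|x|))); last exact: continuous_expR.
  apply: cvgN; apply: cvgM; first exact: cvg_cst.
  exact: norm_continuous.
under eq_integral do rewrite /= ger0_norm ?expR_ge0//.
by rewrite abel1_eps// ltry.
Qed.

Lemma Rintegral_abel1 (eps z c : R) : 0 < eps ->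
  \int[mu]_x (expR (- (eps * `|x|)) * cos (x * z + c)) =
  cos c * (2 * eps / (eps ^+ 2 + z ^+ 2)).
Proof.
move=> e0.
have iE := integrable_abel1 e0.
have iEc : mu.-L1 (fun x => expR (- (eps * `|x|)) * (1 + cos (x * z + c))).
  apply: (integrableM_bounded (M := 2) iE).
    apply: continuous_measurable_fun => x; apply: cvgD; first exact: cvg_cst.
    apply: (continuous_comp (f := fun x : R => x * z + c)); last exact: continuous_cos.
    by apply: cvgD; [apply: cvgM; [exact: cvg_id|exact: cvg_cst]|exact: cvg_cst].
  move=> x; have := cos_geN1 (x * z + c); have := cos_le1 (x * z + c) => ? ?.
  rewrite ler_norml; apply/andP; split; lra.
transitivity (\int[mu]_x (expR (- (eps * `|x|)) * (1 + cos (x * z + c)) - expR (- (eps * `|x|)))).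
  by apply: eq_Rintegral => x _; rewrite mulrDr mulr1 [in RHS]addrC addKr.
by rewrite RintegralB// /Rintegral integral_abel1// abel1_eps//= addrC addKr.
Qed.

(** The convergence factor of Abel summation, one exponential per coordinate. *)
Definition abel n (eps : R) (w : 'rV[R]_n) : R := \prod_j expR (- (eps * `|w ord0 j|)).

Lemma abel_ge0 n eps (w : 'rV[R]_n) : 0 <= abel eps w.
Proof. by apply: prodr_ge0 => j _; exact: expR_ge0. Qed.

Lemma abel_le1 n eps (w : 'rV[R]_n) : 0 <= eps -> abel eps w <= 1.
Proof.
move=> e0; suff /andP[] : 0 <= abel eps w <= 1 by [].
apply: (big_ind (fun x => 0 <= x <= 1)) => [|x y /andP[x0 x1] /andP[y0 y1]|j _].
- by rewrite ler01 lexx.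
- by rewrite mulr_ge0//= mulr_ile1.
- by rewrite expR_ge0/= -expR0 ler_expR oppr_le0 mulr_ge0.
Qed.

Lemma measurable_abel n eps : measurable_fun setT (@abel n eps).
Proof.
apply: measurable_prod => j _; apply: measurableT_comp => //.
apply: measurableT_comp => //; apply: measurable_funM => //.
by apply: measurableT_comp => //; exact: (measurable_rV_coord (R:=R)).
Qed.

Lemma integrable_abel n eps : 0 < eps ->
  (lebesgue_rV R n).-L1 (@abel n eps).
Proof.
move=> e0; apply/integrableP; split; first by apply/measurable_EFinP; exact: measurable_abel.
under eq_integral do rewrite /= ger0_norm ?abel_ge0//.
rewrite /abel (ge0_integral_prod_rV (k := fun _ t => expR (- (eps * `|t|)))).
- under eq_bigr do rewrite abel1_eps//.
  by rewrite prodEFin ltry.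
- move=> _; have /measurable_EFinP := measurable_int _ (integrable_abel1 e0); exact.
- by move=> _ t; exact: expR_ge0.
Qed.

Lemma measurable_cos_dot n (z : 'rV[R]_n) (c : R) :
  measurable_fun setT (fun w : 'rV[R]_n => cos (dot w z + c)).
Proof.
apply: (measurableT_comp (f := @cos R)); first exact: continuous_measurable_fun (@continuous_cos R).
by apply: measurable_funD => //; exact: measurable_dot.
Qed.

(** By induction on the dimension, the first coordinate being absorbed by the
    phase c. *)
Lemma Rintegral_abel n (eps : R) (z : 'rV[R]_n) (c : R) : 0 < eps ->
  \int[lebesgue_rV R n]_w (abel eps w * cos (dot w z + c)) =
  cos c * \prod_j (2 * eps / (eps ^+ 2 + z ord0 j ^+ 2)).
Proof.
move=> e0; elim: n z c => [|n IH] z c.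
  rewrite /= /Rintegral integral_dirac//=; last first.
    by apply/measurable_EFinP; apply: measurable_funM; [exact: measurable_abel|exact: measurable_cos_dot].
  rewrite indicE in_setT mul1r; by rewrite /abel /dot !big_ord0 mul1r mulr1 add0r.
have mcos := @measurable_cos_dot n.+1 z c.
rewrite Rintegral_rV_succ; last first.
  apply: (integrableM_bounded (M := 1)) => //; first exact: integrable_abel.
  by move=> w; rewrite ler_norml cos_geN1 cos_le1.
transitivity (\int[mu]_t (expR (- (eps * `|t|)) * cos (t * z ord0 ord0 + c)
  * \prod_(j < n) (2 * eps / (eps ^+ 2 + z ord0 (lift ord0 j) ^+ 2)))).
  apply: eq_Rintegral => t _.
  pose z' : 'rV[R]_n := \row_j z ord0 (lift ord0 j).
  transitivity (\int[lebesgue_rV R n]_v (expR (- (eps * `|t|)) * (abel eps v * cos (dot v z' + (t * z ord0 ord0 + c))))).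
    apply: eq_Rintegral => v _; rewrite /abel big_ord_recl rV_cons0 -mulrA; congr (_ * _).
    rewrite (eq_bigr (fun j => expR (- (eps * `|v ord0 j|)))); last first.
      by move=> j _; rewrite rV_consS.
    congr (_ * cos _); rewrite addrA; congr (_ + _).
    rewrite /dot big_ord_recl rV_cons0 addrC; congr (_ + _).
    by apply: eq_bigr => j _; rewrite rV_consS mxE.
  have iA : (lebesgue_rV R n).-L1 (fun v => abel eps v * cos (dot v z' + (t * z ord0 ord0 + c))).
    apply: (integrableM_bounded (M := 1)); first exact: integrable_abel.
      exact: measurable_cos_dot.
    by move=> w; rewrite ler_norml cos_geN1 cos_le1.
  rewrite RintegralZl// IH mulrA; congr (_ * _).
  by apply: eq_bigr => j _; rewrite mxE.
rewrite RintegralZr//; last first.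
  apply: (integrableM_bounded (M := 1)); first exact: integrable_abel1.
    apply: (measurableT_comp (f := @cos R)); first exact: continuous_measurable_fun (@continuous_cos R).
    by apply: measurable_funD => //; exact: measurable_funM.
  by move=> w; rewrite ler_norml cos_geN1 cos_le1.
by rewrite Rintegral_abel1// [in RHS]big_ord_recl [in RHS]mulrA.
Qed.

End abel_kernel.

Section inversion.
Context (R : realType) (d : nat).
Local Notation mu := (@lebesgue_measure R).
Local Notation lam := (lebesgue_rV R d).
Variables (u v : 'rV[R]_d -> R).

(** The real and imaginary parts of the Fourier transform of u + iv. *)
Definition fourier_re (w : 'rV[R]_d) : R :=
  (2 * pi) ^- d * \int[lam]_y (u y * cos (dot w y) + v y * sin (dot w y)).
Definition fourier_im (w : 'rV[R]_d) : R :=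
  (2 * pi) ^- d * \int[lam]_y (v y * cos (dot w y) - u y * sin (dot w y)).

End inversion.

(** The real part of (p w + i q w) exp(i theta). *)
Definition wave (R : realType) d (p q : 'rV[R]_d -> R) (w : 'rV[R]_d) (th : R) : R :=
  p w * cos th - q w * sin th.

Section inversion_lemmas.
Context (R : realType) (d : nat).
Local Notation mu := (@lebesgue_measure R).
Local Notation lam := (lebesgue_rV R d).
Variables (u v : 'rV[R]_d -> R).
Hypotheses (iu : lam.-L1 u) (iv : lam.-L1 v).
Local Notation p := (fourier_re u v).
Local Notation q := (fourier_im u v).

Let mu_ : measurable_fun setT u. Proof. by apply/measurable_EFinP; exact: measurable_int iu. Qed.
Let mv_ : measurable_fun setT v. Proof. by apply/measurable_EFinP; exact: measurable_int iv. Qed.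
Let mcos : measurable_fun setT (@cos R). Proof. exact: continuous_measurable_fun (@continuous_cos R). Qed.
Let msin : measurable_fun setT (@sin R). Proof. exact: continuous_measurable_fun (@continuous_sin R). Qed.

Let icos (f g : 'rV[R]_d -> R) : lam.-L1 f -> measurable_fun setT g ->
  lam.-L1 (fun y => f y * cos (g y)).
Proof.
move=> fi mg; apply: (integrableM_bounded (M := 1)) => //; first exact: measurableT_comp.
by move=> y; rewrite ler_norml cos_geN1 cos_le1.
Qed.

Let isin (f g : 'rV[R]_d -> R) : lam.-L1 f -> measurable_fun setT g ->
  lam.-L1 (fun y => f y * sin (g y)).
Proof.
move=> fi mg; apply: (integrableM_bounded (M := 1)) => //; first exact: measurableT_comp.
by move=> y; rewrite ler_norml sin_geN1 sin_le1.
Qed.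

Let mdot (w : 'rV[R]_d) : measurable_fun setT (dot w).
Proof. exact: measurable_dot. Qed.

(** The phase of the frequency w at the point y is subtracted from th by the
    addition formulas. *)
Lemma wave_fourier (w : 'rV[R]_d) th : wave p q w th =
  (2 * pi) ^- d * \int[lam]_y (u y * cos (th - dot w y) - v y * sin (th - dot w y)).
Proof.
have iuc := icos iu (mdot w); have ivc := icos iv (mdot w).
have ius := isin iu (mdot w); have ivs := isin iv (mdot w).
rewrite /wave /fourier_re /fourier_im.
rewrite -!mulrA -mulrBr; congr (_ * _).
rewrite -!RintegralZr//; last 2 first.
- exact: integrableBR.
- exact: integrableDR.
rewrite -RintegralB//; last 2 first.
- have := integrableZR (cos th) measurableT (integrableDR iuc ivs).
  by under [in X in X -> _]eq_fun do rewrite mulrC.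
- have := integrableZR (sin th) measurableT (integrableBR ivc ius).
  by under [in X in X -> _]eq_fun do rewrite mulrC.
by apply: eq_Rintegral => y _; rewrite cosB sinB; ring.
Qed.

Lemma wave_le (w : 'rV[R]_d) th : `|wave p q w th| <= (2 * pi) ^- d *
  (\int[lam]_y `|u y| + \int[lam]_y `|v y|).
Proof.
have c0 : 0 <= (2 * pi : R) ^- d by rewrite invr_ge0 exprn_ge0// mulr_ge0// pi_ge0.
rewrite wave_fourier normrM ger0_norm// ler_wpM2l//.
have mg : measurable_fun setT (fun y => th - dot w y) by apply: measurable_funB.
have iK := integrableBR (icos iu mg) (isin iv mg).
apply: (le_trans (le_normr_Rintegral _ iK)) => //.
have iau : lam.-L1 (fun y => `|u y|) by exact: integrable_norm iu.
have iav : lam.-L1 (fun y => `|v y|) by exact: integrable_norm iv.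
rewrite -RintegralD//; apply: le_Rintegral => //.
- exact: integrable_norm iK.
- exact: integrableDR.
- move=> y _; apply: (le_trans (ler_normB _ _)); rewrite !normrM lerD// ler_piMr//.
  + by rewrite ler_norml cos_geN1 cos_le1.
  + by rewrite ler_norml sin_geN1 sin_le1.
Qed.

Let kern eps x (z : 'rV[R]_d * 'rV[R]_d) := abel eps z.1 *
  (u z.2 * cos (dot z.1 x - dot z.1 z.2) - v z.2 * sin (dot z.1 x - dot z.1 z.2)).

Let mkern eps x : measurable_fun setT (kern eps x).
Proof.
have md : measurable_fun setT (fun z : 'rV[R]_d * 'rV[R]_d => dot z.1 x - dot z.1 z.2).
  by apply: measurable_funB; exact: measurable_dot.
apply: measurable_funM; first by apply: measurableT_comp => //; exact: measurable_abel.
apply: measurable_funB; apply: measurable_funM; exact: measurableT_comp.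
Qed.

Let ikern eps x : 0 < eps -> (lam \x lam)%E.-L1 (kern eps x).
Proof.
move=> e0.
have iuv := integrableDR (integrable_norm iu) (integrable_norm iv).
apply: (integrable_prod_le _ (integrable_abel d e0) iuv); first exact: mkern.
move=> w y; rewrite /kern/= normrM ler_wpM2l// [leRHS]ger0_norm ?addr_ge0//.
apply: (le_trans (ler_normB _ _)); rewrite !normrM lerD// ler_piMr//.
- by rewrite ler_norml cos_geN1 cos_le1.
- by rewrite ler_norml sin_geN1 sin_le1.
Qed.

Let kern_wave eps x w : \int[lam]_y kern eps x (w, y) = abel eps w * ((2 * pi) ^+ d * wave p q w (dot w x)).
Proof.
have mg : measurable_fun setT (fun y => dot w x - dot w y) by apply: measurable_funB.
have iK := integrableBR (icos iu mg) (isin iv mg).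
rewrite /kern/= RintegralZl// wave_fourier mulVKf//.
by rewrite expf_neq0// mulf_neq0// gt_eqF// pi_gt0.
Qed.

(** The transform is a Fubini integral at the damping 1 and the point 0, up to
    a factor that the formal damping -1 cancels. *)
Lemma measurable_fourier_re : measurable_fun setT p.
Proof.
have /measurable_EFinP := measurable_int _ (integrable_Rfubini1 (ikern 0 ltr01)).
under eq_fun do rewrite kern_wave.
move=> mf.
have -> : p = fun w => (abel 1 w * ((2 * pi) ^+ d * wave p q w (dot w 0))) *
    (abel (-1) w * (2 * pi) ^- d).
  apply/funext => w; rewrite [dot w 0](_ : _ = 0); last first.
    by rewrite /dot big1// => i _; rewrite mxE mulr0.
  rewrite /wave cos0 sin0 mulr0 subr0 mulr1 mulrACA.
  rewrite (_ : abel 1 w * abel (-1) w = 1); last first.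
    rewrite /abel -big_split big1//= => j _.
    by rewrite -expRD mulN1r opprK mul1r addNr expR0.
  by rewrite mul1r mulrAC divff ?mul1r// expf_neq0// mulf_neq0// gt_eqF// pi_gt0.
apply: measurable_funM => //; apply: measurable_funM => //.
exact: measurable_abel.
Qed.

(** Damping the inverse Fourier integral convolves with the Poisson kernel. *)
Lemma Rintegral_abel_wave eps x : 0 < eps ->
  \int[lam]_w (abel eps w * wave p q w (dot w x)) =
  \int[lam]_y (u y * \prod_j (pi^-1 * (eps / (eps ^+ 2 + (x ord0 j - y ord0 j) ^+ 2)))).
Proof.
move=> e0.
have pi0 : pi != 0 :> R by rewrite gt_eqF// pi_gt0.
have c0 : (2 * pi : R) ^+ d != 0 by rewrite expf_neq0// mulf_neq0.
have := Rfubini (ikern x e0).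
under eq_Rintegral do rewrite kern_wave mulrCA.
have iL : lam.-L1 (fun w => abel eps w * wave p q w (dot w x)).
  have := integrableZR ((2 * pi) ^- d) measurableT (integrable_Rfubini1 (ikern x e0)).
  rewrite (_ : (fun w => (2 * pi) ^- d * _) = fun w => abel eps w * wave p q w (dot w x))//.
  by apply/funext => w; rewrite kern_wave mulrCA mulKf.
rewrite RintegralZl// => /(congr1 (fun r => (2 * pi) ^- d * r)).
rewrite mulrA mulVf// mul1r => ->.
rewrite -RintegralZl//; last exact: (integrable_Rfubini2 (ikern x e0)).
apply: eq_Rintegral => y _; rewrite /kern/=.
have dotB w : dot w x - dot w y = dot w (x - y).
  by rewrite /dot -sumrB; apply: eq_bigr => k _; rewrite !mxE mulrBr.
have iE := integrable_abel d e0.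
have icd c : lam.-L1 (fun w => abel eps w * cos (dot w (x - y) + c)).
  apply: (icos iE) => //; apply: measurable_funD => //.
  exact: measurable_dot.
transitivity ((2 * pi) ^- d * \int[lam]_w
   (u y * (abel eps w * cos (dot w (x - y) + 0)) + v y * (abel eps w * cos (dot w (x - y) + pi / 2)))).
  congr (_ * _); apply: eq_Rintegral => w _.
  by rewrite addr0 cosDpihalf dotB; ring.
rewrite RintegralD//; [|exact: integrableZR|exact: integrableZR].
rewrite !RintegralZl// !Rintegral_abel// cos0 cos_pihalf mul0r mulr0 addr0 mul1r mulrCA.
congr (_ * _).
rewrite -exprVn -{1}(card_ord d) -prodr_const -big_split/=.
apply: eq_bigr => j _; rewrite !mxE; set D := _ + _.
rewrite invfM; transitivity ((2^-1 * 2) * (pi^-1 * (eps / D))); first by ring.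
by rewrite mulVf ?mul1r.
Qed.

End inversion_lemmas.

Lemma measurable_fourier_im (R : realType) d (u v : 'rV[R]_d -> R) :
  (lebesgue_rV R d).-L1 u ->
  (lebesgue_rV R d).-L1 v ->
  measurable_fun setT (fourier_im u v).
Proof.
move=> iu iv; have -> : fourier_im u v = fourier_re v (fun y => -1 * u y).
  apply/funext => w; congr (_ * _); apply: eq_Rintegral => y _.
  by rewrite mulN1r mulNr.
by apply: measurable_fourier_re => //; exact: integrableZR.
Qed.

Section box_average.
Context (R : realType).
Local Notation mu := (@lebesgue_measure R).

Definition poisson (eps t : R) : R := pi^-1 * (eps / (eps ^+ 2 + t ^+ 2)).

Lemma poisson_ge0 eps t : 0 <= eps -> 0 <= poisson eps t.
Proof.
move=> e0; rewrite /poisson mulr_ge0 ?invr_ge0 ?pi_ge0// divr_ge0//.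
by rewrite addr_ge0// sqr_ge0.
Qed.

Lemma continuous_poisson eps y : 0 < eps -> continuous (fun t : R => poisson eps (t - y)).
Proof.
move=> e0 t; apply: cvgM; first exact: cvg_cst.
apply: cvgM; first exact: cvg_cst.
apply: cvgV; first by rewrite gt_eqF// ltr_pwDl ?exprn_gt0// sqr_ge0.
apply: cvgD; first exact: cvg_cst.
by apply: cvgM; (apply: cvgB; [exact: cvg_id|exact: cvg_cst]).
Qed.

Definition box_atan (eps a b y : R) : R := pi^-1 * (atan ((b - y) / eps) - atan ((a - y) / eps)).

Lemma integral_poisson eps a b y : 0 < eps -> a <= b ->
  (\int[mu]_(t in `[a, b]) (poisson eps (t - y))%:E = (box_atan eps a b y)%:E)%E.
Proof.
move=> e0 ab.
have dF (t : R) : is_derive t (1 : R) (fun t => pi^-1 * atan ((t - y) / eps)) (poisson eps (t - y)).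
  have d1 : is_derive t (1 : R) (fun t => (t - y) / eps) eps^-1.
    have := is_deriveB (is_derive_id t (1 : R)) (is_derive_cst y t (1 : R)).
    move=> /(is_deriveZ eps^-1); rewrite subr0 /GRing.scale/= mulr1.
    rewrite (_ : eps^-1 \*: _ = fun t => (t - y) / eps)//.
    by apply/funext => s; rewrite /= /GRing.scale/= mulrC.
  have d2 := @is_derive1_comp _ (@atan R) (fun t => (t - y) / eps) _ _ _ (is_derive1_atan ((t - y) / eps)) d1.
  have := is_deriveZ (pi^-1 : R) d2.
  rewrite (_ : pi^-1 \*: _ = fun t => pi^-1 * atan ((t - y) / eps))//.
  move/is_derive_eq; apply; rewrite /poisson /GRing.scale/=; congr (_ * _).
  have D0 : eps ^+ 2 + (t - y) ^+ 2 != 0 by rewrite gt_eqF// ltr_pwDl ?exprn_gt0// sqr_ge0.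
  rewrite (_ : 1 + ((t - y) / eps) ^+ 2 = (eps ^+ 2 + (t - y) ^+ 2) / eps ^+ 2).
    by field; rewrite D0 gt_eqF.
  by field; rewrite gt_eqF.
rewrite (integral_FTC ab (continuous_poisson e0) dF) /box_atan mulrBr.
by [].
Qed.

Lemma box_atan_bound eps a b y : 0 < eps -> a <= b -> 0 <= box_atan eps a b y <= 1.
Proof.
move=> e0 ab; rewrite /box_atan; apply/andP; split.
  rewrite mulr_ge0 ?invr_ge0 ?pi_ge0// subr_ge0 le_atan// ler_pM2r ?invr_gt0// lerD2r.
  exact: ab.
rewrite ler_pdivrMl ?pi_gt0// mulr1.
have := atan_ltpi2 ((b - y) / eps); have := atan_gtNpi2 ((a - y) / eps).
have : pi / 2 + pi / 2 = pi :> R by field.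
lra.
Qed.

Lemma cvg_atan_eps (c : R) : c != 0 ->
  atan (c / n.+1%:R^-1) @[n --> \oo] --> (if 0 < c then pi / 2 else - (pi / 2)).
Proof.
move=> c0.
have pos (e : R) : 0 < e -> atan (e / n.+1%:R^-1) @[n --> \oo] --> (pi / 2 : R).
  move=> e0; apply: (@cvg_comp _ _ _ (fun n : nat => e / n.+1%:R^-1) atan _ (pinfty_nbhs R)); last exact: cvgy_atan.
  under eq_fun do rewrite invrK mulrC.
  apply: (@cvg_comp _ _ _ (fun n : nat => n.+1%:R) (fun r => r * e) _ (pinfty_nbhs R)); last first.
    by apply: gt0_cvgMly e0 _; exact: cvg_id.
  under eq_fun do rewrite -addn1.
  exact: (@cvg_comp _ _ _ (fun n => (n + 1)%N) (fun n => n%:R : R) _ _ _ (cvg_addnr 1%N) cvgr_idn).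
case: ifPn => [|]; first exact: pos.
rewrite -leNgt le_eqVlt (negbTE c0)/= => cN.
rewrite (_ : (fun n => _) = fun n : nat => - atan (- c / n.+1%:R^-1)); last first.
  by apply/funext => n; rewrite mulNr atanN opprK.
by apply: cvgN; apply: pos; rewrite oppr_gt0.
Qed.

Lemma cvg_box_atan a b y : a <= b -> y != a -> y != b ->
  box_atan n.+1%:R^-1 a b y @[n --> \oo] --> (\1_`[a, b] y : R).
Proof.
move=> ab ya yb.
have pi0 : pi != 0 :> R by rewrite gt_eqF// pi_gt0.
have L : box_atan n.+1%:R^-1 a b y @[n --> \oo] -->
    pi^-1 * ((if 0 < b - y then pi / 2 else - (pi / 2)) - (if 0 < a - y then pi / 2 else - (pi / 2))).
  apply: cvgM; first exact: cvg_cst.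
  by apply: cvgB; apply: cvg_atan_eps; rewrite subr_eq0 eq_sym.
rewrite indicE (_ : (y \in _)%:R = pi^-1 * ((if 0 < b - y then pi / 2 else - (pi / 2)) - (if 0 < a - y then pi / 2 else - (pi / 2))) :> R)//.
rewrite !subr_gt0; have [yltb|bley] := ltP y b; have [ylta|aley] := ltP y a.
- by rewrite subrr mulr0 memNset//= in_itv/= leNgt ylta.
- by rewrite mem_set /= ?in_itv/= ?aley ?(ltW yltb)// opprK (_ : pi / 2 + pi / 2 = pi) ?mulVf//; field.
- by have := lt_le_trans ylta (le_trans ab bley); rewrite ltxx.
- rewrite subrr mulr0 memNset//= in_itv/= => /andP[_ yb'].
  by move: yb; rewrite eq_le yb' bley.
Qed.

End box_average.

Lemma cvg_Rintegral d (T : measurableType d) (R : realType) (mu : {measure set T -> \bar R})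
    (F : nat -> T -> R) (f g : T -> R) :
  (forall n, measurable_fun setT (F n)) -> measurable_fun setT f ->
  {ae mu, forall x, F n x @[n --> \oo] --> f x} ->
  mu.-L1 g -> (forall n x, `|F n x| <= g x) ->
  \int[mu]_x F n x @[n --> \oo] --> \int[mu]_x f x.
Proof.
move=> mF mf Ff ig Fg.
have iF n : mu.-L1 (F n) by exact: integrable_le ig (Fg n).
have mFE n : measurable_fun setT (EFin \o F n) by exact/measurable_EFinP.
have mfE : measurable_fun setT (EFin \o f) by exact/measurable_EFinP.
have FfE : {ae mu, forall x, setT x -> (F n x)%:E @[n --> \oo] --> (EFin \o f) x}.
  by move: Ff; apply: filterS => x Fx _; apply: cvg_EFin; [exact: nearW|exact: Fx].
have FgE : {ae mu, forall x n, setT x -> (`|(F n x)%:E| <= (EFin \o g) x)%E}.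
  by apply: aeW => x n _; rewrite /= lee_fin.
have [fi _] := dominated_convergence measurableT mFE mfE FfE ig FgE.
by rewrite -(EFin_Rintegral measurableT fi); exact: fine_cvg.
Qed.

Section orthants.
Context (R : realType) (n : nat).
Local Notation lam := (lebesgue_rV R n).

Definition orthant (a : 'rV[R]_n) : set 'rV[R]_n := [set v | forall i, a ord0 i <= v ord0 i].

Lemma orthants_generate : measurable = <<s range orthant >> :> set (set 'rV[R]_n).
Proof.
apply/seteqP; split.
  apply: smallest_sub; first exact: smallest_sigma_algebra.
  rewrite -bigcup_seq/=; apply: bigcup_sub => i _ _ [Y mY <-]; rewrite setTI.
  have := mY; rewrite [X in X Y](RGenCInfty.measurableE R); move: Y {mY}.
  apply: smallest_sub.
    split.
    - by rewrite /= preimage_set0; exact: sigma_algebra0.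
    - by move=> A hA /=; rewrite setTD preimage_setC; exact: sigma_algebraC.
    - by move=> F hF /=; rewrite preimage_bigcup; exact: sigma_algebra_bigcup.
  move=> _ [a ->] /=.
  rewrite (_ : _ @^-1` _ = \bigcup_k orthant (\row_j if j == i then a else - k%:R)).
    apply: sigma_algebra_bigcup => k; apply: sub_sigma_algebra.
    by exists (\row_j if j == i then a else - k%:R).
  apply/seteqP; split => v /=; rewrite /rV_coord in_itv/= andbT.
    move=> av.
    exists (\max_(j < n) Num.bound `|v ord0 j|)%N => // j; rewrite mxE.
    case: eqP => [->//|_]; rewrite lerNl.
    apply: (@le_trans _ _ (Num.bound `|v ord0 j|)%:R); last by rewrite ler_nat leq_bigmax.
    by apply: (le_trans (ler_norm _)); rewrite normrN ltW//; exact: archi_boundP.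
  by move=> [k _ /(_ i)]; rewrite mxE eqxx.
apply: smallest_sub; first exact: sigma_algebra_measurable.
move=> _ [a _ <-].
have := @measurable_rV_box R n (fun i => `[a ord0 i, +oo[%classic) (fun i => measurable_itv _).
by congr measurable; apply/seteqP; split => v /= h i; move: (h i); rewrite in_itv/= andbT.
Qed.

(** The orthants generate the sigma-algebra and are stable under intersection,
    and the sets on which the integral of k vanishes form a lambda-system. *)
Lemma ae_eq0_orthants (k : 'rV[R]_n -> R) : lam.-L1 k ->
  (\int[lam]_x (k x)%:E = 0)%E ->
  (forall a, \int[lam]_(x in orthant a) (k x)%:E = 0)%E ->
  {ae lam, forall x, k x = 0}.
Proof.
move=> ik kT kO.
have kS (S : set 'rV[R]_n) : measurable S -> lam.-integrable S (EFin \o k).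
  by move=> mS; exact: integrableS ik.
have k0 S : measurable S -> (\int[lam]_(x in S) (k x)%:E = 0)%E.
  rewrite orthants_generate; move: S; apply: (@dynkin_induction _ _ (range orthant) (fun S => (\int[lam]_(x in S) (k x)%:E = 0)%E)) => //.
  - exact: orthants_generate.
  - move=> _ _ [a _ <-] [b _ <-].
    exists (\row_i Num.max (a ord0 i) (b ord0 i)) => //.
    apply/seteqP; split => v /=.
      by move=> h; split=> i; move: (h i); rewrite mxE ge_max => /andP[].
    by move=> [h1 h2] i; rewrite mxE ge_max h1 h2.
  - by move=> _ [a _ <-].
  - move=> S mS S0.
    have : (\int[lam]_(x in S `|` ~` S) (k x)%:E = 0)%E by rewrite setUv.
    rewrite (integral_setU _ mS (measurableC mS)) ?S0 ?add0e//.
    + by rewrite setUv; case/integrableP: ik.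
    + by rewrite disj_set2E setICr.
  - move=> F mF tF F0; rewrite integral_bigcup//; last exact/kS/bigcup_measurable.
    by rewrite eseries0.
have := @integral_ae_eq _ _ _ lam setT measurableT (cst 0%E) _ ik _ _.
case=> [|E _ mE|N].
- exact: measurable_cst.
- by rewrite k0// integral_cst// mul0e.
- move=> h; exists N; move: h => [mN N0 h]; split => // x /= kx; apply: h => /= /(_ I) e.
  by apply: kx; case: e.
Qed.

End orthants.

(** Adding a dominating function makes the integrand nonnegative, so that the
    Tonelli measurability applies without integrability on the product. *)
Lemma measurable_Rintegral_param d1 d2 (T1 : measurableType d1) (T2 : measurableType d2)
    (R : realType) (m2 : {sigma_finite_measure set T2 -> \bar R})
    (f : T1 * T2 -> R) (g : T2 -> R) : measurable_fun setT f ->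
  m2.-L1 g -> (forall x y, `|f (x, y)| <= g y) ->
  measurable_fun setT (fun x => \int[m2]_y f (x, y)).
Proof.
move=> mf ig fg.
have mg : measurable_fun setT g by apply/measurable_EFinP; exact: measurable_int ig.
have ifx x : m2.-L1 (fun y => f (x, y)).
  apply: (integrable_le _ ig) => //.
  exact: (measurableT_comp mf (pair1_measurable x)).
rewrite (_ : (fun x => _) = fun x => fine (\int[m2]_y (f (x, y) + g y)%:E)%E - \int[m2]_y g y).
  apply: measurable_funB => //; apply: measurableT_comp => //.
  apply: (@measurable_fun_fubini_tonelli_F _ _ _ _ _ m2 (fun z => (f z + g z.2)%:E)).
    apply/measurable_EFinP; apply: measurable_funD => //; exact: measurableT_comp.
  by move=> [x y]; rewrite lee_fin/= -lerBlDr sub0r; move: (fg x y); rewrite ler_norml => /andP[].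
apply/funext => x; have := RintegralD measurableT (ifx x) ig.
by rewrite /Rintegral => ->; rewrite addrK.
Qed.

Lemma integrable_indicator d (T : measurableType d) (R : realType)
    (mu : {measure set T -> \bar R}) (A : set T) (c : R) : measurable A ->
  (mu A < +oo)%E -> mu.-L1 (fun x => c * \1_A x).
Proof.
move=> mA Aoo; apply: integrableZR => //; apply/integrableP; split.
  by apply/measurable_EFinP; exact: measurable_indic.
rewrite (eq_integral (fun x => (\1_A x)%:E)).
  by rewrite integral_indic// setIT.
by move=> x _; rewrite /= ger0_norm.
Qed.

Section boxes.
Context (R : realType) (n : nat).
Local Notation lam := (lebesgue_rV R n).

Definition box (a b : 'I_n -> R) : set 'rV[R]_n :=
  [set x | forall i, a i <= x ord0 i <= b i].

Lemma boxE a b : box a b = [set x | forall i, `[a i, b i]%classic (x ord0 i)].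
Proof. by apply/seteqP; split => x /= h i; move: (h i); rewrite in_itv/=. Qed.

Lemma measurable_box a b : measurable (box a b).
Proof. by rewrite boxE; apply: (@measurable_rV_box R n (fun i => `[a i, b i]%classic)) => i; exact: measurable_itv. Qed.

Lemma indic_box a b (x : 'rV[R]_n) : \1_(box a b) x = \prod_i \1_`[a i, b i] (x ord0 i) :> R.
Proof.
have [bx|bx] := pselect (box a b x).
  rewrite indicE mem_set// big1// => i _.
  by rewrite indicE mem_set//= in_itv/=; exact: bx.
rewrite indicE memNset//; have [i hi] : exists i, ~ (a i <= x ord0 i <= b i).
  by apply/existsNP => h; exact: bx.
by rewrite (bigD1 i)//= indicE memNset ?mul0r//= in_itv.
Qed.

End boxes.

Lemma measurable_box_atan (R : realType) (eps a b : R) : measurable_fun setT (box_atan eps a b).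
Proof.
have ma c : measurable_fun setT (fun y : R => atan ((c - y) / eps)).
  apply: (measurableT_comp (f := @atan R)).
    exact: continuous_measurable_fun (@continuous_atan R).
  by apply: measurable_funM => //; apply: measurable_funB.
by apply: measurable_funM => //; exact: measurable_funB.
Qed.

Lemma measurable_hyperplane (R : realType) n (j : 'I_n) (c : R) :
  measurable [set y : 'rV[R]_n | y ord0 j = c].
Proof.
rewrite -[X in measurable X]setTI.
exact: (@measurable_rV_coord R n j measurableT [set c] (measurable_set1 c)).
Qed.

Lemma ae_off_hyperplanes (R : realType) n (a : 'I_n -> R) :
  {ae lebesgue_rV R n, forall y : 'rV[R]_n, forall j, y ord0 j != a j}.
Proof.
apply: filter_forall => j; exists [set y : 'rV[R]_n | y ord0 j = a j]; split.
- exact: measurable_hyperplane.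
- exact: lebesgue_rV_hyperplane.
- by move=> y /= /negP; rewrite negbK => /eqP.
Qed.

Section inversion_theorem.
Context (R : realType) (n : nat).
Local Notation mu := (@lebesgue_measure R).
Local Notation lam := (lebesgue_rV R n).

Lemma wave_le_normD (p q : 'rV[R]_n -> R) w th : `|wave p q w th| <= `|p w| + `|q w|.
Proof.
rewrite (le_trans (ler_normB _ _))// !normrM lerD// ler_piMr//.
- by rewrite ler_norml cos_geN1 cos_le1.
- by rewrite ler_norml sin_geN1 sin_le1.
Qed.

Lemma measurable_wave (p q : 'rV[R]_n -> R) d (T : measurableType d) (f : T -> 'rV[R]_n) (h : T -> R) :
  measurable_fun setT p -> measurable_fun setT q ->
  measurable_fun setT f -> measurable_fun setT h ->
  measurable_fun setT (fun t => wave p q (f t) (h t)).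
Proof.
move=> mp mq mf mh; apply: measurable_funB; apply: measurable_funM.
- exact: measurableT_comp.
- by apply: measurableT_comp => //; exact: continuous_measurable_fun (@continuous_cos R).
- exact: measurableT_comp.
- by apply: measurableT_comp => //; exact: continuous_measurable_fun (@continuous_sin R).
Qed.

Lemma poisson_le eps (t : R) : 0 < eps -> poisson eps t <= pi^-1 * eps^-1.
Proof.
move=> e0; rewrite /poisson ler_wpM2l ?invr_ge0 ?pi_ge0//.
rewrite ler_pdivrMr ?ltr_pwDl ?exprn_gt0 ?sqr_ge0//.
by rewrite mulrDr expr2 mulKf ?gt_eqF// lerDl mulr_ge0 ?sqr_ge0// invr_ge0 ltW.
Qed.

Lemma poisson_prod_bound eps (z : 'I_n -> R) : 0 < eps ->
  `|\prod_j poisson eps (z j)| <= (pi^-1 * eps^-1) ^+ n.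
Proof.
move=> e0; rewrite ger0_norm; last by apply: prodr_ge0 => j _; rewrite poisson_ge0// ltW.
rewrite [leRHS](_ : _ = \prod_(j < n) (pi^-1 * eps^-1)); last by rewrite prodr_const card_ord.
by apply: ler_prod => j _; rewrite poisson_ge0 ?(ltW e0)//= poisson_le.
Qed.

Lemma measurable_poisson_prod eps d (T : measurableType d) (f g : T -> 'rV[R]_n) : 0 < eps ->
  measurable_fun setT f -> measurable_fun setT g ->
  measurable_fun setT (fun t => \prod_j poisson eps (f t ord0 j - g t ord0 j)).
Proof.
move=> e0 mf mg; apply: measurable_prod => j _; apply: measurableT_comp.
  apply: continuous_measurable_fun; have := @continuous_poisson R eps 0 e0.
  by under eq_fun do rewrite subr0.
by apply: measurable_funB; exact: measurable_rV_entry.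
Qed.

Lemma Rintegral_box_poisson eps (a b : 'I_n -> R) (y : 'rV[R]_n) : 0 < eps ->
  (forall i, a i <= b i) ->
  \int[lam]_x (\1_(box a b) x * \prod_j poisson eps (x ord0 j - y ord0 j)) =
  \prod_j box_atan eps (a j) (b j) (y ord0 j).
Proof.
move=> e0 ab; pose k j (t : R) := \1_`[a j, b j] t * poisson eps (t - y ord0 j) : R.
transitivity (\int[lam]_x (\prod_j k j (x ord0 j))).
  by apply: eq_Rintegral => x _; rewrite indic_box -big_split.
rewrite /Rintegral ge0_integral_prod_rV.
- rewrite (eq_bigr (fun j => (box_atan eps (a j) (b j) (y ord0 j))%:E)) ; last first.
    move=> j _; rewrite -(integral_poisson (y ord0 j) e0 (ab j)) [RHS]integral_mkcond; apply: eq_integral => t _.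
  rewrite /k patchE indicE; case: ifPn => _; by rewrite ?mul1r ?mul0r.
  by rewrite prodEFin.
- move=> j; apply: measurable_funM; first exact: measurable_indic.
  by apply: continuous_measurable_fun; exact: continuous_poisson.
- by move=> j t; rewrite mulr_ge0// poisson_ge0// ltW.
Qed.

Variables (u v : 'rV[R]_n -> R).
Hypotheses (iu : lam.-L1 u) (iv : lam.-L1 v).
Local Notation p := (fourier_re u v).
Local Notation q := (fourier_im u v).
Hypotheses (ip : lam.-L1 p) (iq : lam.-L1 q).

Definition inverse_fourier (x : 'rV[R]_n) : R := \int[lam]_w wave p q w (dot w x).

Let mp : measurable_fun setT p. Proof. by apply/measurable_EFinP; exact: measurable_int ip. Qed.
Let mq : measurable_fun setT q. Proof. by apply/measurable_EFinP; exact: measurable_int iq. Qed.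
Let mu_ : measurable_fun setT u. Proof. by apply/measurable_EFinP; exact: measurable_int iu. Qed.

Let ipq : lam.-L1 (fun w => `|p w| + `|q w|).
Proof. exact: integrableDR (integrable_norm ip) (integrable_norm iq). Qed.

Lemma integrable_wave (h : 'rV[R]_n -> R) : measurable_fun setT h ->
  lam.-L1 (fun w => wave p q w (h w)).
Proof.
move=> mh; apply: (integrable_le _ ipq); first exact: measurable_wave.
by move=> w; exact: wave_le_normD.
Qed.

Let iu' : lam.-L1 (fun x => `|u x|). Proof. exact: integrable_norm iu. Qed.

Section one_box.
Variables (a b : 'I_n -> R).
Hypothesis ab : forall i, a i <= b i.
Hypothesis boxoo : (lam (box a b) < +oo)%E.

Let mbox : measurable_fun setT (\1_(box a b) : 'rV[R]_n -> R).
Proof. exact: measurable_indic (measurable_box a b). Qed.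

Let kern eps (z : 'rV[R]_n * 'rV[R]_n) :=
  \1_(box a b) z.1 * (u z.2 * \prod_j poisson eps (z.1 ord0 j - z.2 ord0 j)).

Let ikern eps : 0 < eps -> (lam \x lam)%E.-L1 (kern eps).
Proof.
move=> e0.
apply: (integrable_prod_le _ (integrable_indicator ((pi^-1 * eps^-1) ^+ n) (measurable_box a b) boxoo) iu).
- apply: measurable_funM; first exact: measurableT_comp.
  apply: measurable_funM; first exact: measurableT_comp.
  exact: measurable_poisson_prod.
- move=> x y; rewrite /kern/= !normrM mulrCA mulrC ler_wpM2r// mulrC ler_wpM2r//.
  rewrite [leRHS]ger0_norm; first exact: poisson_prod_bound.
  by rewrite exprn_ge0// mulr_ge0 ?invr_ge0 ?pi_ge0// ltW.
Qed.

(** Fubini: averaging the Poisson integral of u over the box amounts to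
    averaging the kernel. *)
Lemma box_damped_wave eps : 0 < eps ->
  \int[lam]_x (\1_(box a b) x * \int[lam]_w (abel eps w * wave p q w (dot w x))) =
  \int[lam]_y (u y * \prod_j box_atan eps (a j) (b j) (y ord0 j)).
Proof.
move=> e0; transitivity (\int[lam]_x \int[lam]_y kern eps (x, y)).
  apply: eq_Rintegral => x _; rewrite (Rintegral_abel_wave iu iv)// /kern/=.
  rewrite RintegralZl//.
  apply: (integrableM_bounded (M := (pi^-1 * eps^-1) ^+ n)) => //.
    exact: measurable_poisson_prod.
  by move=> y; exact: poisson_prod_bound.
rewrite (Rfubini (ikern e0)); apply: eq_Rintegral => y _; rewrite /kern/=.
rewrite -Rintegral_box_poisson// -RintegralZl//.
  by apply: eq_Rintegral => x _; rewrite mulrCA.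
apply: (integrable_le _ (integrable_indicator ((pi^-1 * eps^-1) ^+ n) (measurable_box a b) boxoo)).
  apply: measurable_funM => //; exact: measurable_poisson_prod.
move=> x; rewrite normrM mulrC [`|\1_ _ _|]ger0_norm// ler_wpM2r//.
exact: poisson_prod_bound.
Qed.

Let cvg_poisson_scale : n_.+1%:R^-1 @[n_ --> \oo] --> (0 : R).
Proof. exact: cvg_harmonic. Qed.

Let cvg_abel (w : 'rV[R]_n) : abel k.+1%:R^-1 w @[k --> \oo] --> (1 : R).
Proof.
rewrite (_ : (fun k => _) = fun k : nat => expR (- (k.+1%:R^-1 * l1norm w))); last first.
  apply/funext => k; rewrite /abel /l1norm mulr_sumr -sumrN.
  by apply/esym; exact: (big_morph expR (@expRD R) (@expR0 R)).
rewrite -[X in _ --> X](expR0 R); apply: continuous_cvg; first exact: continuous_expR.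
rewrite -[X in _ --> X]oppr0; apply: cvgN; rewrite -(mul0r (l1norm w)).
by apply: cvgM; [exact: cvg_poisson_scale|exact: cvg_cst].
Qed.

Let k_gt0 (k : nat) : 0 < k.+1%:R^-1 :> R.
Proof. by rewrite invr_gt0 ltr0n. Qed.

Let mwave_dot (x : 'rV[R]_n) : measurable_fun setT (fun w => wave p q w (dot w x)).
Proof. by apply: measurable_wave => //; exact: measurable_dot. Qed.

Let abel_wave_le k x w : `|abel k.+1%:R^-1 w * wave p q w (dot w x)| <= `|p w| + `|q w|.
Proof.
rewrite normrM ger0_norm ?abel_ge0//; apply: (le_trans _ (wave_le_normD p q w (dot w x))).
by rewrite ler_piMl// abel_le1// ltW// k_gt0.
Qed.

Lemma measurable_inverse_fourier : measurable_fun setT inverse_fourier.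
Proof.
apply: (measurable_Rintegral_param (f := fun z => wave p q z.2 (dot z.2 z.1)) _ ipq).
  by apply: measurable_wave => //; exact: measurable_dot.
by move=> x w; exact: wave_le_normD.
Qed.

Lemma inverse_fourier_le x : `|inverse_fourier x| <= \int[lam]_w (`|p w| + `|q w|).
Proof.
have iw := integrable_wave (measurable_dot (@measurable_id _ _ setT) (measurable_cst x)).
apply: (le_trans (le_normr_Rintegral measurableT iw)).
apply: le_Rintegral => //; first exact: integrable_norm iw.
by move=> w _; exact: wave_le_normD.
Qed.

(** The damping tends to 0 in box_damped_wave. On the left convergence is
    dominated by |p| + |q|; on the right the averaged Poisson kernel tends to
    the indicator of the box off the hyperplanes that bound it. *)
Lemma box_inversion :
  \int[lam]_x (\1_(box a b) x * inverse_fourier x) = \int[lam]_x (u x * \1_(box a b) x).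
Proof.
pose F k x := \1_(box a b) x * \int[lam]_w (abel k.+1%:R^-1 w * wave p q w (dot w x)) : R.
pose G k y := u y * \prod_j box_atan k.+1%:R^-1 (a j) (b j) (y ord0 j) : R.
have FG k : \int[lam]_x F k x = \int[lam]_y G k y by exact: box_damped_wave.
have cF : \int[lam]_x F k x @[k --> \oo] --> \int[lam]_x (\1_(box a b) x * inverse_fourier x).
  apply: (cvg_Rintegral (g := fun x => (\int[lam]_w (`|p w| + `|q w|)) * \1_(box a b) x)).
  - move=> k; apply: measurable_funM => //.
    apply: (measurable_Rintegral_param (f := fun z => abel k.+1%:R^-1 z.2 * wave p q z.2 (dot z.2 z.1)) _ ipq) => //.
    apply: measurable_funM; first by apply: measurableT_comp => //; exact: measurable_abel.
    by apply: measurable_wave => //; exact: measurable_dot.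
  - by apply: measurable_funM => //; exact: measurable_inverse_fourier.
  - apply: aeW => x; apply: cvgM; first exact: cvg_cst.
    apply: (cvg_Rintegral (g := fun w => `|p w| + `|q w|)) => //.
    + by move=> k; apply: measurable_funM => //; exact: measurable_abel.
    + apply: aeW => w; rewrite -[X in _ --> X]mul1r.
      by apply: cvgM; [exact: cvg_abel|exact: cvg_cst].
  - exact: integrable_indicator (measurable_box a b) boxoo.
  - move=> k x; rewrite /F normrM mulrC [`|\1_ _ _|]ger0_norm// ler_wpM2r//.
    have iw : lam.-L1 (fun w => abel k.+1%:R^-1 w * wave p q w (dot w x)).
      by apply: (integrable_le _ ipq) => //; apply: measurable_funM => //; exact: measurable_abel.
    apply: (le_trans (le_normr_Rintegral measurableT iw)).
    by apply: le_Rintegral => //; exact: integrable_norm iw.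
have cG : \int[lam]_y G k y @[k --> \oo] --> \int[lam]_x (u x * \1_(box a b) x).
  apply: (cvg_Rintegral (g := fun x => `|u x|)) => //.
  - move=> k; apply: measurable_funM => //; apply: measurable_prod => j _.
    apply: (measurableT_comp (f := box_atan k.+1%:R^-1 (a j) (b j))).
      exact: measurable_box_atan.
    exact: (measurable_rV_coord (R := R)).
  - exact: measurable_funM.
  - have := ae_off_hyperplanes b; have := ae_off_hyperplanes a.
    apply: filterS2 => y ya yb; apply: cvgM; first exact: cvg_cst.
    rewrite indic_box; apply: cvg_big => [|j _]; first exact: mul_continuous.
    exact: cvg_box_atan.
  - move=> k y; rewrite /G normrM ler_piMr// ger0_norm.
      by apply: prodr_ile1 => j _; exact: box_atan_bound.
    by apply: prodr_ge0 => j _; case/andP: (box_atan_bound (y ord0 j) (k_gt0 k) (ab j)).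
move: cF; rewrite (_ : (fun k => \int[lam]_x F k x) = fun k => \int[lam]_y G k y); last exact/funext.
by move=> cF; apply: (cvg_unique _ cF cG).
Qed.

End one_box.

(** By box_inversion both sides have the same integral over every box inside
    the unit cube, hence over the trace on the cube of every orthant, which is
    such a box or empty. *)
Theorem fourier_inversion (Omega : set 'rV[R]_n) :
  Omega `<=` [set x : 'rV[R]_n | forall k, 0 <= x ord0 k <= 1] ->
  {ae lam, forall x, Omega x -> u x = inverse_fourier x}.
Proof.
move=> O1.
pose Q : set 'rV[R]_n := box (cst 0) (cst 1).
pose c := \int[lam]_w (`|p w| + `|q w|).
have Qoo (A : set 'rV[R]_n) : measurable A -> A `<=` Q -> (lam A < +oo)%E.
  by move=> mA AQ; rewrite (le_lt_trans (lebesgue_rV_cube_le1 mA AQ))// ltry.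
have mQ : measurable Q by exact: measurable_box.
pose k x := \1_Q x * (u x - inverse_fourier x) : R.
have iku (A : set 'rV[R]_n) : measurable A -> lam.-L1 (fun x => u x * \1_A x).
  move=> mA; apply: (integrableM_bounded (M := 1)) => //.
  by move=> x; rewrite indicE; case: (_ \in _); rewrite ?normr1 ?normr0.
have iki (A : set 'rV[R]_n) : measurable A -> A `<=` Q ->
    lam.-L1 (fun x => \1_A x * inverse_fourier x).
  move=> mA AQ; apply: (integrable_le _ (integrable_indicator c mA (Qoo _ mA AQ))).
    by apply: measurable_funM; [exact: measurable_indic|exact: measurable_inverse_fourier].
  by move=> x; rewrite normrM mulrC [`|\1_ _ _|]ger0_norm// ler_wpM2r// inverse_fourier_le.
have ik : lam.-L1 k.
  have := integrableBR (iku Q mQ) (iki Q mQ (@subset_refl _ _)).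
  by congr (_.-integrable); apply/funext => x; rewrite /k /=; congr EFin; ring.
have kbox a b : (forall i, a i <= b i) -> box a b `<=` Q ->
    (\int[lam]_(x in box a b) (k x)%:E = 0)%E.
  move=> ab abQ; have mb := @measurable_box R n a b.
  rewrite -EFin_Rintegral; last 2 first.
  - exact: measurable_box.
  - exact: integrableS ik.
  rewrite [X in X%:E](_ : _ = \int[lam]_x (u x * \1_(box a b) x - \1_(box a b) x * inverse_fourier x)).
    by rewrite RintegralB ?box_inversion ?subrr//; [exact: Qoo|exact: iku|exact: iki].
  rewrite /Rintegral integral_mkcond; congr fine; apply: eq_integral => x _.
  rewrite patchE /k !indicE; case: ifPn => [|_]; last by rewrite mul0r mulr0 subrr.
  by rewrite inE => xb; rewrite mem_set ?mul1r ?mulr1//; exact: abQ.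
have k0 : {ae lam, forall x, k x = 0}.
  apply: ae_eq0_orthants => //.
    transitivity (\int[lam]_(x in Q) (k x)%:E)%E; last by rewrite kbox.
    rewrite [RHS]integral_mkcond; apply: eq_integral => x _.
    by rewrite patchE; case: ifPn => // xQ; rewrite /k indicE (negbTE xQ) mul0r.
  move=> a; pose a' i := Num.max 0 (a ord0 i).
  have [a1|/existsNP[i /negP]] := pselect (forall i, a ord0 i <= 1); last first.
    rewrite -ltNge => ai.
    rewrite integral_mkcond integral0_eq// => x _; rewrite patchE; case: ifPn => //.
    rewrite inE => /(_ i) aix; rewrite /k indicE memNset ?mul0r// => /(_ i) /andP[_].
    by rewrite leNgt (lt_le_trans ai aix).
  transitivity (\int[lam]_(x in box a' (cst 1%R)) (k x)%:E)%E; last first.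
    rewrite kbox// => [i|x /= h i]; first by rewrite /a' ge_max ler01 a1.
    by have /andP[+ ->] := h i; rewrite ge_max andbT => /andP[].
  rewrite integral_mkcond [RHS]integral_mkcond; apply: eq_integral => x _.
  rewrite !patchE; case: ifPn => [|/negP xa]; case: ifPn => [|/negP xb]//.
  - rewrite inE => xa; rewrite /k indicE memNset ?mul0r// => xQ; apply: xb.
    rewrite inE => i; have /andP[x0 x1] := xQ i; rewrite x1 andbT /a' ge_max x0.
    exact: xa.
  - rewrite inE => xb; exfalso; apply: xa; rewrite inE => i; have /andP[+ _] := xb i.
    by rewrite ge_max => /andP[].
move: k0; apply: filterS => x kx /O1 xQ; move/eqP: kx.
by rewrite /k indicE mem_set// mul1r subr_eq0 => /eqP.
Qed.

End inversion_theorem.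

(** * Superpositions of waves and their weak derivatives *)

Section amplitude.
Context (R : realType) (n : nat).
Implicit Types p q : 'rV[R]_n -> R.

(** The modulus of p + i q. *)
Definition amp p q w : R := Num.sqrt (p w ^+ 2 + q w ^+ 2).

Lemma amp_ge0 p q w : 0 <= amp p q w. Proof. exact: sqrtr_ge0. Qed.

Lemma wave_le_amp p q w th : `|wave p q w th| <= amp p q w.
Proof.
rewrite -sqrtr_sqr ler_wsqrtr//.
rewrite (_ : p w ^+ 2 + q w ^+ 2 = wave p q w th ^+ 2 + (p w * sin th + q w * cos th) ^+ 2).
  by rewrite lerDl sqr_ge0.
transitivity ((p w ^+ 2 + q w ^+ 2) * (cos th ^+ 2 + sin th ^+ 2)).
  by rewrite cos2Dsin2 mulr1.
by rewrite /wave; ring.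
Qed.

Lemma measurable_amp p q : measurable_fun setT p -> measurable_fun setT q ->
  measurable_fun setT (amp p q).
Proof.
move=> mp mq; apply: (measurableT_comp (f := @Num.sqrt R)).
  exact: continuous_measurable_fun (@sqrt_continuous R).
by apply: measurable_funD; apply: measurable_funX.
Qed.

Lemma l1norm_ge0 (w : 'rV[R]_n) : 0 <= l1norm w.
Proof. exact: sumr_ge0. Qed.

Lemma monomial_le ks (w : 'rV[R]_n) : `|monomial ks w| <= (1 + l1norm w) ^+ size ks.
Proof.
elim: ks => [|k ks IH]; first by rewrite /monomial big_nil normr1 expr0.
rewrite /monomial big_cons normrM exprS ler_pM//.
by rewrite /l1norm (bigD1 k)//= addrCA lerDl addr_ge0// sumr_ge0.
Qed.

Lemma measurable_monomial ks d (T : measurableType d) (f : T -> 'rV[R]_n) :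
  measurable_fun setT f -> measurable_fun setT (fun t => monomial ks (f t)).
Proof.
by move=> mf; apply: measurable_prod => k _; exact: measurable_rV_entry.
Qed.

(** Differentiating the wave with frequency w in the direction k multiplies it
    by w_k and advances its phase by a quarter period. *)
Definition dwave p q ks (w x : 'rV[R]_n) : R :=
  monomial ks w * wave p q w (dot w x + (size ks)%:R * (pi / 2)).

Lemma measurable_dwave p q ks d (T : measurableType d) (f g : T -> 'rV[R]_n) :
  measurable_fun setT p -> measurable_fun setT q ->
  measurable_fun setT f -> measurable_fun setT g ->
  measurable_fun setT (fun t => dwave p q ks (f t) (g t)).
Proof.
move=> mp mq mf mg; apply: measurable_funM; first exact: measurable_monomial.
by apply: measurable_wave => //; apply: measurable_funD => //; exact: measurable_dot.
Qed.

End amplitude.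

Section superposition.
Context (R : realType) (n : nat) (Omega : set 'rV[R]_n).
Local Notation lam := (lebesgue_rV R n).
Variables (p q : 'rV[R]_n -> R).
Hypotheses (mp : measurable_fun setT p) (mq : measurable_fun setT q).
Hypothesis ia : lam.-L1 (fun w => (1 + l1norm w) ^+ 2 * amp p q w).
Hypothesis O1 : Omega `<=` [set x : 'rV[R]_n | forall k, 0 <= x ord0 k <= 1].

Definition superposition ks (x : 'rV[R]_n) : R := \int[lam]_w dwave p q ks w x.

Lemma dwave_le ks (w x : 'rV[R]_n) : (size ks <= 2)%N ->
  `|dwave p q ks w x| <= (1 + l1norm w) ^+ 2 * amp p q w.
Proof.
move=> k2; rewrite normrM ler_pM ?wave_le_amp// (le_trans (monomial_le _ _))//.
by rewrite ler_weXn2l// lerDl l1norm_ge0.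
Qed.

Lemma measurable_superposition ks : (size ks <= 2)%N -> measurable_fun setT (superposition ks).
Proof.
move=> k2; apply: (measurable_Rintegral_param (f := fun z => dwave p q ks z.2 z.1) _ ia).
  exact: measurable_dwave.
by move=> x w; exact: dwave_le.
Qed.

Lemma integrable_dwave ks x : (size ks <= 2)%N ->
  lam.-L1 (fun w => dwave p q ks w x).
Proof.
move=> k2; apply: (integrable_le _ ia); first exact: measurable_dwave.
by move=> w; exact: dwave_le.
Qed.

Lemma superposition_le ks x : (size ks <= 2)%N ->
  `|superposition ks x| <= \int[lam]_w ((1 + l1norm w) ^+ 2 * amp p q w).
Proof.
move=> k2; apply: (le_trans (le_normr_Rintegral measurableT (integrable_dwave x k2))).
apply: le_Rintegral => //; first exact: integrable_norm (integrable_dwave x k2).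
by move=> w _; exact: dwave_le.
Qed.

Let superposition_test ks phi : (size ks <= 2)%N -> test_function Omega phi ->
  \int[lam]_(x in Omega) (superposition ks x * phi x) =
  \int[lam]_w \int[lam]_(x in Omega) (dwave p q ks w x * phi x) /\
  lam.-L1 (fun w => \int[lam]_(x in Omega) (dwave p q ks w x * phi x)).
Proof.
move=> k2 tphi; rewrite Rintegral_test//.
have E w : \int[lam]_(x in Omega) (dwave p q ks w x * phi x) = \int[lam]_x (dwave p q ks w x * phi x).
  by rewrite (Rintegral_test _ tphi).
have iphi : lam.-L1 phi.
  have := integrable_test O1 (@cst_continuous _ _ (1 : R)) tphi.
  by under [in X in X -> _]eq_fun do rewrite mul1r.
have mphi : measurable_fun setT phi by apply/measurable_EFinP; exact: measurable_int iphi.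
have ik : (lam \x lam)%E.-L1 (fun z => dwave p q ks z.2 z.1 * phi z.1).
  apply: (integrable_prod_le _ iphi ia).
    apply: measurable_funM; first exact: measurable_dwave.
    exact: measurableT_comp.
  move=> x w /=; rewrite normrM mulrC ler_wpM2l// (le_trans (dwave_le _ _ k2))//.
  exact: ler_norm.
rewrite (_ : (fun w => \int[lam]_(x in Omega) _) = fun w => \int[lam]_x (dwave p q ks w x * phi x)); last exact/funext.
split; last exact: (integrable_Rfubini2 ik).
rewrite -(Rfubini ik).
by apply: eq_Rintegral => x _; rewrite /= RintegralZr//; exact: integrable_dwave.
Qed.

Lemma is_derive_wave w t :
  is_derive t (1 : R) (wave p q w) (wave p q w (t + pi / 2)).
Proof.
have := is_deriveB (is_deriveZ (p w) (is_derive_cos t)) (is_deriveZ (q w) (is_derive_sin t)).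
rewrite (_ : _ - _ = wave p q w)//; move/is_derive_eq; apply.
by rewrite /wave cosDpihalf sinDpihalf /GRing.scale.
Qed.

(** Fubini reduces this to one frequency, where the wave is a ridge function. *)
Lemma superposition_by_parts ks phi : (size ks <= 2)%N -> test_function Omega phi ->
  \int[lam]_(x in Omega) (superposition [::] x * foldr (@partial R n) phi ks x) =
  (-1) ^+ size ks * \int[lam]_(x in Omega) (superposition ks x * phi x).
Proof.
move=> k2 tphi; rewrite (superposition_test _ (test_function_foldr _ tphi)).1//.
have [-> iw] := superposition_test k2 tphi.
pose psi w j (t : R) := wave p q w (j%:R * (pi / 2) + t).
have dpsi w j (t : R) : is_derive t (1 : R) (psi w j) (psi w j.+1 t).
  rewrite (_ : psi w j.+1 t = wave p q w (j%:R * (pi / 2) + t + pi / 2)).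
    exact: is_derive_translate (is_derive_wave w _).
  by rewrite /psi -addn1 natrD mulrDl mul1r addrAC.
have E w : \int[lam]_(x in Omega) (dwave p q [::] w x * foldr (@partial R n) phi ks x) =
  (-1) ^+ size ks * \int[lam]_(x in Omega) (dwave p q ks w x * phi x).
  have := @integral_by_parts_ridge R n Omega O1 w 0 (psi w) ks phi 0 (fun j t _ => dpsi w j t) _ tphi.
  rewrite /ridge /psi add0n => h; rewrite /dwave; transitivity (\int[lam]_(x in Omega)
      (wave p q w (0%:R * (pi / 2) + (dot w x + 0)) * foldr (@partial R n) phi ks x)).
    apply: eq_Rintegral => x _; congr (_ * _).
    by rewrite /monomial big_nil mul1r !mul0r add0r addr0.
  rewrite h; last first.
    move=> j _ t; apply: differentiable_continuous; apply/derivable1_diffP.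
    by case: (dpsi w j t).
  by congr (_ * _); apply: eq_Rintegral => x _; rewrite addr0 addrC.
under eq_Rintegral do rewrite E.
by rewrite RintegralZl.
Qed.

End superposition.

(** * The squared H2 norm of the error *)

(** The partial derivatives that enter the H2 norm. *)
Definition indices n : seq (seq 'I_n) :=
  [::] :: [seq [:: k] | k <- index_enum 'I_n] ++
          [seq [:: k; l] | k <- index_enum 'I_n, l <- index_enum 'I_n].

Lemma big_indices (S : Type) (idx : S) (op : Monoid.com_law idx) n (F : seq 'I_n -> S) :
  \big[op/idx]_(ks <- indices n) F ks =
  op (F [::]) (op (\big[op/idx]_k F [:: k]) (\big[op/idx]_k \big[op/idx]_l F [:: k; l])).
Proof. rewrite big_cons big_cat/= big_map; congr (op _ (op _ _)).
by rewrite big_allpairs_dep. Qed.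

Lemma size_indices n ks : ks \in indices n -> (size ks <= 2)%N.
Proof.
by rewrite inE mem_cat => /or3P[/eqP->//|/mapP[k _ ->]//|/allpairsP[[k l] [_ _ ->]]].
Qed.

Section unit_cube.
Context (R : realType) (n : nat) (Omega : set 'rV[R]_n).
Local Notation lam := (lebesgue_rV R n).
Hypothesis oO : open Omega.
Hypothesis O1 : Omega `<=` [set x : 'rV[R]_n | forall k, 0 <= x ord0 k <= 1].

Let mO : measurable Omega. Proof. exact: open_measurable_rV. Qed.

Lemma integrable_bounded_in (K : set 'rV[R]_n) (g : 'rV[R]_n -> R) C : measurable K ->
  K `<=` Omega -> measurable_fun K g -> (forall x, K x -> `|g x| <= C) ->
  lam.-integrable K (EFin \o g).
Proof.
move=> mK KO mg gC; apply: measurable_bounded_integrable => //.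
  by apply: (@le_lt_trans _ _ 1%E); [apply: lebesgue_rV_cube_le1 => // x /KO /O1|rewrite ltry].
exists C; split; first exact: num_real.
by move=> y Cy x /= Kx; exact: le_trans (gC x Kx) (ltW Cy).
Qed.

Lemma loc_integrable_bounded (g : 'rV[R]_n -> R) C : measurable_fun setT g ->
  (forall x, `|g x| <= C) -> loc_integrable Omega g.
Proof.
move=> mg gC; split; first exact: measurable_funTS.
move=> K cK KO; apply: (integrable_bounded_in (C := C)) => //.
  by apply: closed_measurable_rV; apply: compact_closed => //; exact: norm_hausdorff.
exact: measurable_funTS.
Qed.

(** The functions D ks are weak derivatives of u, hence one of the choices
    over which the infimum defining the squared norm is taken. *)
Lemma H2_normsq_le (u : 'rV[R]_n -> R) (D : seq 'I_n -> 'rV[R]_n -> R) :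
  measurable_fun Omega u -> {ae lam, forall x, Omega x -> u x = D [::] x} ->
  (forall ks, (size ks <= 2)%N -> measurable_fun setT (D ks)) ->
  (forall ks, (size ks <= 2)%N -> exists C, forall x, `|D ks x| <= C) ->
  (forall ks phi, (size ks <= 2)%N -> test_function Omega phi ->
    \int[lam]_(x in Omega) (D [::] x * foldr (@partial R n) phi ks x) =
    (-1) ^+ size ks * \int[lam]_(x in Omega) (D ks x * phi x)) ->
  (H2_normsq Omega u <=
   \sum_(ks <- indices n) \int[lam]_(x in Omega) (D ks x ^+ 2)%:E)%E.
Proof.
move=> mu_ uD mD bD Dparts.
have lu : loc_integrable Omega u.
  split => // K cK KO.
  have mK : measurable K.
    by apply: closed_measurable_rV; apply: compact_closed => //; exact: norm_hausdorff.
  have [C DC] := bD [::] isT.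
  have iD : lam.-integrable K (EFin \o D [::]).
    by apply: (integrable_bounded_in (C := C)) => //; apply: measurable_funTS; exact: mD.
  apply/integrableP; split; first by apply/measurable_EFinP; exact: measurable_funS mu_.
  case/integrableP: iD => mD0; congr (_ < _)%E; apply: ae_eq_integral => //.
  - by apply: measurableT_comp => //; apply: measurable_funTS; apply/measurable_EFinP; exact: mD.
  - by apply: measurableT_comp => //; apply/measurable_EFinP; exact: measurable_funS mu_.
  - by move: uD; apply: filterS => x h Kx /=; rewrite h//; exact: KO.
have wD ks : (size ks <= 2)%N -> weak_derivative Omega ks u (D ks).
  move=> k2; split => //.
    by have [C DC] := bD ks k2; apply: (loc_integrable_bounded _ DC); exact: mD.
  move=> phi tphi; rewrite -Dparts//; apply: ae_eq_Rintegral => //.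
  - apply: measurable_funM => //; apply: measurable_funTS; apply: continuous_measurable_rV.
    exact: test_function_continuous (test_function_foldr _ tphi).
  - apply: measurable_funM; apply: measurable_funTS; first exact: mD.
    by apply: continuous_measurable_rV; exact: test_function_continuous (test_function_foldr _ tphi).
  - by move: uD; apply: filterS => x h Ox; rewrite h.
apply: ereal_inf_lbound; exists (fun k => D [:: k]), (fun k l => D [:: k; l]); split.
- by move=> k; exact: wD.
- by move=> k l; exact: wD.
rewrite big_indices/= addeA; congr (_ + _ + _)%E.
apply: ae_eq_integral => //.
- by apply/measurable_EFinP; apply: measurable_funX; apply: measurable_funTS; exact: mD.
- by apply/measurable_EFinP; exact: measurable_funX.
- by move: uD; apply: filterS => x h Ox; rewrite h.
Qed.

End unit_cube.

Section network.
Context (R : realType) (n m : nat) (Omega : set 'rV[R]_n).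
Local Notation lam := (lebesgue_rV R n).
Hypothesis oO : open Omega.
Hypothesis O1 : Omega `<=` [set x : 'rV[R]_n | forall k, 0 <= x ord0 k <= 1].
Variables (a : 'rV[R]_m) (w : 'I_m -> 'rV[R]_n) (b : 'I_m -> R).

(** The derivative along ks of the network, computed neuron by neuron. *)
Definition dnet ks (x : 'rV[R]_n) : R :=
  m%:R^-1 * \sum_(i < m) a ord0 i * (monomial ks (w i) * ridge (w i) (b i) (spline (size ks)) x).

Lemma dnet0 : dnet [::] = random_net a w b.
Proof.
apply/funext => x; congr (_ * _); apply: eq_bigr => i _.
by rewrite /monomial big_nil mul1r /ridge spline0.
Qed.

Lemma measurable_dnet ks : (size ks <= 2)%N -> measurable_fun setT (dnet ks).
Proof.
move=> k2; apply: measurable_funM => //; apply: measurable_sum => i.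
apply: measurable_funM => //; apply: measurable_funM => //.
apply: (measurableT_comp (measurable_spline k2)).
by apply: measurable_funD => //; exact: measurable_dot.
Qed.

Lemma dnet_bounded ks : (size ks <= 2)%N -> exists C, forall x, `|dnet ks x| <= C.
Proof.
move=> k2; exists (`|m%:R^-1| * \sum_(i < m) `|a ord0 i| * (`|monomial ks (w i)| * spline_sup R)) => x.
rewrite normrM ler_wpM2l// (le_trans (ler_norm_sum _ _ _))// ler_sum// => i _.
rewrite normrM [X in _ * X]normrM ler_wpM2l// ler_wpM2l//.
exact: (spline_bound (dot (w i) x + b i) k2).
Qed.

Lemma dnet_by_parts ks phi : (size ks <= 2)%N -> test_function Omega phi ->
  \int[lam]_(x in Omega) (dnet [::] x * foldr (@partial R n) phi ks x) =
  (-1) ^+ size ks * \int[lam]_(x in Omega) (dnet ks x * phi x).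
Proof.
move=> k2 tphi.
have E (ks' : seq 'I_n) psi : (size ks' <= 2)%N -> test_function Omega psi ->
    \int[lam]_(x in Omega) (dnet ks' x * psi x) = m%:R^-1 * \sum_(i < m) a ord0 i *
    \int[lam]_(x in Omega) (monomial ks' (w i) * ridge (w i) (b i) (spline (size ks')) x * psi x).
  move=> k2' tpsi; rewrite !(Rintegral_test _ tpsi).
  have ii i : lam.-integrable setT (EFin \o
      (fun x => monomial ks' (w i) * ridge (w i) (b i) (spline (size ks')) x * psi x)).
    apply: (integrable_test O1 _ tpsi) => x.
    apply: (@continuousM _ _ (fun=> monomial ks' (w i) : R)); first exact: cst_continuous.
    exact: (continuous_ridge (continuous_spline k2')).
  transitivity (\int[lam]_x (m%:R^-1 * \sum_(i < m) a ord0 i *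
     (monomial ks' (w i) * ridge (w i) (b i) (spline (size ks')) x * psi x))).
    apply: eq_Rintegral => x _; rewrite -mulrA mulr_suml; congr (_ * _).
    by apply: eq_bigr => i _; rewrite !mulrA.
  rewrite RintegralZl//; last first.
    by apply: integrable_sumR => // i; exact: integrableZR.
  rewrite Rintegral_sum//; last by move=> i; exact: integrableZR.
  congr (_ * _); apply: eq_bigr => i _; rewrite RintegralZl// ; congr (_ * _).
  by rewrite (Rintegral_test _ tpsi).
rewrite !E//; last exact: test_function_foldr.
rewrite mulrCA; congr (_ * _); rewrite mulr_sumr; apply: eq_bigr => i _.
rewrite mulrCA; congr (_ * _).
have sd j (t : R) : (j < 0 + size ks)%N -> is_derive t (1 : R) (spline j) (spline j.+1 t).
  by rewrite add0n => jk; apply: is_derive_spline; exact: leq_trans jk k2.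
have sc j : (j <= 0 + size ks)%N -> continuous (@spline R j).
  by rewrite add0n => jk; apply: continuous_spline; exact: leq_trans jk k2.
rewrite -(integral_by_parts_ridge O1 (w i) (b i) sd sc tphi).
by apply: eq_Rintegral => x _; rewrite /monomial big_nil mul1r.
Qed.

End network.

Lemma H2_normsq_error (R : realType) n m (Omega : set 'rV[R]_n) (f p q : 'rV[R]_n -> R)
    (a : 'rV[R]_m) w b :
  open Omega -> Omega `<=` [set x : 'rV[R]_n | forall k, 0 <= x ord0 k <= 1] ->
  measurable_fun setT p -> measurable_fun setT q ->
  (lebesgue_rV R n).-L1 (fun w => (1 + l1norm w) ^+ 2 * amp p q w) ->
  measurable_fun Omega f ->
  {ae lebesgue_rV R n, forall x, Omega x -> f x = superposition p q [::] x} ->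
  (H2_normsq Omega (f \- random_net a w b)%R <= \sum_(ks <- indices n)
    \int[lebesgue_rV R n]_(x in Omega) ((superposition p q ks x - dnet a w b ks x) ^+ 2)%:E)%E.
Proof.
move=> oO O1 mp mq ia mf fs; rewrite -dnet0.
have mD ks : (size ks <= 2)%N ->
    measurable_fun setT (fun x => superposition p q ks x - dnet a w b ks x).
  move=> k2; apply: measurable_funB; first exact: measurable_superposition.
  exact: measurable_dnet.
apply: (@H2_normsq_le _ _ _ oO O1 _ (fun ks x => superposition p q ks x - dnet a w b ks x)) => //.
- by apply: measurable_funB => //; apply: measurable_funTS; exact: measurable_dnet.
- by move: fs; apply: filterS => x h Ox /=; rewrite h.
- move=> ks k2; have [C hC] := dnet_bounded a w b k2.
  exists (\int[lebesgue_rV R n]_w ((1 + l1norm w) ^+ 2 * amp p q w) + C) => x.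
  by rewrite (le_trans (ler_normB _ _))// lerD// superposition_le.
- move=> ks phi k2 tphi.
  have E ks' psi : (size ks' <= 2)%N -> test_function Omega psi ->
    \int[lebesgue_rV R n]_(x in Omega) ((superposition p q ks' x - dnet a w b ks' x) * psi x) =
    \int[lebesgue_rV R n]_(x in Omega) (superposition p q ks' x * psi x) -
    \int[lebesgue_rV R n]_(x in Omega) (dnet a w b ks' x * psi x).
    move=> k2' tpsi; have [c c0 hc] := test_function_bounded tpsi.
    have mpsi := continuous_measurable_rV (test_function_continuous tpsi).
    have mO := open_measurable_rV oO.
    rewrite -RintegralB//.
    + by apply: eq_Rintegral => x _; rewrite mulrBl.
    + apply: (integrable_bounded_in O1 (C := (\int[lebesgue_rV R n]_w ((1 + l1norm w) ^+ 2 * amp p q w)) * c)) => //.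
        by apply: measurable_funTS; apply: measurable_funM => //; exact: measurable_superposition.
      by move=> x _; rewrite normrM ler_pM// superposition_le.
    + have [C hC] := dnet_bounded a w b k2'.
      apply: (integrable_bounded_in O1 (C := C * c)) => //.
        by apply: measurable_funTS; apply: measurable_funM => //; exact: measurable_dnet.
      by move=> x _; rewrite normrM ler_pM.
  rewrite !E//; last exact: test_function_foldr.
  rewrite (superposition_by_parts mp mq ia O1 k2 tphi) (dnet_by_parts O1 a w b k2 tphi).
  by rewrite mulrBr.
Qed.

(** * One random neuron *)

Section uniform_law.
Context d (T : measurableType d) (R : realType).
Variables (mu : {measure set T -> \bar R}) (K : set T) (Q : probability T R).
Hypothesis mK : measurable K.
Hypothesis lawQ : forall S, measurable S -> Q S = (mu (S `&` K) / mu K)%E.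

(** If the measure of K were null or infinite, the law would give the value 0
    instead of 1 to the whole space. *)
Lemma uniform_law_volume : exists2 V : R, 0 < V & mu K = V%:E.
Proof.
have := lawQ measurableT; rewrite setTI probability_setT.
have : (0 <= mu K)%E by exact: measure_ge0.
case: (mu K) => [V V0|_|//].
- have [->|V0'] := eqVneq V 0; first by rewrite mul0e => /eqP; rewrite onee_eq0.
  by exists V; rewrite // lt_neqAle eq_sym V0' -lee_fin.
- by rewrite invey mule0 => /eqP; rewrite onee_eq0.
Qed.

(** On the subsets of K the measure mu is mu K times the law. *)
Lemma ge0_integral_uniform (f : T -> \bar R) : measurable_fun setT f ->
  (forall x, 0 <= f x)%E -> (forall x, ~ K x -> f x = 0%E) ->
  (\int[mu]_x f x = mu K * \int[Q]_x f x)%E.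
Proof.
move=> mf f0 fK; have [V V0 muK] := uniform_law_volume.
have fKE : f = f \_ K.
  apply/funext => x; rewrite patchE; case: ifPn => // /negP xK.
  by rewrite fK// => Kx; apply: xK; rewrite inE.
rewrite fKE -!integral_mkcond muK.
pose c := NngNum (ltW V0).
rewrite (@eq_measure_integral _ _ _ K (mscale c Q)); last first.
  move=> A mA AK; transitivity (V%:E * Q A)%E; last by [].
  rewrite lawQ// muK inver gt_eqF// (setIidl AK).
  by rewrite muleCA -EFinM divff ?gt_eqF// mule1.
by rewrite ge0_integral_mscale//; exact: measurable_funTS.
Qed.

Lemma Rintegral_uniform (f : T -> R) : measurable_fun setT f ->
  Q.-L1 f -> (forall x, ~ K x -> f x = 0) ->
  \int[mu]_x f x = fine (mu K) * \int[Q]_x f x /\ mu.-L1 f.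
Proof.
move=> mf ifQ fK; have [V V0 muK] := uniform_law_volume.
have mE : measurable_fun setT (EFin \o f) by exact/measurable_EFinP.
have pos : (\int[mu]_x (EFin \o f)^\+ x = mu K * \int[Q]_x (EFin \o f)^\+ x)%E.
  apply: ge0_integral_uniform => [|//|x /fK fx]; first exact: measurable_funepos.
  by rewrite funeposE /= fx maxxx.
have neg : (\int[mu]_x (EFin \o f)^\- x = mu K * \int[Q]_x (EFin \o f)^\- x)%E.
  apply: ge0_integral_uniform => [|//|x /fK fx]; first exact: measurable_funeneg.
  by rewrite funenegE /= fx oppr0 maxxx.
have iabs : (\int[mu]_x `|(EFin \o f) x| = mu K * \int[Q]_x `|(EFin \o f) x|)%E.
  apply: ge0_integral_uniform => [|//|x /fK fx]; first exact: measurableT_comp.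
  by rewrite /= fx normr0.
split.
  rewrite muK/= /Rintegral integralE pos neg [in RHS]integralE muK.
  have fp := integrable_pos_fin_num measurableT ifQ.
  have fn := integrable_neg_fin_num measurableT ifQ.
  by rewrite fineB ?fin_numM// !fineM// [in RHS]fineB//= mulrBr.
apply/integrableP; split => //; rewrite iabs muK.
case/integrableP: ifQ => _ h; rewrite lte_mul_pinfty// ?lee_fin ?ltW//.
Qed.

Lemma uniform_law_le S : measurable S -> (mu K * Q S <= mu S)%E.
Proof.
move=> mS; have [V V0 muK] := uniform_law_volume.
rewrite lawQ// muK inver gt_eqF// muleCA -EFinM divff ?gt_eqF// mule1.
by apply: le_measure; rewrite ?inE//; exact: measurableI.
Qed.

End uniform_law.

Lemma probability_lty d (T : measurableType d) (R : realType) (Q : probability T R) : (Q setT < +oo)%E.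
Proof. by rewrite probability_setT ltry. Qed.

(** The same function as lebesgue_measure, on the measurable structure in
    which real random variables take their values; the measurable sets are the
    same, the display differs. *)
Definition lebesgue_default (R : realType) : set R -> \bar R := @lebesgue_measure R.

Section lebesgue_default.
Context (R : realType).

Let ld0 : @lebesgue_default R set0 = 0%E. Proof. exact: measure0. Qed.
Let ld_ge0 A : (0 <= @lebesgue_default R A)%E. Proof. exact: measure_ge0. Qed.
Let ld_sigma : semi_sigma_additive (@lebesgue_default R).
Proof.
move=> F mF tF mUF.
exact: (@measure_semi_sigma_additive _ (measurableTypeR R) R (@lebesgue_measure R) F mF tF mUF).
Qed.

HB.instance Definition _ := isMeasure.Build _ R R (@lebesgue_default R) ld0 ld_ge0 ld_sigma.

End lebesgue_default.

Lemma square_le (R : realType) (k a A mm t S : R) : `|a| <= A -> `|t| <= S ->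
  (k * a * (mm * t)) ^+ 2 <= k ^+ 2 * S ^+ 2 * (mm * A) ^+ 2.
Proof.
move=> aA tS.
rewrite [leLHS](_ : _ = (k * mm) ^+ 2 * (`|a| ^+ 2 * `|t| ^+ 2)).
  rewrite [leRHS](_ : _ = (k * mm) ^+ 2 * (A ^+ 2 * S ^+ 2)); last by ring.
  rewrite ler_wpM2l ?sqr_ge0// ler_pM ?sqr_ge0// lerXn2r ?nnegrE//.
    exact: le_trans aA.
  exact: le_trans tS.
by rewrite !real_normK ?num_real//; ring.
Qed.

Section atoms.
Context (R : realType) (n : nat).
Local Notation lam := (lebesgue_rV R n).
Local Notation mu := (@lebesgue_measure R).

Definition coef (kappa : R) (p q : 'rV[R]_n -> R) (w : 'rV[R]_n) (b : R) : R :=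
  kappa * wave p q w (- b).

(** The contribution of one neuron, with inner weights z.1 and z.2, to the
    derivative along ks of the network at x. *)
Definition atom kappa p q ks (x : 'rV[R]_n) (z : 'rV[R]_n * R) : R :=
  coef kappa p q z.1 z.2 * (monomial ks z.1 * ridge z.1 z.2 (spline (size ks)) x).

Lemma dnet_atom m kappa p q (w : 'I_m -> 'rV[R]_n) (b : 'I_m -> R) ks x :
  dnet (\row_i coef kappa p q (w i) (b i)) w b ks x =
  m%:R^-1 * \sum_(i < m) atom kappa p q ks x (w i, b i).
Proof. by congr (_ * _); apply: eq_bigr => i _; rewrite mxE. Qed.

Variables (M L kappa : R) (p q : 'rV[R]_n -> R).
Hypotheses (M2 : (2 : R) <= M) (mp : measurable_fun setT p) (mq : measurable_fun setT q).
Hypothesis ampL : forall w, amp p q w <= L.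
Hypothesis amp0 : forall w, M < l1norm w -> amp p q w = 0.
Variables (pW : probability 'rV[R]_n R) (pB : probability R R).
Hypothesis lawW : forall S, measurable S -> pW S = (lam (S `&` l1ball n M) / lam (l1ball n M))%E.
Hypothesis lawB : forall S, measurable S ->
  pB S = (mu (S `&` [set b | (`|b| <= 2 * M)%R]) / mu [set b | (`|b| <= 2 * M)%R])%E.

Let V : R := fine (lam (l1ball n M)).

(* V * (4 * M) is the volume of the parameter space *)
Hypothesis kappaE : kappa = V * (4 * M) / spline_hat R.

Lemma measurable_coef d (T : measurableType d) (f : T -> 'rV[R]_n) (g : T -> R) :
  measurable_fun setT f -> measurable_fun setT g ->
  measurable_fun setT (fun t => coef kappa p q (f t) (g t)).
Proof.
move=> mf mg; apply: measurable_funM => //; apply: measurable_wave => //.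
exact: measurableT_comp.
Qed.

Lemma measurable_atom ks d (T : measurableType d) (f : T -> 'rV[R]_n) (g : T -> 'rV[R]_n * R) :
  (size ks <= 2)%N -> measurable_fun setT f -> measurable_fun setT g ->
  measurable_fun setT (fun t => atom kappa p q ks (f t) (g t)).
Proof.
move=> k2 mf mg; have mg1 : measurable_fun setT (fun t => (g t).1) by exact: measurableT_comp.
have mg2 : measurable_fun setT (fun t => (g t).2) by exact: measurableT_comp.
apply: measurable_funM; first exact: measurable_coef.
apply: measurable_funM; first exact: measurable_monomial.
apply: (measurableT_comp (measurable_spline k2)).
by apply: measurable_funD => //; exact: measurable_dot.
Qed.

Lemma L_ge0 : 0 <= L.
Proof. exact: le_trans (amp_ge0 p q 0) (ampL 0). Qed.

Lemma amp_monomial_le ks (w : 'rV[R]_n) : (size ks <= 2)%N ->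
  amp p q w * `|monomial ks w| <= L * (1 + M) ^+ 2.
Proof.
move=> k2; have [wM|/amp0 ->] := leP (l1norm w) M; last first.
  by rewrite mul0r mulr_ge0// ?L_ge0// exprn_ge0// addr_ge0// ltW// (lt_le_trans _ M2).
rewrite ler_pM ?amp_ge0// (le_trans (monomial_le _ _))//.
have w0 := l1norm_ge0 w.
apply: (@le_trans _ _ ((1 + l1norm w) ^+ 2)); first by rewrite ler_weXn2l// lerDl.
by rewrite lerXn2r ?nnegrE//; lra.
Qed.

Lemma atom_bounded ks x z : (size ks <= 2)%N ->
  `|atom kappa p q ks x z| <= `|kappa| * (L * (1 + M) ^+ 2 * spline_sup R).
Proof.
move=> k2; rewrite /atom /coef -mulrA normrM ler_wpM2l// mulrA normrM [X in X * _]normrM.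
have s0 : 0 <= spline_sup R by apply: le_trans (spline_bound 0 k2).
rewrite ler_pM//; last exact: (spline_bound (dot z.1 x + z.2) k2).
apply: le_trans (amp_monomial_le z.1 k2).
by rewrite ler_wpM2r// wave_le_amp.
Qed.

Lemma dot_cube (w x : 'rV[R]_n) : (forall k, 0 <= x ord0 k <= 1) -> `|dot w x| <= l1norm w.
Proof.
move=> x1; rewrite (le_trans (ler_norm_sum _ _ _))// ler_sum// => k _.
have /andP[x0 xl] := x1 k; rewrite normrM (ger0_norm x0) ler_piMr//.
Qed.

Let mK : measurable [set b : R | `|b| <= 2 * M].
Proof.
rewrite (_ : mkset _ = `[- (2 * M), 2 * M]%classic); first exact: measurable_itv.
by apply/seteqP; split => b /=; rewrite in_itv/= ler_norml.
Qed.

Let volB : mu [set b : R | `|b| <= 2 * M] = (4 * M)%:E.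
Proof.
rewrite (_ : mkset _ = `[- (2 * M), 2 * M]%classic); last first.
  by apply/seteqP; split => b /=; rewrite in_itv/= ler_norml.
rewrite lebesgue_measure_itv/= lte_fin ifT; first by congr EFin; ring.
by move: M2; lra.
Qed.

Let uniformB (f : R -> R) : measurable_fun setT f ->
  pB.-L1 f -> (forall b, 2 * M < `|b| -> f b = 0) ->
  \int[mu]_b f b = 4 * M * \int[pB]_b f b.
Proof.
move=> mf fi f0.
have gen (m : {measure set R -> \bar R}) : m [set b : R | `|b| <= 2 * M] = (4 * M)%:E ->
    (forall S, measurable S ->
      pB S = (m (S `&` [set b | (`|b| <= 2 * M)%R]) / m [set b | (`|b| <= 2 * M)%R])%E) ->
    \int[m]_b f b = 4 * M * \int[pB]_b f b /\ m.-L1 f.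
  move=> mv law; have [] := Rintegral_uniform mK law mf fi; last by rewrite mv.
  by move=> b /negP; rewrite -ltNge => /f0.
have ev : \int[@lebesgue_default R]_b f b = \int[mu]_b f b.
  apply: (@Rintegral_pushforward _ _ _ _ _ _ mu (fun b : R => b : measurableTypeR R) f) => //.
  exact: (gen [the measure _ _ of @lebesgue_default R] volB lawB).2.
by rewrite -ev; exact: (gen [the measure _ _ of @lebesgue_default R] volB lawB).1.
Qed.

Let wave0 (w : 'rV[R]_n) th : M < l1norm w -> wave p q w th = 0.
Proof. by move=> /amp0 a0; apply/normr0_eq0/le_anti; rewrite normr_ge0 andbT -a0 wave_le_amp. Qed.

Let atom0 ks (x w : 'rV[R]_n) b : (size ks <= 2)%N -> (forall k, 0 <= x ord0 k <= 1) ->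
  2 * M < `|b| -> atom kappa p q ks x (w, b) = 0.
Proof.
move=> k2 x1 bM; rewrite /atom/=; have [wM|/wave0 w0] := leP (l1norm w) M; last first.
  by rewrite /coef w0 mulr0 mul0r.
rewrite /ridge spline_outside ?mulr0//.
have := dot_cube w x1; have := lerB_normD b (dot w x); rewrite [b + _]addrC; move: M2; lra.
Qed.

Let batom ks (x w : 'rV[R]_n) : (size ks <= 2)%N ->
  pB.-L1 (fun b => atom kappa p q ks x (w, b)).
Proof.
move=> k2; apply: (integrable_bounded (C := `|kappa| * (L * (1 + M) ^+ 2 * spline_sup R))).
- exact: probability_lty.
- apply: (measurable_atom (f := cst x) k2) => //.
- by move=> b; exact: atom_bounded.
Qed.

Let Rintegral_cos_spline (c th : R) j : (j <= 2)%N -> `|th| <= M ->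
  mu.-integrable `[- (2 * M), 2 * M] (EFin \o (fun b => cos (c - b) * spline j (th + b))).
Proof.
move=> j2 thM; apply: continuous_compact_integrable; first exact: segment_compact.
apply: continuous_subspaceT => b; apply: cvgM.
  apply: continuous_cvg; first exact: continuous_cos.
  by apply: cvgB; [exact: cvg_cst|exact: cvg_id].
apply: continuous_cvg; first exact: continuous_spline.
by apply: cvgD; [exact: cvg_cst|exact: cvg_id].
Qed.

Let atom_mean_b ks (x w : 'rV[R]_n) : (size ks <= 2)%N -> (forall k, 0 <= x ord0 k <= 1) ->
  \int[pB]_b atom kappa p q ks x (w, b) = V * dwave p q ks w x.
Proof.
move=> k2 x1.
have M0 : 4 * M != 0 by rewrite gt_eqF//; move: M2; lra.
have h0 : spline_hat R != 0 by rewrite gt_eqF// spline_hat_gt0.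
have ma : measurable_fun setT (fun b => atom kappa p q ks x (w, b)).
  exact: (measurable_atom (f := cst x) k2).
apply: (mulfI M0); rewrite -uniformB//; [|exact: batom|by move=> b /(atom0 w k2 x1)].
have [wM|wM] := leP (l1norm w) M; last first.
  rewrite /dwave wave0// !mulr0 /Rintegral integral0_eq// => b _.
  by rewrite /atom /coef/= wave0// mulr0 mul0r.
have thM := le_trans (dot_cube w x1) wM.
set j := size ks in k2 *; set th := dot w x in thM *.
transitivity (\int[mu]_(b in `[- (2 * M), 2 * M]) atom kappa p q ks x (w, b)).
  rewrite /Rintegral [in RHS]integral_mkcond; congr fine; apply: eq_integral => b _.
  rewrite patchE; case: ifPn => // /negP bM.
  rewrite (atom0 w k2 x1)// ltNge; apply/negP => bM'; apply: bM.
  by rewrite inE/= in_itv/= -ler_norml.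
transitivity (\int[mu]_(b in `[- (2 * M), 2 * M])
  (kappa * monomial ks w * p w * (cos (0 - b) * spline j (th + b)) -
   kappa * monomial ks w * q w * (cos (- (pi / 2) - b) * spline j (th + b)))).
  apply: eq_Rintegral => b _; rewrite /atom /coef/= /wave /ridge -/j -/th sub0r.
  by rewrite [- (pi / 2) - b]addrC cosBpihalf; ring.
have i1 := Rintegral_cos_spline 0 k2 thM.
have i2 := Rintegral_cos_spline (- (pi / 2)) k2 thM.
rewrite RintegralB//; last 2 first.
- exact: integrableZR.
- exact: integrableZR.
rewrite !RintegralZl// !integral_cos_spline// /dwave /wave -/j -/th add0r.
rewrite (_ : - (pi / 2) + th + j%:R * (pi / 2) = th + j%:R * (pi / 2) - pi / 2); last by ring.
rewrite cosBpihalf kappaE.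
set c := cos _; set s := sin _.
transitivity ((spline_hat R / spline_hat R) * (4 * M * (V * (monomial ks w * (p w * c - q w * s))))).
  by ring.
by rewrite divff// mul1r.
Qed.

Let iatom ks (x : 'rV[R]_n) : (size ks <= 2)%N ->
  (pW \x pB)%E.-L1 (atom kappa p q ks x).
Proof.
move=> k2; pose QX : probability ('rV[R]_n * R)%type R := (pW \x pB)%E.
apply: (@integrable_bounded _ _ _ QX _ (`|kappa| * (L * (1 + M) ^+ 2 * spline_sup R))).
- exact: probability_lty.
- by apply: (measurable_atom (f := cst x) k2).
- by move=> z; exact: atom_bounded.
Qed.

(** For a fixed w the mean over b is the wave by integral_cos_spline; the
    constant kappa cancels the density of the uniform laws and the factor
    spline_hat. *)
Lemma atom_mean ks (x : 'rV[R]_n) : (size ks <= 2)%N -> (forall k, 0 <= x ord0 k <= 1) ->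
  \int[(pW \x pB)%E]_z atom kappa p q ks x z = superposition p q ks x.
Proof.
move=> k2 x1; rewrite -(Rintegral12_prod (iatom x k2)).
under eq_Rintegral do rewrite atom_mean_b//.
have md : measurable_fun setT (fun w => dwave p q ks w x) by exact: measurable_dwave.
have id : pW.-L1 (fun w => dwave p q ks w x).
  apply: (integrable_bounded (C := L * (1 + M) ^+ 2)) => //.
    exact: probability_lty.
  move=> w; rewrite normrM mulrC (le_trans _ (amp_monomial_le w k2))//.
  by rewrite ler_wpM2r// wave_le_amp.
rewrite RintegralZl//.
have [] := Rintegral_uniform (@measurable_l1ball R n M) lawW md id.
  by move=> w /negP; rewrite -ltNge => wM; rewrite /dwave wave0// mulr0.
by move=> <-.
Qed.

(** For a fixed w the spline is nonzero only for b in an interval of length 4,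
    whose probability is at most 1 / M. This gains a factor M over the bound
    by the maximum, which turns M ^ (d + 2) into M ^ (d + 1) in the end. *)
Lemma atom_second_moment ks (x : 'rV[R]_n) : (size ks <= 2)%N -> (forall k, 0 <= x ord0 k <= 1) ->
  \int[(pW \x pB)%E]_z (atom kappa p q ks x z ^+ 2) <=
  16 * V * M * spline_sup R ^+ 2 / spline_hat R ^+ 2 *
  \int[lam]_w ((monomial ks w * amp p q w) ^+ 2).
Proof.
move=> k2 x1.
pose QX : probability ('rV[R]_n * R)%type R := (pW \x pB)%E.
set S := spline_sup R; set c := `|kappa| * (L * (1 + M) ^+ 2 * S).
have c0 : 0 <= c by apply: le_trans (atom_bounded x (0, 0) k2).
have matom := measurable_atom (f := cst x) k2 (measurable_cst x) (@measurable_id _ _ setT).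
have ia2 : (pW \x pB)%E.-L1 (fun z => atom kappa p q ks x z ^+ 2).
  apply: (@integrable_bounded _ _ _ QX _ (c ^+ 2)); first exact: probability_lty.
    by apply: measurable_funX.
  by move=> z; rewrite normrX lerXn2r ?nnegrE//; exact: atom_bounded.
rewrite -(Rintegral12_prod ia2).
pose g w := monomial ks w * amp p q w.
have mg : measurable_fun setT g.
  by apply: measurable_funM; [exact: measurable_monomial|exact: measurable_amp].
have gc w : `|g w| <= L * (1 + M) ^+ 2.
  by rewrite normrM mulrC ger0_norm ?amp_ge0// amp_monomial_le.
have ig2 : pW.-L1 (fun w => g w ^+ 2).
  apply: (integrable_bounded (C := (L * (1 + M) ^+ 2) ^+ 2)); first exact: probability_lty.
    exact: measurable_funX.
  by move=> w; rewrite normrX lerXn2r ?nnegrE//; exact: le_trans (gc w).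
have inner w : \int[pB]_b (atom kappa p q ks x (w, b) ^+ 2) <= kappa ^+ 2 * S ^+ 2 / M * g w ^+ 2.
  pose I := `[- 2 - dot w x, 2 - dot w x]%classic : set R.
  have mI : measurable I by exact: measurable_itv.
  have pI : fine (pB I) <= M^-1.
    have := @uniform_law_le _ _ R [the measure _ _ of @lebesgue_default R] _ pB mK lawB I mI.
    have : pB I \is a fin_num by exact: fin_num_measure.
    case: (pB I) => // r _.
    rewrite [X in (X * _ <= _)%E]volB [X in (_ <= X)%E](_ : _ = 4%:E); last first.
      rewrite [LHS]lebesgue_measure_itv/= lte_fin ifT; last by lra.
      by rewrite -EFinB; congr EFin; ring.
    rewrite lee_fin/= => h; rewrite -(ler_pM2l (_ : 0 < 4 * M)); last by move: M2; lra.
    by rewrite mulfK// gt_eqF//; move: M2; lra.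
  apply: (@le_trans _ _ (\int[pB]_b (kappa ^+ 2 * S ^+ 2 * g w ^+ 2 * \1_I b))).
    apply: le_Rintegral => //.
    - apply: (integrable_bounded (C := c ^+ 2)); first exact: probability_lty.
        exact: measurable_funX (measurable_fun_pair2 w matom).
      by move=> b; rewrite normrX lerXn2r ?nnegrE//; exact: atom_bounded.
    - by apply: integrable_indicator => //; apply: le_lt_trans (probability_le1 _ mI) (ltry _).
    - move=> b _; rewrite /atom/= /coef /ridge.
      have [bI|bI] := pselect (I b); last first.
        rewrite [spline _ _]spline_outside ?mulr0 ?expr0n/=.
          by rewrite indicE memNset// mulr0.
        by [].
        rewrite leNgt; apply/negP => h; apply: bI; rewrite /I/= in_itv/=.
        by move: h; rewrite ltr_norml => /andP[]; lra.
      rewrite indicE mem_set// mulr1; apply: square_le; first exact: wave_le_amp.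
      exact: (spline_bound (dot w x + b) k2).
  rewrite /Rintegral; under eq_integral do rewrite EFinM.
  rewrite integralZl//; last first.
    have := @integrable_indicator _ _ _ pB I 1 mI (le_lt_trans (probability_le1 _ mI) (ltry _)).
    by under [in X in X -> _]eq_fun do rewrite /= mul1r.
  rewrite integral_indic// setIT fineM//; last exact: fin_num_measure.
  rewrite /= [leRHS](_ : _ = kappa ^+ 2 * S ^+ 2 * g w ^+ 2 * M^-1); last by ring.
  by rewrite ler_wpM2l// mulr_ge0 ?sqr_ge0// mulr_ge0 ?sqr_ge0.
apply: (@le_trans _ _ (\int[pW]_w (kappa ^+ 2 * S ^+ 2 / M * g w ^+ 2))).
  apply: le_Rintegral => //; first exact: integrable_Rfubini1 ia2.
  exact: integrableZR.
rewrite RintegralZl//.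
have [V1 V0 VE] := uniform_law_volume lawW.
have V0' : V != 0 by rewrite /V VE gt_eqF.
have [|e _] := Rintegral_uniform (@measurable_l1ball R n M) lawW (measurable_funX 2%N mg) ig2.
  by move=> w /negP; rewrite -ltNge => wM; rewrite /g amp0// mulr0 expr0n.
rewrite -/V in e.
rewrite /g in e *; rewrite e kappaE le_eqVlt; apply/orP; left; apply/eqP.
set J := \int[pW]_w _.
have M0 : M != 0 by rewrite gt_eqF//; move: M2; lra.
have h0 : spline_hat R != 0 by rewrite gt_eqF// spline_hat_gt0.
by field; rewrite M0 h0.
Qed.

End atoms.

(** * The expected error *)

Lemma sum_sqr_le (R : realType) (I : Type) (s : seq I) (F : I -> R) : (forall i, 0 <= F i) ->
  \sum_(i <- s) F i ^+ 2 <= (\sum_(i <- s) F i) ^+ 2.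
Proof.
move=> F0; elim: s => [|i s IH]; first by rewrite !big_nil expr0n.
rewrite !big_cons sqrrD; apply: (@le_trans _ _ (F i ^+ 2 + (\sum_(j <- s) F j) ^+ 2)).
  by rewrite lerD2l.
by rewrite lerD2r lerDl mulrn_wge0// mulr_ge0// sumr_ge0.
Qed.

(** The sum is 1 + |w| + |w| ^ 2 for the l1-norm. *)
Lemma sum_monomials_le (R : realType) n (w : 'rV[R]_n) :
  \sum_(ks <- indices n) `|monomial ks w| <= (1 + l1norm w) ^+ 2.
Proof.
rewrite big_indices/= /monomial big_nil normr1.
rewrite (eq_bigr (fun k => `|w ord0 k|)); last by move=> k _; rewrite big_seq1.
rewrite (_ : \sum_k \sum_l _ = l1norm w * l1norm w).
  rewrite -/(l1norm w) sqrrD expr1n mul1r mulr2n expr2.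
  by rewrite addrA lerD2r lerD2l lerDl l1norm_ge0.
rewrite /l1norm mulr_suml; apply: eq_bigr => k _; rewrite mulr_sumr; apply: eq_bigr => l _.
by rewrite big_cons big_seq1 normrM.
Qed.

Section expected_error.
Context (R : realType) (n : nat) (Omega : set 'rV[R]_n) (M L : R).
Local Notation lam := (lebesgue_rV R n).
Local Notation mu := (@lebesgue_measure R).
Hypothesis M2 : (2 : R) <= M.
Hypothesis oO : open Omega.
Hypothesis O1 : Omega `<=` [set x : 'rV[R]_n | forall k, 0 <= x ord0 k <= 1].
Variables (f p q : 'rV[R]_n -> R).
Hypotheses (mp : measurable_fun setT p) (mq : measurable_fun setT q).
Hypothesis ia : lam.-L1 (fun w => (1 + l1norm w) ^+ 2 * amp p q w).
Hypothesis ampL : forall w, amp p q w <= L.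
Hypothesis mf : measurable_fun Omega f.
Hypothesis fs : {ae lam, forall x, Omega x -> f x = superposition p q [::] x}.

Context (disp : measure_display) (T : measurableType disp) (P : probability T R) (m : nat).
Variables (W : 'I_m -> {RV P >-> 'rV[R]_n}) (B : 'I_m -> {RV P >-> R}).
Hypothesis m0 : (0 < m)%N.
Hypothesis lawW : forall i, uniformly_distributed (W i) lam (l1ball n M).
Hypothesis lawB : forall i, uniformly_distributed (B i) mu [set b : R | `|b| <= 2 * M].
Hypothesis indW : mutually_independent W.
Hypothesis indB : mutually_independent B.
Hypothesis indWB : independent_sigma_algebras P (g_sigma_preimage W) (g_sigma_preimage B).

(* the frequencies inside and outside of the ball that is sampled *)
Let pM w : R := \1_(l1ball n M) w * p w.
Let qM w : R := \1_(l1ball n M) w * q w.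
Let pT w : R := \1_(~` (l1ball n M)) w * p w.
Let qT w : R := \1_(~` (l1ball n M)) w * q w.

Let V : R := fine (lam (l1ball n M)).
Let kappa := V * (4 * M) / spline_hat R.

(** W i lies in the ball only almost surely; cutting p and q off to the ball
    makes the coefficients bounded at every sample. *)
Definition coefs (t : T) : 'rV[R]_m := \row_i coef kappa pM qM (W i t) (B i t).

Let mball := @measurable_l1ball R n M.

Let mpM : measurable_fun setT pM.
Proof. by apply: measurable_funM => //; exact: measurable_indic. Qed.
Let mqM : measurable_fun setT qM.
Proof. by apply: measurable_funM => //; exact: measurable_indic. Qed.
Let mpT : measurable_fun setT pT.
Proof. by apply: measurable_funM => //; apply: measurable_indic; exact: measurableC. Qed.
Let mqT : measurable_fun setT qT.
Proof. by apply: measurable_funM => //; apply: measurable_indic; exact: measurableC. Qed.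

Lemma amp_indic (A : set 'rV[R]_n) w :
  amp (fun w => \1_A w * p w) (fun w => \1_A w * q w) w = \1_A w * amp p q w.
Proof.
rewrite /amp !exprMn -mulrDr sqrtrM ?sqr_ge0// sqrtr_sqr ger0_norm//.
Qed.

Let ampM_le w : amp pM qM w <= amp p q w.
Proof.
rewrite amp_indic ler_piMl ?amp_ge0// indicE; by case: (_ \in _).
Qed.

Let ampM0 w : M < l1norm w -> amp pM qM w = 0.
Proof.
move=> wM; rewrite amp_indic indicE memNset ?mul0r// /l1ball/= => h.
by move: wM; rewrite ltNge h.
Qed.

Let i_weighted (a : 'rV[R]_n -> R) : measurable_fun setT a ->
  (forall w, 0 <= a w <= amp p q w) ->
  lam.-L1 (fun w => (1 + l1norm w) ^+ 2 * a w).
Proof.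
move=> ma aamp; apply: (integrable_le _ ia).
  apply: measurable_funM => //; apply: measurable_funX; apply: measurable_funD => //.
  exact: measurable_l1norm.
move=> w; have /andP[a0 a1] := aamp w.
by rewrite ger0_norm ?mulr_ge0 ?ler_wpM2l// ?exprn_ge0// ?addr_ge0 ?l1norm_ge0.
Qed.

Let iaM : lam.-L1 (fun w => (1 + l1norm w) ^+ 2 * amp pM qM w).
Proof.
apply: i_weighted; first exact: measurable_amp.
by move=> w; rewrite amp_ge0 ampM_le.
Qed.

Let iaT : lam.-L1 (fun w => (1 + l1norm w) ^+ 2 * amp pT qT w).
Proof.
apply: i_weighted; first exact: measurable_amp.
move=> w; rewrite amp_ge0/= amp_indic ler_piMl ?amp_ge0//.
Qed.

Let superposition_split ks x : (size ks <= 2)%N ->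
  superposition p q ks x = superposition pM qM ks x + superposition pT qT ks x.
Proof.
move=> k2; rewrite /superposition -RintegralD//; last 2 first.
- exact: (integrable_dwave mpM mqM iaM x k2).
- exact: (integrable_dwave mpT mqT iaT x k2).
apply: eq_Rintegral => w _; rewrite /dwave -mulrDr; congr (_ * _).
rewrite /wave /pM /qM /pT /qT !indicE in_setC; case: (_ \in _) => /=; by ring.
Qed.

Let tail ks : R := \int[lam]_w (`|monomial ks w| * amp pT qT w).
Let low ks : R := \int[lam]_w ((monomial ks w * amp pM qM w) ^+ 2).

Let itail ks : (size ks <= 2)%N ->
  lam.-L1 (fun w => `|monomial ks w| * amp pT qT w).
Proof.
move=> k2; apply: (integrable_le _ iaT).
  apply: measurable_funM; last exact: measurable_amp.
  by apply: measurableT_comp => //; exact: measurable_monomial.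
move=> w; rewrite ger0_norm ?mulr_ge0 ?amp_ge0//; apply: ler_wpM2r; first exact: amp_ge0.
by rewrite (le_trans (monomial_le _ _))// ler_weXn2l// lerDl l1norm_ge0.
Qed.

Let tail_le ks x : (size ks <= 2)%N -> `|superposition pT qT ks x| <= tail ks.
Proof.
move=> k2; have id := integrable_dwave mpT mqT iaT x k2.
apply: (le_trans (le_normr_Rintegral measurableT id)).
apply: le_Rintegral => //; [exact: integrable_norm id|exact: itail|].
by move=> w _; rewrite normrM ler_wpM2l// wave_le_amp.
Qed.

Definition err_const : R := 16 * spline_sup R ^+ 2 / spline_hat R ^+ 2.

(** The high frequencies are a bias that the network does not see; the low
    ones are met on average, with the error of mean_square_average. *)
Let pointwise ks x : (size ks <= 2)%N -> Omega x ->
  (\int[P]_t ((superposition p q ks x - dnet (coefs t) (fun i => W i t) (fun i => B i t) ks x) ^+ 2)%:E <=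
   (2 * (m%:R^-1 * (err_const * V * M * low ks) + tail ks ^+ 2))%:E)%E.
Proof.
move=> k2 Ox; have x1 := O1 Ox.
pose i0 := Ordinal m0.
pose pW : probability 'rV[R]_n R := distribution P (W i0).
pose pB : probability R R := distribution P (B i0).
have hW S : measurable S -> pW S = (lam (S `&` l1ball n M) / lam (l1ball n M))%E.
  by move=> mS; exact: lawW.
have hB S : measurable S -> pB S =
    (mu (S `&` [set b | (`|b| <= 2 * M)%R]) / mu [set b | (`|b| <= 2 * M)%R])%E.
  by move=> mS; exact: lawB.
have LM w : amp pM qM w <= L by exact: le_trans (ampM_le w) (ampL w).
have mean := atom_mean M2 mpM mqM LM ampM0 hW hB (erefl kappa) k2 x1.
have second := atom_second_moment M2 mpM mqM LM ampM0 hW hB (erefl kappa) k2 x1.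
have matom := measurable_atom kappa mpM mqM (f := cst x) k2 (measurable_cst x) (@measurable_id _ _ setT).
have lW i S : measurable S -> P (W i @^-1` S) = pW S.
  by move=> mS; rewrite hW//; exact: lawW.
have lB i S : measurable S -> P (B i @^-1` S) = pB S.
  by move=> mS; rewrite hB//; exact: lawB.
have ms := mean_square_average lW lB indW indB indWB m0 matom
  (fun z => atom_bounded kappa M2 LM ampM0 x z k2).
have mD : measurable_fun setT (fun t => m%:R^-1 * \sum_(i < m) atom kappa pM qM ks x (W i t, B i t)).
  apply: measurable_funM => //; apply: measurable_sum => i.
  apply: (measurable_atom kappa mpM mqM (f := cst x) (g := fun t => (W i t, B i t)) k2) => //.
  by apply: measurable_fun_pair.
pose b := superposition pT qT ks x.
apply: (@le_trans _ _ (\int[P]_t (2 * ((m%:R^-1 * \sum_(i < m) atom kappa pM qM ks x (W i t, B i t) -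
    superposition pM qM ks x) ^+ 2)%:E + (2 * b ^+ 2)%:E))%E).
  apply: ge0_le_integral_lower => t; first by rewrite lee_fin sqr_ge0.
  rewrite dnet_atom superposition_split// -EFinM -EFinD lee_fin.
  set s := superposition _ _ _ _; set a := _ * _; rewrite -/b.
  rewrite -subr_ge0 [leRHS](_ : _ = (a - s + b) ^+ 2); last by ring.
  exact: sqr_ge0.
rewrite ge0_integralD//; last 3 first.
- by move=> t _; rewrite mule_ge0// lee_fin sqr_ge0.
- apply: measurable_funeM; apply/measurable_EFinP; apply: measurable_funX.
  exact: measurable_funB.
- by move=> t _; rewrite lee_fin mulr_ge0// sqr_ge0.
rewrite ge0_integralZl//; last 2 first.
- by apply/measurable_EFinP; apply: measurable_funX; exact: measurable_funB.
- by move=> t _; rewrite lee_fin sqr_ge0.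
have -> : (\int[P]_t (2 * b ^+ 2)%:E = (2 * b ^+ 2)%:E)%E.
  by rewrite integral_cst// [X in (_ * X)%E]probability_setT mule1.
rewrite [X in (_ <= X)%E](_ : _ = (2 * (m%:R^-1 * (err_const * V * M * low ks))%:E + (2 * tail ks ^+ 2)%:E)%E); last first.
  by rewrite -EFinM -EFinD mulrDr.
apply: leeD.
  apply: lee_wpmul2l => //; rewrite -mean; apply: (le_trans ms).
  rewrite lee_fin ler_wpM2l ?invr_ge0//; apply: (le_trans second).
  have h (v a a' c J : R) : 16 * v * c * a / a' * J = 16 * a / a' * v * c * J by ring.
  by rewrite h.
rewrite lee_fin ler_wpM2l// -real_normK ?num_real// lerXn2r ?nnegrE ?tail_le//.
exact: le_trans (tail_le x k2).
Qed.

Let mdnet ks : (size ks <= 2)%N -> measurable_fun setT (fun z : T * 'rV[R]_n =>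
  dnet (coefs z.1) (fun i => W i z.1) (fun i => B i z.1) ks z.2).
Proof.
move=> k2; under eq_fun do rewrite dnet_atom.
apply: measurable_funM => //; apply: measurable_sum => i.
apply: (measurable_atom kappa mpM mqM (f := snd) (g := fun z : T * 'rV[R]_n => (W i z.1, B i z.1)) k2) => //.
by apply: measurable_fun_pair; exact: measurableT_comp.
Qed.

Let mO : measurable Omega. Proof. exact: open_measurable_rV. Qed.

Let G ks (z : T * 'rV[R]_n) := (\1_Omega z.2 * (superposition p q ks z.2 -
  dnet (coefs z.1) (fun i => W i z.1) (fun i => B i z.1) ks z.2) ^+ 2)%:E.

Let mG ks : (size ks <= 2)%N -> measurable_fun setT (G ks).
Proof.
move=> k2; apply/measurable_EFinP; apply: measurable_funM.
  by apply: measurableT_comp => //; exact: measurable_indic.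
apply: measurable_funX; apply: measurable_funB; last exact: mdnet.
by apply: measurableT_comp => //; exact: measurable_superposition.
Qed.

Let G0 ks z : (0 <= G ks z)%E. Proof. by rewrite lee_fin mulr_ge0// sqr_ge0. Qed.

Let integral_G ks t : (\int[lam]_(x in Omega) ((superposition p q ks x -
  dnet (coefs t) (fun i => W i t) (fun i => B i t) ks x) ^+ 2)%:E = \int[lam]_x G ks (t, x))%E.
Proof.
rewrite integral_mkcond; apply: eq_integral => x _.
by rewrite patchE /G/= indicE; case: ifPn => _; rewrite ?mul1r ?mul0r.
Qed.

(** Tonelli, and Omega has volume at most 1. *)
Let averaged ks : (size ks <= 2)%N ->
  (\int[P]_t \int[lam]_(x in Omega)
     ((superposition p q ks x - dnet (coefs t) (fun i => W i t) (fun i => B i t) ks x) ^+ 2)%:E <=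
   (2 * (m%:R^-1 * (err_const * V * M * low ks) + tail ks ^+ 2))%:E)%E.
Proof.
move=> k2; set c := 2 * _.
have V0 : 0 <= V by rewrite fine_ge0.
have e0 : 0 <= err_const by rewrite divr_ge0 ?sqr_ge0// mulr_ge0// sqr_ge0.
have c0 : 0 <= c.
  rewrite mulr_ge0// addr_ge0 ?sqr_ge0// mulr_ge0 ?invr_ge0// mulr_ge0//.
    by rewrite mulr_ge0 ?(le_trans _ M2)// mulr_ge0.
  by apply: Rintegral_ge0 => // w _; exact: sqr_ge0.
under eq_integral do rewrite integral_G.
rewrite (@fubini_tonelli _ _ _ _ _ P lam (G ks) (mG k2) (G0 ks)).
apply: (@le_trans _ _ (\int[lam]_x (c * \1_Omega x)%:E)%E).
  apply: ge0_le_integral_lower => x; first by apply: integral_ge0.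
  rewrite /G/= indicE; have [Ox|Ox] := pselect (Omega x); last first.
    by rewrite memNset// mulr0 integral0_eq// => t _; rewrite mul0r.
  rewrite mem_set// mulr1.
  by under eq_integral do rewrite mul1r; exact: pointwise.
under eq_integral do rewrite EFinM.
rewrite ge0_integralZl//; last first.
  by apply/measurable_EFinP; exact: measurable_indic.
rewrite integral_indic// setIT -[leRHS]mule1 lee_wpmul2l//.
exact: lebesgue_rV_cube_le1.
Qed.

Let weight (w : 'rV[R]_n) : R := (1 + l1norm w) ^+ 2.

Let weight_ge0 w : 0 <= weight w.
Proof. by rewrite exprn_ge0// addr_ge0// l1norm_ge0. Qed.

Let mweight : measurable_fun setT weight.
Proof. by apply: measurable_funX; apply: measurable_funD => //; exact: measurable_l1norm. Qed.

Let i_low : lam.-L1 (fun w => (weight w * amp pM qM w) ^+ 2).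
Proof.
have iK := integrableZR ((1 + M) ^+ 2 * L) measurableT iaM.
apply: (integrable_le _ iK).
  by apply: measurable_funX; apply: measurable_funM => //; exact: measurable_amp.
move=> w; rewrite ger0_norm ?sqr_ge0// expr2; apply: ler_wpM2r.
  by rewrite mulr_ge0// amp_ge0.
have [wM|/ampM0 ->] := leP (l1norm w) M; last first.
  by rewrite mulr0 mulr_ge0 ?sqr_ge0// (le_trans (amp_ge0 p q 0) (ampL 0)).
rewrite ler_pM ?amp_ge0// ?(le_trans (ampM_le w) (ampL w))//.
by rewrite /weight lerXn2r ?nnegrE ?addr_ge0 ?l1norm_ge0 ?lerD2l//; move: M2; lra.
Qed.

Let monomial_le_weight ks w : (size ks <= 2)%N -> `|monomial ks w| <= weight w.
Proof. by move=> k2; rewrite (le_trans (monomial_le _ _))// ler_weXn2l// lerDl l1norm_ge0. Qed.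

Let low_sum : \sum_(ks <- indices n) low ks <= \int[lam]_w ((weight w * amp pM qM w) ^+ 2).
Proof.
have il ks : (size ks <= 2)%N ->
    lam.-L1 (fun w => (monomial ks w * amp pM qM w) ^+ 2).
  move=> k2; apply: (integrable_le _ i_low).
    apply: measurable_funX; apply: measurable_funM; last exact: measurable_amp.
    exact: measurable_monomial.
  move=> w; rewrite ger0_norm ?sqr_ge0// -real_normK ?num_real//.
  rewrite lerXn2r ?nnegrE//; first by rewrite mulr_ge0 ?amp_ge0.
  rewrite normrM [X in _ * X]ger0_norm ?amp_ge0//.
  by rewrite ler_wpM2r ?amp_ge0 ?monomial_le_weight.
pose F (ks : seq 'I_n) w := if (size ks <= 2)%N then (monomial ks w * amp pM qM w) ^+ 2 else 0.
have iF ks : lam.-L1 (F ks).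
  by rewrite /F; have [k2|_] := boolP (size ks <= 2)%N; [exact: il|exact: integrable0].
rewrite (eq_big_seq (fun ks => \int[lam]_w F ks w)); last first.
  by move=> ks /size_indices k2; rewrite /F k2.
rewrite -Rintegral_sum//; apply: le_Rintegral => //; first exact: integrable_sumR.
move=> w _; rewrite (eq_big_seq (fun ks => (`|monomial ks w| * amp pM qM w) ^+ 2)); last first.
  by move=> ks /size_indices k2; rewrite /F k2 !exprMn real_normK ?num_real.
apply: (le_trans (sum_sqr_le _ _)); first by move=> ks; rewrite mulr_ge0// amp_ge0.
have sum0 : 0 <= \sum_(ks <- indices n) `|monomial ks w| * amp pM qM w.
  by apply: sumr_ge0 => ks _; rewrite mulr_ge0// amp_ge0.
have weight0 : 0 <= weight w * amp pM qM w by rewrite mulr_ge0// amp_ge0.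
rewrite lerXn2r ?nnegrE//.
by rewrite -mulr_suml ler_wpM2r ?amp_ge0// sum_monomials_le.
Qed.

Let tail_sum : \sum_(ks <- indices n) tail ks ^+ 2 <= (\int[lam]_w (weight w * amp pT qT w)) ^+ 2.
Proof.
have tail0 ks : 0 <= tail ks.
  by apply: Rintegral_ge0 => // w _; rewrite mulr_ge0// amp_ge0.
apply: (le_trans (sum_sqr_le _ _)) => //.
rewrite lerXn2r ?nnegrE ?sumr_ge0//.
  by apply: Rintegral_ge0 => // w _; rewrite mulr_ge0// amp_ge0.
pose F (ks : seq 'I_n) w := if (size ks <= 2)%N then `|monomial ks w| * amp pT qT w else 0.
have iF ks : lam.-L1 (F ks).
  by rewrite /F; have [k2|_] := boolP (size ks <= 2)%N; [exact: itail|exact: integrable0].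
rewrite (eq_big_seq (fun ks => \int[lam]_w F ks w)); last first.
  by move=> ks /size_indices k2; rewrite /F k2.
rewrite -Rintegral_sum//; apply: le_Rintegral => //; first exact: integrable_sumR.
move=> w _; rewrite (eq_big_seq (fun ks => `|monomial ks w| * amp pT qT w)); last first.
  by move=> ks /size_indices k2; rewrite /F k2.
by rewrite -mulr_suml ler_wpM2r ?amp_ge0// sum_monomials_le.
Qed.

(** The squares of the weighted amplitudes of the single derivatives add up to
    at most the square of their sum, hence the weight (1 + |w|) ^ 2 in both
    terms. *)
Lemma expected_error_le :
  (\int[P]_t H2_normsq Omega (f \- random_net (coefs t) (fun i => W i t) (fun i => B i t))%R <=
   (2 * (m%:R^-1 * (err_const * V * M *
           \int[lam]_w (((1 + l1norm w) ^+ 2 * amp pM qM w) ^+ 2)) +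
         (\int[lam]_w ((1 + l1norm w) ^+ 2 * amp pT qT w)) ^+ 2))%:E)%E.
Proof.
pose Z ks t : \bar R := (\int[lam]_(x in Omega) ((superposition p q ks x -
  dnet (coefs t) (fun i => W i t) (fun i => B i t) ks x) ^+ 2)%:E)%E.
have Z0 ks t : (0 <= Z ks t)%E by apply: integral_ge0 => x _; rewrite lee_fin sqr_ge0.
apply: (@le_trans _ _ (\int[P]_t \sum_(ks <- indices n) Z ks t)%E).
  apply: ge0_le_integral_lower => t; last exact: H2_normsq_error.
  apply: le_ereal_inf_tmp => _ [D1 [D2 [_ _ ->]]].
  apply: adde_ge0; first apply: adde_ge0.
  - by apply: integral_ge0 => x _; rewrite lee_fin sqr_ge0.
  - by apply: sume_ge0 => k _; apply: integral_ge0 => x _; rewrite lee_fin sqr_ge0.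
  - apply: sume_ge0 => k _; apply: sume_ge0 => l _.
    by apply: integral_ge0 => x _; rewrite lee_fin sqr_ge0.
pose Z' ks := if (size ks <= 2)%N then Z ks else cst 0%E.
have mZ ks : measurable_fun setT (Z' ks).
  rewrite /Z'; case: ifPn => [k2|_]; last exact: measurable_cst.
  rewrite (_ : Z ks = fubini_F lam (G ks)); last by apply/funext => t; rewrite /Z integral_G.
  exact: measurable_fun_fubini_tonelli_F (mG k2) (G0 ks).
rewrite (eq_integral (fun t => \sum_(ks <- indices n) Z' ks t)%E); last first.
  by move=> t _; apply: eq_big_seq => ks /size_indices k2; rewrite /Z' k2.
rewrite ge0_integral_sum//; last by move=> ks t _; rewrite /Z'; case: ifPn.
apply: (@le_trans _ _ (\sum_(ks <- indices n) (2 * (m%:R^-1 * (err_const * V * M * low ks) + tail ks ^+ 2))%:E)%E).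
  rewrite big_seq [leRHS]big_seq; apply: lee_sum => ks /size_indices k2.
  by rewrite /Z' k2; exact: averaged.
rewrite sumEFin lee_fin -mulr_sumr ler_wpM2l//.
rewrite big_split/=; apply: lerD; last exact: tail_sum.
rewrite -!mulr_sumr.
rewrite ler_wpM2l ?invr_ge0// ler_wpM2l//.
rewrite mulr_ge0 ?(le_trans _ M2)// mulr_ge0 ?fine_ge0//.
by rewrite divr_ge0 ?sqr_ge0// mulr_ge0// sqr_ge0.
Qed.

End expected_error.

(** * The Fourier transform and the Barron norm *)

Section complex_fourier.
Context (R : realType) (n : nat) (g : 'rV[R]_n -> R[i]).
Local Notation lam := (lebesgue_rV R n).
Local Notation u := (fun x => complex.Re (g x)).
Local Notation v := (fun x => complex.Im (g x)).

Lemma fourierE w : fourier g w = Complex (fourier_re u v w) (fourier_im u v w).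
Proof.
rewrite /fourier /fourier_re /fourier_im /Cintegral /=.
rewrite [RHS](_ : _ = ((2 * pi) ^- n)%:C%C *
  Complex (\int[lam]_x (u x * cos (dot w x) + v x * sin (dot w x)))
          (\int[lam]_x (v x * cos (dot w x) - u x * sin (dot w x)))); last first.
  by rewrite /GRing.mul/= !mul0r subr0 addr0.
congr (_ * Complex _ _); apply: eq_Rintegral => x _; rewrite /expi; case: (g x) => a b.
  by rewrite /GRing.mul/= cosN sinN mulrN opprK.
by rewrite /GRing.mul/= cosN sinN mulrN addrC.
Qed.

Lemma normc_fourier w : Normc.normc (fourier g w) = amp (fourier_re u v) (fourier_im u v) w.
Proof. by rewrite fourierE. Qed.

Lemma barron_integralE s : barron_integral s g =
  (\int[lam]_w ((1 + l1norm w) `^ s * amp (fourier_re u v) (fourier_im u v) w)%:E)%E.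
Proof. by apply: eq_integral => w _; rewrite normc_fourier. Qed.

Hypothesis ig : Cintegrable g.

(** The transform of an integrable function is bounded, and it stays almost
    everywhere below its essential supremum. *)
Lemma fourier_Linfty_fin : (0 < lam setT)%E -> exists2 L : R,
  fourier_Linfty g = L%:E /\ 0 <= L &
  {ae lam, forall w, amp (fourier_re u v) (fourier_im u v) w <= L}.
Proof.
move=> mu0; case: ig => iu iv.
pose K : R := (2 * pi) ^- n * (\int[lam]_y `|u y| + \int[lam]_y `|v y|).
have LE : fourier_Linfty g = ess_sup lam (fun w => (amp (fourier_re u v) (fourier_im u v) w)%:E).
  rewrite /fourier_Linfty (_ : (fun w => _) =
    fun w => (amp (fourier_re u v) (fourier_im u v) w)%:E); last first.
    by apply/funext => w; rewrite normc_fourier.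
  rewrite unlock mu0; congr (ess_sup _ _); apply/funext => w /=.
  by rewrite ger0_norm ?amp_ge0.
have Lle : (fourier_Linfty g <= (K + K)%:E)%E.
  rewrite LE; apply/ess_supP; apply: aeW => w; rewrite lee_fin.
  have a1 := wave_le iu iv w 0; have a2 := wave_le iu iv w (- (pi / 2)).
  rewrite /wave cos0 sin0 mulr0 subr0 mulr1 in a1.
  rewrite /wave cosN cos_pihalf sinN sin_pihalf mulr0 mulrN1 opprK add0r in a2.
  have ampD (a b : R) : Num.sqrt (a ^+ 2 + b ^+ 2) <= `|a| + `|b|.
    rewrite -[leRHS]ger0_norm ?addr_ge0// -sqrtr_sqr ler_wsqrtr// sqrrD !real_normK ?num_real//.
    by rewrite lerD2r lerDl mulrn_wge0// mulr_ge0.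
  by apply: (le_trans (ampD _ _)); exact: lerD.
have L0 : (0 <= fourier_Linfty g)%E by exact: Lnorm_ge0.
have := ess_sup_ge lam (fun w => (amp (fourier_re u v) (fourier_im u v) w)%:E).
rewrite -LE; case: (fourier_Linfty g) L0 Lle => // L L0 _ h; exists L => //.
Qed.

End complex_fourier.

Lemma weight_powR (R : realType) n (w : 'rV[R]_n) (k : nat) (s : R) : k%:R <= s ->
  (1 + l1norm w) ^+ k <= (1 + l1norm w) `^ s.
Proof.
move=> ks; have w0 := l1norm_ge0 w.
by rewrite -powR_mulrn ?addr_ge0// ler_powR// lerDl.
Qed.

(** The exponent 4 is raised to 6 = (6 - s) + s. As M is at least 2, 1 + |w|
    is at most (3 / 2) M on the ball, and (3 / 2) ^ (6 - s) is at most (3 / 2)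
    ^ 3. *)
Lemma low_weight (R : realType) n (w : 'rV[R]_n) (s M : R) : 2 <= M -> 3 < s < 6 ->
  l1norm w <= M ->
  (1 + l1norm w) ^+ 4 <= (3 / 2) ^+ 3 * M `^ (6 - s) * (1 + l1norm w) `^ s.
Proof.
move=> M2 /andP[s3 s6] wM; have w0 := l1norm_ge0 w.
have w1 : 0 < 1 + l1norm w by rewrite ltr_pwDl.
apply: (@le_trans _ _ ((1 + l1norm w) `^ 6)).
  by rewrite -powR_mulrn ?(ltW w1)// ler_powR ?lerDl// ler_nat.
rewrite [X in _ `^ X <= _](_ : 6 = (6 - s) + s); last by ring.
rewrite powRD; last by apply/implyP => _; rewrite gt_eqF.
rewrite ler_wpM2r ?powR_ge0//; apply: (@le_trans _ _ ((3 / 2 * M) `^ (6 - s))).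
  by apply: ge0_ler_powR; rewrite ?nnegrE ?(ltW w1) ?subr_ge0 ?(ltW s6)//; lra.
have M0 : 0 <= M by lra.
have h0 : (0 : R) <= 3 / 2 by rewrite divr_ge0.
rewrite powRM// ler_wpM2r ?powR_ge0// -powR_mulrn// ler_powR//; lra.
Qed.

Lemma tail_weight (R : realType) n (w : 'rV[R]_n) (s M : R) : 2 <= M -> 3 < s ->
  M < l1norm w ->
  M `^ (s - 3) * (1 + l1norm w) ^+ 2 <= (1 + l1norm w) `^ s.
Proof.
move=> M2 s3 wM; have w0 := l1norm_ge0 w.
have w1 : 0 < 1 + l1norm w by rewrite ltr_pwDl.
rewrite [in leRHS](_ : s = (s - 3) + 3); last by ring.
rewrite [leRHS]powRD; last by apply/implyP => _; rewrite gt_eqF.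
rewrite ler_pM ?powR_ge0 ?exprn_ge0 ?(ltW w1)//.
  by apply: ge0_ler_powR; rewrite ?nnegrE ?(ltW w1) ?subr_ge0 ?(ltW s3)//; lra.
by rewrite powR_mulrn ?(ltW w1)// ler_weXn2l// lerDl.
Qed.

Section random_coefficients.
Context (R : realType) (n : nat) (M : R) (p q : 'rV[R]_n -> R).
Context (disp : measure_display) (T : measurableType disp) (P : probability T R) (m : nat).
Variables (W : 'I_m -> {RV P >-> 'rV[R]_n}) (B : 'I_m -> {RV P >-> R}).
Hypotheses (mp : measurable_fun setT p) (mq : measurable_fun setT q).

Lemma coefs_measurable S : measurable S -> sigma_joint W B (coefs M p q W B @^-1` S).
Proof.
move=> mS; pose T' := g_sigma_algebraType (g_sigma_preimage W `|` g_sigma_preimage B).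
have mW i : measurable_fun setT (W i : T' -> 'rV[R]_n).
  move=> _ A mA; rewrite setTI; apply: sub_sigma_algebra; left.
  exact: (@g_sigma_preimage_sub _ _ _ _ _ W).
have mB i : measurable_fun setT (B i : T' -> R).
  move=> _ A mA; rewrite setTI; apply: sub_sigma_algebra; right.
  exact: (@g_sigma_preimage_sub _ _ _ _ _ B).
have mA : measurable_fun setT (coefs M p q W B : T' -> 'rV[R]_m).
  apply: measurable_fun_rVP => i.
  rewrite (_ : _ \o _ = fun t : T' => coef (fine (lebesgue_rV R n (l1ball n M)) * (4 * M) / spline_hat R)
     (fun w => \1_(l1ball n M) w * p w) (fun w => \1_(l1ball n M) w * q w) (W i t) (B i t)).
    have mi : measurable_fun setT (\1_(l1ball n M) : 'rV[R]_n -> R).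
      exact: measurable_indic (@measurable_l1ball R n M).
    by apply: measurable_coef => //; apply: measurable_funM.
  by apply/funext => t; rewrite /rV_coord /= mxE.
by have := mA measurableT S mS; rewrite setTI.
Qed.

Lemma coefs_le L t i : 0 <= M -> (forall w, amp p q w <= L) ->
  `|coefs M p q W B t ord0 i| <=
  fine (lebesgue_rV R n (l1ball n M)) * (4 * M) / spline_hat R * L.
Proof.
move=> M0 ampL; rewrite mxE /coef normrM ler_pM//.
  by rewrite ger0_norm// divr_ge0 ?(ltW (spline_hat_gt0 _))// mulr_ge0 ?fine_ge0 ?mulr_ge0.
apply: (le_trans (wave_le_amp _ _ _ _)); rewrite amp_indic.
apply: le_trans (ampL (W i t)); by rewrite ler_piMl ?amp_ge0.
Qed.

End random_coefficients.

(** * Low and high frequencies *)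

Section spectral_bounds.
Context (R : realType) (n : nat) (s M L : R) (p q : 'rV[R]_n -> R).
Local Notation lam := (lebesgue_rV R n).
Hypotheses (M2 : (2 : R) <= M) (s3 : (3 : R) < s).
Hypotheses (mp : measurable_fun setT p) (mq : measurable_fun setT q).
Hypothesis ampL : forall w, amp p q w <= L.
Hypothesis is_ : lam.-L1 (fun w => (1 + l1norm w) `^ s * amp p q w).

Let J : R := \int[lam]_w ((1 + l1norm w) `^ s * amp p q w).
Let ball := l1ball n M.

Let mweight : measurable_fun setT (fun w : 'rV[R]_n => 1 + l1norm w).
Proof. by apply: measurable_funD => //; exact: measurable_l1norm. Qed.

Lemma integrable_weight2 :
  lam.-L1 (fun w => (1 + l1norm w) ^+ 2 * amp p q w).
Proof.
apply: (integrable_le _ is_).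
  by apply: measurable_funM; [exact: measurable_funX|exact: measurable_amp].
move=> w; have w0 := l1norm_ge0 w.
rewrite ger0_norm ?mulr_ge0 ?amp_ge0 ?exprn_ge0 ?addr_ge0//.
by rewrite ler_wpM2r ?amp_ge0// weight_powR//; move: s3; lra.
Qed.

(** One of the two factors of the squared amplitude is bounded by L, the other
    is left to the Barron norm. *)
Lemma low_frequencies_le (K : R) : 0 <= K ->
  (forall w : 'rV[R]_n, l1norm w <= M -> (1 + l1norm w) ^+ 4 <= K * (1 + l1norm w) `^ s) ->
  \int[lam]_w (((1 + l1norm w) ^+ 2 * amp (fun w => \1_ball w * p w) (fun w => \1_ball w * q w) w) ^+ 2)
  <= L * K * J.
Proof.
move=> K0 hK; rewrite -RintegralZl//.
have mball := @measurable_l1ball R n M.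
have L0 : 0 <= L by exact: le_trans (amp_ge0 p q 0) (ampL 0).
have le w : ((1 + l1norm w) ^+ 2 * amp (fun w => \1_ball w * p w) (fun w => \1_ball w * q w) w) ^+ 2 <=
    L * K * ((1 + l1norm w) `^ s * amp p q w).
  have a0 := amp_ge0 p q w.
  have r0 : 0 <= L * K * ((1 + l1norm w) `^ s * amp p q w) by rewrite !mulr_ge0 ?powR_ge0.
  rewrite amp_indic indicE; have [wM|wM] := leP (l1norm w) M; last first.
    by rewrite memNset ?mul0r ?mulr0 ?expr0n//= => h; move: wM; rewrite ltNge h.
  rewrite mem_set// mul1r.
  rewrite [leLHS](_ : _ = (1 + l1norm w) ^+ 4 * (amp p q w * amp p q w)); last by ring.
  rewrite [leRHS](_ : _ = (K * (1 + l1norm w) `^ s) * (L * amp p q w)); last by ring.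
  rewrite ler_pM ?mulr_ge0 ?hK ?exprn_ge0 ?addr_ge0 ?l1norm_ge0// ler_wpM2r//.
apply: le_Rintegral => //; last exact: integrableZR.
apply: (integrable_le _ (integrableZR (L * K) measurableT is_)).
  apply: measurable_funX; apply: measurable_funM; first exact: measurable_funX.
  by apply: measurable_amp; apply: measurable_funM => //; exact: measurable_indic.
by move=> w; rewrite ger0_norm ?sqr_ge0.
Qed.

Lemma high_frequencies_le :
  \int[lam]_w ((1 + l1norm w) ^+ 2 *
    amp (fun w => \1_(~` ball) w * p w) (fun w => \1_(~` ball) w * q w) w)
  <= (M `^ (s - 3))^-1 * J.
Proof.
rewrite -RintegralZl//.
have mball := measurableC (@measurable_l1ball R n M).
have MS : 0 < M `^ (s - 3) by rewrite powR_gt0//; exact: lt_le_trans M2.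
have le w : (1 + l1norm w) ^+ 2 *
    amp (fun w => \1_(~` ball) w * p w) (fun w => \1_(~` ball) w * q w) w <=
    (M `^ (s - 3))^-1 * ((1 + l1norm w) `^ s * amp p q w).
  have a0 := amp_ge0 p q w.
  have r0 : 0 <= (M `^ (s - 3))^-1 * ((1 + l1norm w) `^ s * amp p q w).
    by rewrite mulr_ge0 ?invr_ge0 ?(ltW MS)// mulr_ge0 ?powR_ge0.
  rewrite amp_indic indicE; have [wM|wM] := leP (l1norm w) M.
    by rewrite memNset ?mul0r ?mulr0.
  rewrite mem_set; last by move=> /= h; move: wM; rewrite ltNge h.
  by rewrite mul1r mulrA ler_wpM2r// ler_pdivlMl// tail_weight.
apply: le_Rintegral => //; last exact: integrableZR.
apply: (integrable_le _ (integrableZR (M `^ (s - 3))^-1 measurableT is_)).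
  apply: measurable_funM; first exact: measurable_funX.
  by apply: measurable_amp; apply: measurable_funM => //; exact: measurable_indic.
by move=> w; rewrite ger0_norm ?mulr_ge0 ?amp_ge0 ?exprn_ge0 ?addr_ge0 ?l1norm_ge0.
Qed.

End spectral_bounds.

(** * The approximation theorem *)

Lemma collect_bounds (R : realType) (m d : nat) (ec h V M L b K K' y low high : R) :
  (0 < m)%N -> 0 <= ec -> 0 < h -> 0 <= V -> V <= 2 * M ^+ d -> 0 <= M -> 0 <= L -> 0 <= b ->
  0 <= K' -> K <= (3 / 2) ^+ 3 * K' -> 0 <= low -> low <= L * K * b ->
  0 <= high -> high <= y ->
  2 * (m%:R^-1 * (ec * V * M * low) + high ^+ 2) <=
  (14 * ec + 2 + 8 / h) * (M ^+ d.+1 * K' / m%:R * b * L + y ^+ 2).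
Proof.
move=> m0 ec0 h0 V0 VM M0 L0 b0 K'0 KK' low0 lowK high0 highy.
set X := M ^+ d.+1 * K' / m%:R * b * L.
have Mn k : 0 <= M ^+ k by exact: exprn_ge0.
have X0 : 0 <= X by rewrite !mulr_ge0 ?invr_ge0.
have Y0 : 0 <= y ^+ 2 by exact: sqr_ge0.
have highY : high ^+ 2 <= y ^+ 2 by rewrite lerXn2r ?nnegrE// (le_trans high0).
have lowX : 2 * (m%:R^-1 * (ec * V * M * low)) <= 27 / 2 * ec * X.
  apply: (@le_trans _ _ (2 * (m%:R^-1 * (ec * (2 * M ^+ d) * M * (L * ((3 / 2) ^+ 3 * K') * b))))).
    rewrite ler_wpM2l// ler_wpM2l ?invr_ge0//.
    apply: ler_pM; rewrite ?mulr_ge0//.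
      by rewrite ler_wpM2r// ler_wpM2l.
    by apply: (le_trans lowK); rewrite ler_wpM2r// ler_wpM2l.
  rewrite le_eqVlt; apply/orP; left; apply/eqP; rewrite /X [M ^+ d.+1]exprS.
  by field; rewrite pnatr_eq0 -lt0n.
have CX : 27 / 2 * ec * X <= 14 * ec * X.
  by rewrite ler_wpM2r// ler_wpM2r//; lra.
have hX : 0 <= 8 / h * (X + y ^+ 2) by rewrite mulr_ge0 ?addr_ge0// divr_ge0// ltW.
have eY : 0 <= 14 * ec * y ^+ 2 by rewrite mulr_ge0// mulr_ge0.
rewrite [leLHS](_ : _ = 2 * (m%:R^-1 * (ec * V * M * low)) + 2 * high ^+ 2); last by ring.
rewrite [leRHS](_ : _ = 14 * ec * X + 8 / h * (X + y ^+ 2) + 14 * ec * y ^+ 2 + 2 * X + 2 * y ^+ 2); last by ring.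
lra.
Qed.

Theorem theorem1 (R : realType) :
  exists C : R, 0 < C /\
  forall (d m : nat) (s M : R) (Omega : set 'rV[R]_d) (f : 'rV[R]_d -> R)
    (fe : 'rV[R]_d -> R[i])
    (disp : measure_display) (T : measurableType disp) (P : probability T R)
    (W : 'I_m -> {RV P >-> 'rV[R]_d}) (B : 'I_m -> {RV P >-> R}),
  (0 < d)%N -> (0 < m)%N -> 3 < s -> 2 <= M ->
  open Omega ->
  Omega `<=` [set x : 'rV[R]_d | forall k, 0 <= x ord0 k <= 1] ->
  in_barron s Omega (fun x => (f x)%:C%C) ->
  L1_extension Omega (fun x => (f x)%:C%C) fe ->
  barron_integral s fe = barron_norm s Omega (fun x => (f x)%:C%C) ->
  (forall i, uniformly_distributed (W i) (lebesgue_rV R d)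
     [set w : 'rV[R]_d | l1norm w <= M]) ->
  (forall i, uniformly_distributed (B i) lebesgue_measure
     [set b : R | `|b| <= 2 * M]) ->
  mutually_independent W ->
  mutually_independent B ->
  independent_sigma_algebras P (g_sigma_preimage W) (g_sigma_preimage B) ->
  let Bnorm := barron_norm s Omega (fun x => (f x)%:C%C) in
  exists A : T -> 'rV[R]_m,
  let fm t := random_net (A t) (fun i => W i t) (fun i => B i t) in
  let err := (\int[P]_t H2_normsq Omega (f \- fm t)%R)%E in
  [/\ (forall S : set 'rV[R]_m, measurable S ->
         sigma_joint W B (A @^-1` S)),
      ((s < 6)%R ->
         err <= C%:E * ((M `^ (d%:R + 7 - s) / m%:R)%:E * Bnorm *
                          fourier_Linfty fe
                        + ((M `^ (s - 3))^-1%:E * Bnorm) ^+ 2))%E,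
      ((6 <= s)%R ->
         err <= C%:E * ((M ^+ d.+1 / m%:R)%:E * Bnorm * fourier_Linfty fe
                        + ((M `^ (s - 3))^-1%:E * Bnorm) ^+ 2))%E &
      (forall t i, `|A t ord0 i|%:E <=
                     C%:E * fourier_Linfty fe * (M ^+ d.+1)%:E)%E].
Proof.
have ec0 : 0 <= err_const R by rewrite divr_ge0 ?sqr_ge0// mulr_ge0// sqr_ge0.
have h0 := spline_hat_gt0 R.
(* 14 is at least 4 * (3 / 2) ^ 3, where 4 comes from 2 * V <= 4 * M ^ d; the last
   term is what the bound on the coefficients needs *)
pose C : R := 14 * err_const R + 2 + 8 / spline_hat R.
have C0 : 0 < C.
  by rewrite ltr_pwDl ?divr_ge0 ?(ltW h0)// ltr_wpDl// mulr_ge0.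
exists C; split => //.
case=> // d m s M Omega f fe disp T P W B _ m0 s3 M2 oO O1 finB [ig fef] BE lawW lawB indW indB indWB Bnorm.
set lam := lebesgue_rV R d.+1.
have M0 : 0 <= M by lra.
pose u x := complex.Re (fe x); pose v x := complex.Im (fe x).
pose p0 := fourier_re u v; pose q0 := fourier_im u v.
have [iu iv] := ig.
have mp0 : measurable_fun setT p0 := measurable_fourier_re iu iv.
have mq0 : measurable_fun setT q0 := measurable_fourier_im iu iv.
have [V V0 VE] := uniform_law_volume (Q := distribution P (W (Ordinal m0))) (fun S mS => lawW _ S mS).
have mu0 : (0 < lam setT)%E.
  by apply: (@lt_le_trans _ _ V%:E); rewrite ?lte_fin// -VE le_measure ?inE//; exact: measurable_l1ball.
have [L [LE L0] aeL] := fourier_Linfty_fin ig mu0.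
(* The transform is replaced by 0 on the null set where it exceeds its essential
   supremum L, so that the coefficients are bounded at every sample. *)
pose G : set 'rV[R]_d.+1 := [set w | amp p0 q0 w <= L].
have mG : measurable G.
  have := measurable_amp mp0 mq0 measurableT (measurable_itv `]-oo, L]).
  by rewrite setTI; congr measurable; apply/seteqP; split => w /=; rewrite in_itv.
have m1G : measurable_fun setT (\1_G : 'rV[R]_d.+1 -> R) by exact: measurable_indic.
pose p w := \1_G w * p0 w; pose q w := \1_G w * q0 w.
have mp : measurable_fun setT p by exact: measurable_funM.
have mq : measurable_fun setT q by exact: measurable_funM.
have ampL w : amp p q w <= L.
  rewrite amp_indic indicE; have [wG|wG] := pselect (G w).
    by rewrite mem_set// mul1r.
  by rewrite memNset// mul0r.
have amp_le w : amp p q w <= amp p0 q0 w.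
  by rewrite amp_indic ler_piMl ?amp_ge0.
have ms : measurable_fun setT (fun w : 'rV[R]_d.+1 => (1 + l1norm w) `^ s).
  apply: (measurableT_comp (f := fun r : R => r `^ s)); first exact: measurable_powR.
  by apply: measurable_funD => //; exact: measurable_l1norm.
have is0 : lam.-L1 (fun w => (1 + l1norm w) `^ s * amp p0 q0 w).
  apply/integrableP; split.
    by apply/measurable_EFinP; apply: measurable_funM => //; exact: measurable_amp.
  under eq_integral do rewrite /= ger0_norm ?mulr_ge0 ?powR_ge0 ?amp_ge0//.
  by rewrite -barron_integralE BE.
pose b : R := \int[lam]_w ((1 + l1norm w) `^ s * amp p0 q0 w).
have bE : Bnorm = b%:E by rewrite EFin_Rintegral// -barron_integralE BE.
have is_ : lam.-L1 (fun w => (1 + l1norm w) `^ s * amp p q w).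
  apply: (integrable_le _ is0); first by apply: measurable_funM => //; exact: measurable_amp.
  by move=> w; rewrite ger0_norm ?mulr_ge0 ?powR_ge0 ?amp_ge0// ler_wpM2l ?powR_ge0.
have Jb : \int[lam]_w ((1 + l1norm w) `^ s * amp p q w) <= b.
  by apply: le_Rintegral => // w _; rewrite ler_wpM2l ?powR_ge0.
have J0 : 0 <= \int[lam]_w ((1 + l1norm w) `^ s * amp p q w).
  by apply: Rintegral_ge0 => // w _; rewrite mulr_ge0 ?powR_ge0 ?amp_ge0.
have b0 : 0 <= b by exact: le_trans J0 Jb.
have ia0 := integrable_weight2 s3 mp0 mq0 is0.
have ia := integrable_weight2 s3 mp mq is_.
have i_le (r : 'rV[R]_d.+1 -> R) : measurable_fun setT r -> (forall w, `|r w| <= amp p0 q0 w) ->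
    lam.-L1 r.
  move=> mr ramp; apply: (integrable_le _ ia0) => // w; apply: (le_trans (ramp w)).
  by rewrite ler_peMl ?amp_ge0// exprn_ege1// lerDl l1norm_ge0.
have ip0 : lam.-L1 p0.
  apply: i_le => // w; rewrite -sqrtr_sqr ler_wsqrtr// lerDl sqr_ge0//.
have iq0 : lam.-L1 q0.
  apply: i_le => // w; rewrite -sqrtr_sqr ler_wsqrtr// lerDr sqr_ge0//.
have inv := fourier_inversion iu iv ip0 iq0 O1.
have fu x : Omega x -> f x = u x by move=> Ox; rewrite /u fef.
have mO := open_measurable_rV oO.
have mf : measurable_fun Omega f.
  apply: (@eq_measurable_fun _ _ _ _ _ u); first by move=> x; rewrite inE => /fu.
  by apply: measurable_funTS; apply/measurable_EFinP; exact: measurable_int iu.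
have fs : {ae lam, forall x, Omega x -> f x = superposition p q [::] x}.
  move: inv; apply: filterS => x h Ox; transitivity (inverse_fourier u v x).
    by rewrite fu//; exact: h.
  rewrite /superposition /inverse_fourier.
  apply: ae_eq_Rintegral => //.
  - by apply: measurable_wave => //; exact: measurable_dot.
  - exact: measurable_dwave.
  - move: aeL; apply: filterS => w wL _.
    rewrite /dwave /monomial big_nil mul1r mul0r addr0 /wave /p /q indicE mem_set//.
    by rewrite !mul1r.
have err := expected_error_le M2 oO O1 mp mq ia ampL mf fs m0 lawW lawB indW indB indWB.
rewrite [fine _](_ : _ = V) in err; last by rewrite [lebesgue_rV _ _ _]VE.
have VM : V <= 2 * M ^+ d.+1.
  by have := @l1ball_volume_le R d M M0; rewrite [X in (X <= _)%E]VE lee_fin.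
have high : \int[lam]_w ((1 + l1norm w) ^+ 2 *
    amp (fun w => \1_(~` (l1ball d.+1 M)) w * p w) (fun w => \1_(~` (l1ball d.+1 M)) w * q w) w)
    <= (M `^ (s - 3))^-1 * b.
  apply: (le_trans (high_frequencies_le M2 s3 mp mq is_)).
  by rewrite ler_wpM2l// invr_ge0 powR_ge0.
have low K : 0 <= K ->
    (forall w : 'rV[R]_d.+1, l1norm w <= M -> (1 + l1norm w) ^+ 4 <= K * (1 + l1norm w) `^ s) ->
    \int[lam]_w (((1 + l1norm w) ^+ 2 * amp (fun w => \1_(l1ball d.+1 M) w * p w)
      (fun w => \1_(l1ball d.+1 M) w * q w) w) ^+ 2) <= L * K * b.
  move=> K0 hK; apply: (le_trans (low_frequencies_le mp mq ampL is_ K0 hK)).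
  by rewrite ler_wpM2l// mulr_ge0.
have bound (K K' : R) : 0 <= K' -> K <= (3 / 2) ^+ 3 * K' -> 0 <= K ->
    (forall w : 'rV[R]_d.+1, l1norm w <= M -> (1 + l1norm w) ^+ 4 <= K * (1 + l1norm w) `^ s) ->
  (\int[P]_t H2_normsq Omega
      (f \- random_net (coefs M p q W B t) (fun i => W i t) (fun i => B i t))%R
   <= C%:E * ((M ^+ d.+2 * K' / m%:R)%:E * Bnorm * fourier_Linfty fe
                        + ((M `^ (s - 3))^-1%:E * Bnorm) ^+ 2))%E.
  move=> K'0 KK' K0 hK; apply: (le_trans err).
  rewrite bE LE [X in (_ <= X)%E](_ : _ = (C * (M ^+ d.+2 * K' / m%:R * b * L +
    ((M `^ (s - 3))^-1 * b) ^+ 2))%:E)//= lee_fin.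
  apply: (collect_bounds (K := K)) => //.
  - exact: ltW.
  - by apply: Rintegral_ge0 => // w _; exact: sqr_ge0.
  - exact: low.
  - apply: Rintegral_ge0 => // w _; rewrite mulr_ge0 ?amp_ge0// exprn_ge0// addr_ge0//.
    exact: l1norm_ge0.
exists (coefs M p q W B); split.
- by move=> S mS; exact: coefs_measurable.
- move=> s6; have s36 : 3 < s < 6 by rewrite s3.
  have := bound ((3 / 2) ^+ 3 * M `^ (6 - s)) (M `^ (6 - s)).
  move=> /(_ (powR_ge0 _ _) (lexx _)).
  rewrite (_ : M ^+ d.+2 * M `^ (6 - s) = M `^ (d.+1%:R + 7 - s)); last first.
    rewrite -powR_mulrn// -powRD; last by apply/implyP => _; rewrite gt_eqF//; lra.
    by congr (_ `^ _); rewrite -[d.+2]addn1 natrD; ring.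
  apply; first by rewrite mulr_ge0 ?powR_ge0// exprn_ge0// divr_ge0.
  by move=> w wM; exact: low_weight.
- move=> s6; have := bound 1 1 ler01.
  rewrite mulr1; apply => //.
  + by rewrite exprS !mulr1; lra.
  + by move=> w _; rewrite mul1r; apply: weight_powR; apply: le_trans s6; rewrite ler_nat.
- move=> t i; rewrite LE -!EFinM lee_fin.
  apply: (le_trans (coefs_le W B t i M0 ampL)).
  rewrite [fine _](_ : _ = V); last by rewrite [lebesgue_rV _ _ _]VE.
  set z := M ^+ d.+1 in VM *.
  apply: (@le_trans _ _ ((8 / spline_hat R) * L * (M * z))).
    rewrite [leRHS](_ : _ = (2 * z * (4 * M) / spline_hat R) * L); last by field; rewrite gt_eqF.
    by rewrite ler_wpM2r// ler_wpM2r ?invr_ge0 ?(ltW h0)// ler_wpM2r// mulr_ge0.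
  have z0 : 0 <= M * z by rewrite mulr_ge0// exprn_ge0.
  rewrite [M ^+ d.+2]exprS -/z ler_wpM2r// ler_wpM2r//.
  by rewrite /C lerDr addr_ge0// mulr_ge0.
Qed.
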